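(* Let $\mathfrak g$ be a finite-dimensional complex Lie algebra without proper semi-invariants, with $\operatorname{ind}\mathfrak g=1$ and with nonconstant fundamental semi-invariant $p_{\mathfrak g}$. Put $k=\tfrac12(\dim\mathfrak g+\operatorname{ind}\mathfrak g)-\deg p_{\mathfrak g}$. Then: (1) the algebra of invariant polynomials is a polynomial algebra $\mathbb C[\mathfrak g^*]^{\mathfrak g}=\mathbb C[f]$ with $\deg f=k$, and $p_{\mathfrak g}=c f^d$ for some $c\in\mathbb C$, $d\in\mathbb N$; (2) the Jordan–Kronecker invariants of $\mathfrak g$ consist of one Kronecker $(2k-1)\times(2k-1)$ block and $k$ equal Jordan tuples $J_{\lambda_i}(2n_1,\dots,2n_s)$, $i=1,\dots,k$, where $n_1+\dots+n_s=d=\deg p_{\mathfrak g}/\deg f$.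
   Context: Identify the symmetric algebra $S(\mathfrak g)$ with polynomials on $\mathfrak g^*$, with Lie–Poisson bracket $\{f,g\}(x)=\langle x,[df(x),dg(x)]\rangle$. A nonzero $f\in S(\mathfrak g)$ is a semi-invariant of weight $\chi_f\in\mathfrak g^*$ if $\{g,f\}(x)=\chi_f(dg(x))f(x)$ for all $g$; it is an invariant if $\chi_f=0$, and $\mathfrak g$ has no proper semi-invariants if every semi-invariant is an invariant. $\mathbb C[\mathfrak g^*]^{\mathfrak g}$ is the algebra of invariant polynomials. For $x\in\mathfrak g^*$ let $\mathcal A_x=(\sum_kc^k_{ij}x_k)$ be the matrix of $(\xi,\eta)\mapsto\langle x,[\xi,\eta]\rangle$ in a basis with structure constants $c^k_{ij}$. The index $\operatorname{ind}\mathfrak g=\dim\mathfrak g-\max_x\operatorname{rk}\mathcal A_x$. The fundamental semi-invariant $p_{\mathfrak g}$ is the greatest common divisor of the Pfaffians of all principal submatrices of $\mathcal A_x$ of order $\dim\mathfrak g-\operatorname{ind}\mathfrak g$ (a polynomial in $x$, defined up to a scalar). JK invariants: by the Jordan–Kronecker theorem a pair of skew forms on a finite-dimensional complex space decomposes into Jordan $2n\times2n$ blocks with eigenvalues $\mu\in\mathbb C\cup\{\infty\}$ and Kronecker $(2k-1)\times(2k-1)$ blocks, uniquely up to order; the JK invariants of $\mathfrak g$ are the Kronecker sizes and Jordan tuples $J_{\lambda_i}(2n_{i1},\dots,2n_{is_i})$ (sizes of Jordan blocks with common eigenvalue $\lambda_i$) of $(\mathcal A_x,\mathcal A_a)$ for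 $(x,a)$ in a nonempty Zariski open subset of $\mathfrak g^*\times\mathfrak g^*$. Two Jordan tuples are equal if they have the same list of sizes. *)

(* Defs.v *)
From HB Require Import structures.
From mathcomp Require Import all_boot all_order all_algebra all_fingroup.
From mathcomp Require Import reals complex.
From mathcomp Require Import mpoly.

Set Implicit Arguments.
Unset Strict Implicit.
Unset Printing Implicit Defensive.

Import Order.TTheory GRing.Theory Num.Theory.
Local Open Scope ring_scope.

Section LieDefs.
Variables (F : fieldType) (n : nat).

(* A Lie algebra g with basis e_0..e_{n-1} is given by its structure constants
   c i j k = c^k_{ij}, i.e. [e_i, e_j] = \sum_k c i j k e_k. *)
Definition is_lie (c : 'I_n -> 'I_n -> 'I_n -> F) : Prop :=
  (forall i j k, c i j k = - c j i k) /\
  (forall i j k m, \sum_(l < n) (c i j l * c l k m + c j k l * c l i m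
                                + c k i l * c l j m) = 0).

(* S(g) = polynomials on g^*, in the coordinates x_0..x_{n-1} w.r.t. the dual
   basis; the matrix A_x = (\sum_k c^k_{ij} x_k) with polynomial entries. *)
Definition poissonMx (c : 'I_n -> 'I_n -> 'I_n -> F) : 'M[{mpoly F[n]}]_n :=
  \matrix_(i, j) \sum_(k < n) c i j k *: 'X_k.

Definition evalMx (c : 'I_n -> 'I_n -> 'I_n -> F) (x : 'I_n -> F) : 'M[F]_n :=
  \matrix_(i, j) \sum_(k < n) c i j k * x k.

(* Lie-Poisson bracket {f,g}(x) = <x,[df(x),dg(x)]> *)
Definition pbracket (c : 'I_n -> 'I_n -> 'I_n -> F) (f g : {mpoly F[n]}) :
    {mpoly F[n]} :=
  \sum_(i < n) \sum_(j < n) (mderiv i f * mderiv j g) * poissonMx c i j.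

(* f is a semi-invariant of weight chi \in g^* (chi given by its coordinates);
   chi(dg(x)) = \sum_i chi_i (d g / d x_i)(x). *)
Definition semi_inv (c : 'I_n -> 'I_n -> 'I_n -> F) (f : {mpoly F[n]})
    (chi : 'I_n -> F) : Prop :=
  f != 0 /\
  forall g : {mpoly F[n]},
    pbracket c g f = (\sum_(i < n) chi i *: mderiv i g) * f.

Definition is_invariant (c : 'I_n -> 'I_n -> 'I_n -> F) (f : {mpoly F[n]}) : Prop :=
  forall g : {mpoly F[n]}, pbracket c g f = 0.

Definition no_proper_semi_inv (c : 'I_n -> 'I_n -> 'I_n -> F) : Prop :=
  forall f chi, semi_inv c f chi -> forall i, chi i = 0.

Definition is_index (c : 'I_n -> 'I_n -> 'I_n -> F) (r : nat) : Prop :=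
  (r <= n)%N /\
  (exists x : 'I_n -> F, \rank (evalMx c x) = (n - r)%N) /\
  (forall x : 'I_n -> F, (\rank (evalMx c x) <= n - r)%N).

End LieDefs.

(* Pfaffian of a square matrix of order k (0 for odd k):
   Pf(A) = 1/(2^m m!) \sum_{s in S_{2m}} sgn(s) \prod_{i<m} A_{s(2i),s(2i+1)}
   (k = 2m; the product ranges over the even indices 2i < k, and ordS is the
   successor in 'I_k, which maps 2i to 2i+1 here). *)
Definition pfaff (F : fieldType) (R : lalgType F) (k : nat) (A : 'M[R]_k) : R :=
  if odd k then 0 else
  let m := k./2 in
  ((2 ^ m * m`!)%:R : F)^-1 *:
  \sum_(s : 'S_k) (-1) ^+ s *
    \prod_(i : 'I_k | ~~ odd i) A (s i) (s (ordS i)).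

Definition mdvd (F : fieldType) (n : nat) (p q : {mpoly F[n]}) : Prop :=
  exists r, q = r * p.

Definition is_gcd_of (F : fieldType) (n : nat) (P : {mpoly F[n]} -> Prop)
    (p : {mpoly F[n]}) : Prop :=
  (forall q, P q -> mdvd p q) /\
  (forall d, (forall q, P q -> mdvd d q) -> mdvd d p).

(* total degree of a polynomial (degree of 0 is 0) *)
Definition mdegree (F : fieldType) (n : nat) (p : {mpoly F[n]}) : nat :=
  (msize p).-1.

Definition fund_semiinv (F : fieldType) (n : nat) (c : 'I_n -> 'I_n -> 'I_n -> F)
    (p : {mpoly F[n]}) : Prop :=
  exists r, is_index c r /\
    is_gcd_of (fun q => exists f : 'I_(n - r) -> 'I_n,
                  injective f /\ q = pfaff (mxsub f f (poissonMx c))) p.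

Definition peval (F : fieldType) (n : nat) (q : {poly F}) (f : {mpoly F[n]}) :
    {mpoly F[n]} :=
  \sum_(i < size q) q`_i *: f ^+ i.

(* A block is a pair (t, m):
   - t = None      : Kronecker block of size (2m-1) x (2m-1)
   - t = Some l    : Jordan block of size 2m x 2m with eigenvalue l,
                     l = Some lambda (lambda in F) or l = None (lambda = oo). *)
Definition jkblock (F : fieldType) := (option (option F) * nat)%type.

Definition jk_size (F : fieldType) (b : jkblock F) : nat :=
  match b.1 with None => (b.2.*2).-1 | Some _ => b.2.*2 end.

Definition jk_valid (F : fieldType) (b : jkblock F) : bool := (0 < b.2)%N.

(* skew matrix [[0, K], [-K^T, 0]] with upper-left block of order p *)
Definition skew_entry (F : fieldType) (K : nat -> nat -> F) (p u v : nat) : F :=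
  if (u < p)%N && (p <= v)%N then K u (v - p)%N
  else if (p <= u)%N && (v < p)%N then - K v (u - p)%N
  else 0.

Definition jordan_entry (F : fieldType) (lam : F) (a b : nat) : F :=
  (if a == b then lam else 0) + (if a.+1 == b then 1 else 0).

Definition id_entry (F : fieldType) (a b : nat) : F := (a == b)%:R.

(* entry (u,v) of the block b for the first form (first = true) or the second
   form (first = false) of the pair; the pencil A - mu B degenerates at
   mu = lambda on a Jordan block of eigenvalue lambda. *)
Definition jk_entry (F : fieldType) (first : bool) (b : jkblock F) (u v : nat) : F :=
  let m := b.2 in
  match b.1 with
  | None => let p := m.-1 in
      if first then skew_entry (fun a c => (a == c)%:R) p u v
      else skew_entry (fun a c => (a.+1 == c)%:R) p u v
  | Some (Some lam) =>
      if first then skew_entry (jordan_entry lam) m u v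
      else skew_entry (@id_entry F) m u v
  | Some None =>
      if first then skew_entry (@id_entry F) m u v
      else skew_entry (jordan_entry 0) m u v
  end.

Fixpoint jk_locate (F : fieldType) (bs : seq (jkblock F)) (i : nat) :
    option (nat * nat) :=
  match bs with
  | [::] => None
  | b :: bs' => if (i < jk_size b)%N then Some (0%N, i)
                else omap (fun q => (q.1.+1, q.2)) (jk_locate bs' (i - jk_size b))
  end.

Definition jk_mx (F : fieldType) (n : nat) (first : bool) (bs : seq (jkblock F)) :
    'M[F]_n :=
  \matrix_(i, j)
    match jk_locate bs i, jk_locate bs j with
    | Some (a, u), Some (b, v) =>
        if a == b then jk_entry first (nth (None, 0%N) bs a) u v else 0
    | _, _ => 0
    end.

Definition jk_decomp (F : fieldType) (n : nat) (A B : 'M[F]_n)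
    (bs : seq (jkblock F)) : Prop :=
  all (@jk_valid F) bs /\ \sum_(b <- bs) jk_size b = n /\
  exists P : 'M[F]_n, P \in unitmx /\
    P^T *m A *m P = jk_mx n true bs /\ P^T *m B *m P = jk_mx n false bs.

Definition join_pt (F : fieldType) (n : nat) (x a : 'I_n -> F) : 'I_(n + n) -> F :=
  fun i => match split i with inl j => x j | inr j => a j end.

(* Main.v *)
(* Since the index is 1, the kernel of A_x is generically a line; it is spanned by
   a vector w of coprime polynomials, homogeneous of degree e, such that the
   Pfaffians of order n - 1 are +- p w_j.  Put f = \sum_j x_j w_j, of degree
   e + 1.  Hamiltonian fields rescale w, hence p and f, so both are
   semi-invariants and therefore invariants; p being nonconstant, f <> 0.  The
   gradient of every invariant lies in the kernel of A_x, so it is a multiple of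
   w, and Euler's identity makes the homogeneous invariants multiples of powers
   of f.  Prime factors of f are semi-invariants, so f is prime; moreover
   w = grad f / (e + 1).

   On a generic line x - t a the polynomial f has k = e + 1 simple roots and the
   vector w(x - t a) is a kernel vector of A_x - t A_a of degree e without zeros.
   It splits off a Kronecker block of size 2k - 1, and A_a is nondegenerate on a
   complement, where the eigenvalues of the pencil are roots of f.  The Jordan
   sizes at a root t are determined by the ranks of block Toeplitz matrices in
   A_(x - t a) and A_a.  As f is prime, a minor that does not vanish identically
   on f = 0 is nonzero at all the roots of f on a generic line, so these ranks
   do not depend on the root. *)
From Stdlib Require Import Classical.
Require Import Defs.
From HB Require Import structures.
From mathcomp Require Import all_boot all_order all_algebra all_fingroup.
From mathcomp Require Import reals complex.
From mathcomp Require Import mpoly zify ring.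
Import Order.TTheory GRing.Theory Num.Theory.
Local Open Scope ring_scope.

Set Implicit Arguments.
Unset Strict Implicit.
Unset Printing Implicit Defensive.

(** * Unique factorization *)

(** The weight of p is found through the adjugate of A_x: its diagonal entries are one common
    constant times squares of Pfaffians, so Jacobi's formula for determinants replaces a derivation
    rule for Pfaffians. The constant is never evaluated, since congruence to a common normal form
    shows that it is the same at all points. The obstacle in the second half is that a root t of f
    on the line x - t a is only algebraic over the coordinates of x and a, so nonvanishing at all
    roots is not visibly an open condition. It is expressed by a Bezout identity for polynomials in
    t over F[x, a]; if there is none, the substitution x = y + t a turns f(x - t a) into f(y), free
    of t, and the primality of f gives a contradiction. A complement of the Kronecker block depends
    on choices, so the operator whose powers give the Jordan sizes is not polynomial in x and a. The
    Toeplitz matrices are, and their corank differs from the one wanted by a fixed amount due to the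
    Kronecker block. Unique factorization serves twice: for dividing coprime polynomial vectors, and
    for passing from irreducible to prime. *)

Section Factorial.
Variable R : idomainType.
Implicit Types (a b p : R).

Definition rdvd a b := exists q, b = q * a.

Definition prime_elt p :=
  [/\ p != 0, p \isn't a GRing.unit &
      forall a b, rdvd p (a * b) -> rdvd p a \/ rdvd p b].

(** Factoring into prime rather than irreducible elements builds uniqueness in and lets divisibility
    proofs peel off one prime at a time. *)
Definition factorial_ring :=
  forall a, a != 0 -> exists u (s : seq R),
    [/\ u \is a GRing.unit, (forall p, p \in s -> prime_elt p) &
        a = u * \prod_(p <- s) p].

Lemma rdvd_mull a b c : rdvd a b -> rdvd a (c * b).
Proof. by case=> q ->; exists (c * q); rewrite mulrA. Qed.

Lemma rdvd_mulr a b c : rdvd a b -> rdvd a (b * c).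
Proof. by rewrite mulrC; apply: rdvd_mull. Qed.

Lemma rdvd_refl a : rdvd a a.
Proof. by exists 1; rewrite mul1r. Qed.

Lemma rdvd_trans b a c : rdvd a b -> rdvd b c -> rdvd a c.
Proof. by case=> q -> [r ->]; exists (r * q); rewrite mulrA. Qed.

Lemma rdvd0 a : rdvd a 0.
Proof. by exists 0; rewrite mul0r. Qed.

Lemma rdvdD a b c : rdvd a b -> rdvd a c -> rdvd a (b + c).
Proof. by case=> q -> [r ->]; exists (q + r); rewrite mulrDl. Qed.

Lemma rdvdN a b : rdvd a b -> rdvd a (- b).
Proof. by case=> q ->; exists (- q); rewrite mulNr. Qed.

Lemma rdvd_sum (I : Type) (r : seq I) (P : pred I) (F : I -> R) a :
  (forall i, P i -> rdvd a (F i)) -> rdvd a (\sum_(i <- r | P i) F i).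
Proof. by move=> aF; elim/big_rec: _ => [|i x Pi]; [exact: rdvd0 | apply/rdvdD/aF]. Qed.

Lemma rdvd_mul2l a b c : c != 0 -> rdvd (c * a) (c * b) <-> rdvd a b.
Proof.
move=> c0; split=> -[q]; last by move->; exists q; rewrite mulrCA.
by rewrite mulrCA => /(mulfI c0) ->; exists q.
Qed.

Lemma prime_elt_unitM p u : u \is a GRing.unit -> prime_elt p -> prime_elt (u * p).
Proof.
move=> uu [p0 pu pP]; have u0 : u != 0 by apply: contraL uu => /eqP->; rewrite unitr0.
split; first by rewrite mulf_neq0.
  by rewrite unitrM uu.
have up x : rdvd p x -> rdvd (u * p) x.
  by case=> q ->; exists (q / u); rewrite mulrA divrK.
move=> a b [q ab]; have [] : rdvd p a \/ rdvd p b.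
- by apply: pP; exists (q * u); rewrite ab mulrA.
- by move/up; left.
- by move/up; right.
Qed.

Lemma prime_dvd_prod p (s : seq R) :
  prime_elt p -> rdvd p (\prod_(q <- s) q) -> exists2 q, q \in s & rdvd p q.
Proof.
case=> p0 pu pP; elim: s => [|q s IH].
  by rewrite big_nil => -[r /esym rp]; case/negP: pu; apply/unitrPr; exists r; rewrite mulrC.
rewrite big_cons => /pP [pq|/IH [r rs pr]]; first by exists q; rewrite ?mem_head.
by exists r; rewrite // inE rs orbT.
Qed.

(** Peel the primes off [a]: a prime dividing every [b * w i] misses some [w i], so it divides [b]
    and cancels on both sides. *)
Lemma factorial_dvd_family (I : finType) (w : I -> R) a b :
  factorial_ring -> (forall p, prime_elt p -> exists i, ~ rdvd p (w i)) ->
  a != 0 -> (forall i, rdvd a (b * w i)) -> rdvd a b.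
Proof.
move=> fR prim a0 ab; have [u [s [uu sP aE]]] := fR _ a0.
have {}ab i : rdvd (\prod_(p <- s) p) (b * w i).
  by apply: rdvd_trans (ab i); rewrite aE; exists u.
suff [q ->] : rdvd (\prod_(p <- s) p) b.
  by exists (q / u); rewrite aE mulrA divrK.
elim: s b sP ab {aE} => [|p s IH] b sP ab.
  by exists b; rewrite big_nil mulr1.
have pP : prime_elt p by apply: sP; rewrite mem_head.
rewrite big_cons in ab *; have [i wi] := prim _ pP.
have p0 : p != 0 by case: pP.
have : rdvd p b \/ rdvd p (w i).
  by case: pP => _ _; apply; apply: rdvd_trans (ab i); exists (\prod_(q <- s) q); rewrite mulrC.
case=> // -[c bE]; rewrite bE [c * p]mulrC; apply/rdvd_mul2l => //.
apply: IH => [q qs|j]; first by apply: sP; rewrite inE qs orbT.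
by apply/(rdvd_mul2l _ _ p0); move: (ab j); rewrite bE [c * p]mulrC mulrA.
Qed.

(** [w j] divides [u j * w i] for all [i], hence [u j], because the family [w] is coprime. Kernel
    vectors proportional to [w] over the fraction field thereby become polynomial multiples of
    it. *)
Lemma proportional_family (I : finType) (w u : I -> R) j :
  factorial_ring -> (forall p, prime_elt p -> exists i, ~ rdvd p (w i)) ->
  w j != 0 -> (forall i, u i * w j = u j * w i) -> exists q, forall i, u i = q * w i.
Proof.
move=> fR prim wj uw.
have [|q uj] := @factorial_dvd_family _ w (w j) (u j) fR prim wj.
  by move=> i; exists (u i); rewrite uw.
exists q => i; apply: (mulIf wj); rewrite uw uj.
by rewrite -!mulrA [w j * _]mulrC.
Qed.

Lemma factorial_ind : factorial_ring -> forall P : R -> Prop,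
  (forall u, u \is a GRing.unit -> P u) ->
  (forall p a, prime_elt p -> a != 0 -> P a -> P (p * a)) ->
  forall a, a != 0 -> P a.
Proof.
move=> fR P Pu Pp a a0; have [u [s [uu sP aE]]] := fR _ a0.
elim: s a a0 sP aE => [|p s IH] a a0 sP; first by rewrite big_nil mulr1 => ->; apply: Pu.
rewrite big_cons mulrCA => aE; rewrite aE.
have us0 : u * \prod_(q <- s) q != 0 by move: a0; rewrite aE mulf_eq0 negb_or => /andP[].
apply: Pp => //; first by apply: sP; rewrite mem_head.
by apply: IH => // q qs; apply: sP; rewrite inE qs orbT.
Qed.

End Factorial.

(** * Gauss's theorem on polynomials over a factorial ring *)

Section Gauss.
Variable R : idomainType.
Implicit Types (f g : {poly R}).

Lemma rdvd_polyC (p : R) f : rdvd p%:P f <-> forall i, rdvd p f`_i.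
Proof.
split=> [[q ->] i|pf]; first by exists q`_i; rewrite coefMC.
have q i : exists q, f`_i == q * p by have [q /eqP] := pf i; exists q.
exists (\poly_(i < size f) xchoose (q i)); apply/polyP => i; rewrite coefMC coef_poly.
case: ltnP => fi; first exact/eqP/(xchooseP (q i)).
by rewrite mul0r nth_default.
Qed.

Lemma rdvd_polyC2 (p a : R) : rdvd p%:P a%:P <-> rdvd p a.
Proof.
rewrite rdvd_polyC; split=> [/(_ 0)|pa [|i]]; rewrite coefC //.
by apply: rdvd0.
Qed.

(** If [p] divides neither factor, take in each the lowest coefficient that [p] misses; modulo [p],
    their product is a coefficient of the product polynomial. *)
Lemma polyC_prime (p : R) : prime_elt p -> prime_elt p%:P.
Proof.
case=> p0 pu pP; split; first by rewrite polyC_eq0.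
  by rewrite poly_unitE size_polyC p0 coefC.
move=> f g /rdvd_polyC pfg; apply: NNPP => nor.
have nf : ~ rdvd p%:P f by move=> pf; apply: nor; left.
have ng : ~ rdvd p%:P g by move=> pg; apply: nor; right.
have minimal h : ~ rdvd p%:P h ->
    exists i, ~ rdvd p h`_i /\ forall j, (j < i)%N -> rdvd p h`_j.
  move=> npf; have [i ni] : exists i, ~ rdvd p h`_i.
    apply: NNPP => noi; apply: npf; apply/rdvd_polyC => i.
    by apply: NNPP => hi; apply: noi; exists i.
  elim/ltn_ind: i ni => i IH hi.
  have [[j [ji hj]]|no] := classic (exists j, (j < i)%N /\ ~ rdvd p h`_j).
    exact: IH hj.
  by exists i; split=> // j ji; apply: NNPP => hj; apply: no; exists j.
have [i [fi fP]] := minimal _ nf; have [j [gj gP]] := minimal _ ng.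
have : rdvd p (f`_i * g`_j).
  have := pfg (i + j)%N; rewrite coefM.
  have ij : (i < (i + j).+1)%N by rewrite ltnS leq_addr.
  rewrite (bigD1 (Ordinal ij)) //= addKn => pS.
  rewrite -[X in rdvd p X](addrK (\sum_(k < (i + j).+1 | k != Ordinal ij) f`_k * g`_(i + j - k))).
  apply: rdvdD => //; apply/rdvdN/rdvd_sum => k /eqP ki.
  have [lt|le] := ltnP k i; first exact/rdvd_mulr/fP.
  apply/rdvd_mull/gP; rewrite ltn_subLR; last by rewrite -ltnS.
  rewrite ltn_add2r ltn_neqAle le andbT; apply/eqP => ik.
  by apply: ki; apply/val_inj.
by case/pP.
Qed.

Definition primitive_poly f := forall p, prime_elt p -> ~ rdvd p%:P f.

Hypothesis factR : factorial_ring R.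

(** A prime factor of [c] divides [q * g] but not the primitive [g], so it can be removed from [q].
    Pseudo-division over [R] leaves such scalars behind. *)
Lemma primitive_cancel f g (c : R) :
  primitive_poly g -> c != 0 -> rdvd g (c *: f) -> rdvd g f.
Proof.
move=> gP c0; move: c c0 f.
apply: (factorial_ind factR (P := fun c => forall f, rdvd g (c *: f) -> rdvd g f)) => [u uu|p a pP a0 IH] f.
  case=> q E; exists (u^-1 *: q); by rewrite -scalerAl -E scalerA mulVr ?scale1r.
rewrite -scalerA => -[q E]; apply: IH; have [_ _ pPP] := polyC_prime pP.
have p0 : p%:P != 0 by rewrite polyC_eq0; case: pP.
have : rdvd p%:P (q * g) by exists (a *: f); rewrite -E mulrC mul_polyC.
case/pPP => [[r qE]|/gP //]; exists r; apply: (mulfI p0).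
by rewrite mul_polyC E qE mulrA [r * _]mulrC.
Qed.

(** Each prime of [c] divides one of the two factors and is cancelled there, so a factorization over
    the fraction field descends to [R] with the same degrees. *)
Lemma split_scalar g f h (c : R) :
  c != 0 -> c *: g = f * h ->
  exists f' h', [/\ g = f' * h', size f' = size f & size h' = size h].
Proof.
move=> c0; move: c c0 f h.
apply: (factorial_ind factR (P := fun c => forall f h, c *: g = f * h ->
  exists f' h', [/\ g = f' * h', size f' = size f & size h' = size h])) => [u uu|p a pP a0 IH] f h.
  move=> E; exists (u^-1 *: f), h; rewrite -scalerAl -E scalerA mulVr // scale1r.
  by split=> //; rewrite size_scale // invr_eq0; apply: contraL uu => /eqP ->; rewrite unitr0.
have p0 : p != 0 by case: pP.
have p0' : p%:P != 0 by rewrite polyC_eq0.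
rewrite -scalerA => E; have [_ _ pPP] := polyC_prime pP.
have : rdvd p%:P (f * h) by exists (a *: g); rewrite -E mulrC mul_polyC.
case/pPP => -[r rE].
- have {}rE : f = p *: r by rewrite rE mulrC mul_polyC.
  have [|f' [h' [? sf sh]]] := IH r h.
    by apply: (mulfI p0'); rewrite !mul_polyC E rE scalerAl.
  by exists f', h'; rewrite rE size_scale.
- have {}rE : h = p *: r by rewrite rE mulrC mul_polyC.
  have [|f' [h' [? sf sh]]] := IH f r.
    by apply: (mulfI p0'); rewrite !mul_polyC E rE scalerAr.
  by exists f', h'; rewrite rE size_scale.
Qed.

Lemma primitive_const (c : R) : c != 0 -> primitive_poly c%:P -> c \is a GRing.unit.
Proof.
move=> c0 cP; have [u [[|p s] [uu sP E]]] := factR c0.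
  by rewrite E big_nil mulr1.
case: (cP p); first by apply: sP; rewrite mem_head.
apply/rdvd_polyC2; exists (u * \prod_(q <- s) q).
by rewrite E big_cons mulrCA mulrC.
Qed.

Lemma dvdp_scalar f g : g %| f -> exists (c : R) h, c != 0 /\ c *: f = h * g.
Proof. by move/Pdiv.Idomain.dvdpP => [[c h] /= c0 E]; exists c, h. Qed.

(** Over the fraction field, either [g] is coprime to [a] and Bezout applies, or irreducibility
    gives their gcd the degree of [g]. The scalars that clear denominators are cancelled by
    primitivity. *)
Lemma primitive_irred_prime g :
  (1 < size g)%N -> primitive_poly g ->
  (forall f h, g = f * h -> (size f <= 1)%N \/ (size h <= 1)%N) ->
  prime_elt g.
Proof.
move=> sg gP irr; have g0 : g != 0 by rewrite -size_poly_gt0 ltnW.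
split=> //; first by rewrite poly_unitE gtn_eqF.
move=> a b gab; have [cop|] := boolP (coprimep g a).
  right; have /Bezout_coprimepP [[u v] /= /eqpP [[c d] /= /andP[c0 d0] E]] := cop.
  apply: (@primitive_cancel _ _ d) => //.
  have -> : d *: b = c *: ((u * b) * g + v * (a * b)).
    rewrite -[d *: b]mul1r -scalerAr scalerAl -E -scalerAl; congr (_ *: _).
    by rewrite mulrDl -!mulrA [b * g]mulrC.
  rewrite scalerDr; apply: rdvdD; rewrite -mul_polyC; last exact/rdvd_mull/rdvd_mull.
  by apply/rdvd_mull/rdvd_mull/rdvd_refl.
rewrite coprimep_def => sd; left.
have [c [q [c0 qE]]] := dvdp_scalar (dvdp_gcdl g a).
have [c' [q' [c'0 qE']]] := dvdp_scalar (dvdp_gcdr g a).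
have [f [h [gE sf sh]]] := split_scalar c0 qE.
have d0 : gcdp g a != 0 by rewrite gcdp_eq0 (negPf g0).
have q0 : q != 0.
  apply: contraNneq g0 => q0; move/eqP: qE; rewrite q0 mul0r.
  by rewrite -mul_polyC mulf_eq0 polyC_eq0 (negPf c0).
have s1 : (1 < size (gcdp g a))%N by rewrite ltn_neqAle eq_sym sd size_poly_gt0.
have {}sf : size q = 1.
  have [] := irr _ _ gE; rewrite ?sf ?sh => sz; last by rewrite leqNgt s1 in sz.
  by apply/eqP; rewrite eqn_leq sz size_poly_gt0.
have /size_poly1P [e e0 qe] : size q == 1 by rewrite sf.
apply: (@primitive_cancel _ _ (e * c')); rewrite ?mulf_neq0 //.
exists (c *: q'); rewrite -scalerA qE' scalerAr -scalerAl scalerAr qE.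
by rewrite qe mul_polyC -scalerAr.
Qed.

Lemma primitive_mul f g : primitive_poly (f * g) -> primitive_poly f.
Proof. by move=> fgP p pP pf; apply: fgP pP _; apply: rdvd_mulr. Qed.

Lemma primitive_factor g :
  g != 0 -> primitive_poly g ->
  exists u (s : seq {poly R}),
    [/\ u \is a GRing.unit, (forall p, p \in s -> prime_elt p) &
        g = u * \prod_(p <- s) p].
Proof.
have [m] := ubnP (size g); elim: m g => // m IH g; rewrite ltnS => sg g0 gP.
have [s1|s1] := leqP (size g) 1.
  have /size_poly1P [c c0 gE] : size g == 1 by rewrite eqn_leq s1 size_poly_gt0.
  exists g, [::]; rewrite big_nil mulr1; split=> //.
  by rewrite poly_unitE gE size_polyC c0 coefC primitive_const // -gE.
have [[f [h [gE sf sh]]]|no] := classic (exists f h, [/\ g = f * h, ~~ (size f <= 1)%N & ~~ (size h <= 1)%N]); last first.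
  exists 1, [:: g]; rewrite big_seq1 mul1r unitr1; split=> // p.
  rewrite inE => /eqP->; apply: primitive_irred_prime => // f h gE.
  have [sf|sf] := boolP (size f <= 1)%N; [by left | right].
  by apply/negPn/negP => sh; apply: no; exists f, h.
rewrite -!ltnNge in sf sh.
have [f0 h0] : f != 0 /\ h != 0 by split; rewrite -size_poly_gt0 ltnW.
have sE : size g = (size f + size h).-1 by rewrite gE size_mul.
have [||u [s [uu sP fE]]] := IH f _ f0.
- by move: sg; rewrite sE; case: (size h) sh => [|[|k]] // _; rewrite !addnS /=; apply: leq_trans; rewrite ltnS leq_addr.
- by move: gP; rewrite gE; apply: primitive_mul.
have [||v [t [vv tP hE]]] := IH h _ h0.
- by move: sg; rewrite sE; case: (size f) sf => [|[|k]] // _; rewrite !addSn /=; apply: leq_trans; rewrite ltnS leq_addl.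
- by move: gP; rewrite gE mulrC; apply: primitive_mul.
exists (u * v), (s ++ t); rewrite unitrM uu vv big_cat /=; split=> //.
  by move=> p; rewrite mem_cat => /orP[/sP|/tP].
by rewrite gE fE hE mulrACA.
Qed.

Lemma factorial_poly : factorial_ring {poly R}.
Proof.
move=> g g0; have [u [s [uu sP E]]] : exists u (s : seq R),
    [/\ u \is a GRing.unit, (forall p, p \in s -> prime_elt p) &
        lead_coef g = u * \prod_(p <- s) p].
  by apply: factR; rewrite lead_coef_eq0.
(* Induction on the number of primes in the leading coefficient: a constant prime dividing [g]
   occurs there up to a unit, and dividing it out lowers the count. If no constant prime divides
   [g], it is primitive. *)
elim: {s}(size s) {-2}s (erefl (size s)) g g0 sP E => [|m IH] s ss g g0 sP E.
  apply: primitive_factor => // q qP /rdvd_polyC /(_ (size g).-1) [r].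
  rewrite -lead_coefE E (size0nil ss) big_nil mulr1 => uE.
  by case: qP => _ /negP[]; move: uu; rewrite uE unitrM => /andP[].
have [[q [qP qg]]|no] := classic (exists q, prime_elt q /\ rdvd q%:P g); last first.
  by apply: primitive_factor => // q qP qg; apply: no; exists q.
have [p ps qp] : exists2 p, p \in s & rdvd q p.
  apply: prime_dvd_prod => //; move/rdvd_polyC/(_ (size g).-1): qg.
  rewrite -lead_coefE E => -[r rE]; exists (u^-1 * r).
  by rewrite -mulrA -rE mulKr.
have pP := sP _ ps; have [p0 pu pPP] := pP.
(* In [p = r * q] the prime [p] cannot divide [r], as [q] would then be a unit; so [p] divides
   [q]. *)
have pg : rdvd p%:P g.
  apply: rdvd_trans qg; apply/rdvd_polyC2; case: qp => r pE.
  have [||//] := pPP r q; first by rewrite -pE; apply: rdvd_refl.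
  case=> t rE; case: qP => _ /negP[]; apply/unitrPr; exists t.
  by apply: (mulIf p0); rewrite mul1r [RHS]pE rE [RHS]mulrAC [t * q]mulrC.
case: pg => h gE; have h0 : h != 0 by apply: contraNneq g0 => h0; rewrite gE h0 mul0r.
have [|||v [t [vv tP hE]]] := IH (rem p s) _ h h0.
- by rewrite size_rem // ss.
- by move=> r /mem_rem/sP.
- apply: (mulIf p0); have := E; rewrite gE lead_coefM lead_coefC => ->.
  by rewrite (perm_big _ (perm_to_rem ps)) big_cons /= mulrCA mulrC.
exists v, (p%:P :: t); split=> // [r|].
  by rewrite inE => /orP[/eqP->|/tP//]; apply: polyC_prime.
by rewrite big_cons gE hE mulrCA mulrC.
Qed.

End Gauss.

(** * Unique factorization in several variables *)

Section Transfer.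
Variables (R S : idomainType) (phi : R -> S) (psi : S -> R).
Hypotheses (phiK : cancel phi psi) (psiK : cancel psi phi).
Hypotheses (phi0 : phi 0 = 0) (phi1 : phi 1 = 1) (phiM : {morph phi : a b / a * b}).

Let phi_unit a : a \is a GRing.unit -> phi a \is a GRing.unit.
Proof.
by case/unitrPr => b ab; apply/unitrPr; exists (phi b); rewrite -phiM ab.
Qed.

Lemma prime_elt_iso p : prime_elt p -> prime_elt (phi p).
Proof.
case=> p0 pu pP; split; first by rewrite (can2_eq phiK psiK) -phi0 phiK.
  apply: contra pu => /unitrPr [b pb]; apply/unitrPr; exists (psi b).
  by apply: (can_inj phiK); rewrite phiM psiK pb.
have dv x : rdvd p x <-> rdvd (phi p) (phi x).
  split=> -[q E]; first by exists (phi q); rewrite E phiM.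
  by exists (psi q); apply: (can_inj phiK); rewrite phiM psiK.
move=> a b; rewrite -[a]psiK -[b]psiK -phiM -!dv; exact: pP.
Qed.

Lemma factorial_iso : factorial_ring R -> factorial_ring S.
Proof.
move=> fR a a0; have [|u [s [uu sP E]]] := fR (psi a).
  by rewrite (can2_eq psiK phiK) phi0.
exists (phi u), (map phi s); split; first exact: phi_unit.
  by move=> p /mapP[q /sP qP ->]; apply: prime_elt_iso.
by rewrite big_map -(big_morph phi phiM phi1) -phiM -E psiK.
Qed.

End Transfer.

(** A polynomial ring is free on its variables; most identities between substitutions below are
    checked in this way, on constants and variables only. *)
Lemma mpoly_rmorph_eq (R S : comNzRingType) n (f g : {rmorphism {mpoly R[n]} -> S}) :
  (forall c, f c%:MP = g c%:MP) -> (forall i, f 'X_i = g 'X_i) -> f =1 g.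
Proof.
move=> fgC fgX p; rewrite (mpolyE p) !rmorph_sum; apply: eq_bigr => m _.
rewrite -mul_mpolyC !rmorphM fgC; congr (_ * _).
rewrite mpolyXE_id !rmorph_prod; apply: eq_bigr => i _.
by rewrite !rmorphXn fgX.
Qed.

Section Uni.
Variables (R : comNzRingType) (n : nat).

(** Inverse of [muni], which reads a polynomial as univariate in its last variable; the pair
    transfers Gauss's theorem to one more variable. *)
Definition unmuni : {poly {mpoly R[n]}} -> {mpoly R[n.+1]} :=
  horner_eval 'X_ord_max \o map_poly (@mwiden n R).
HB.instance Definition _ := GRing.RMorphism.on unmuni.

Lemma muni_Xmax : muni ('X_ord_max : {mpoly R[n.+1]}) = 'X.
Proof.
rewrite muniE msuppX big_seq1 mcoeffX eqxx scale1r mnm1E eqxx expr1.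
rewrite [X in 'X_[X]](_ : _ = 0%MM) ?mpolyX0 ?scale1r //.
by apply/mnmP => i; rewrite mnmE mnm1E mnm0E -val_eqE /= gtn_eqF.
Qed.

Lemma muni_Xwiden (i : 'I_n) :
  muni ('X_(widen_ord (leqnSn n) i) : {mpoly R[n.+1]}) = ('X_i)%:P.
Proof.
rewrite muniE msuppX big_seq1 mcoeffX eqxx scale1r mnm1E.
rewrite -val_eqE /= ltn_eqF // expr0 alg_polyC.
congr ('X_[_])%:P; apply/mnmP => j; rewrite mnmE !mnm1E.
by rewrite -!val_eqE.
Qed.

Lemma widen_or_max (i : 'I_n.+1) :
  i = ord_max \/ exists j : 'I_n, i = widen_ord (leqnSn n) j.
Proof.
have [lt|ge] := ltnP i n; first by right; exists (Ordinal lt); apply/val_inj.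
by left; apply/val_inj/eqP; rewrite /= eqn_leq ge -ltnS ltn_ord.
Qed.

Lemma muniK : cancel (@muni n R) unmuni.
Proof.
apply: (@mpoly_rmorph_eq _ _ _ (unmuni \o @muni n R) idfun) => [c|i] /=.
  by rewrite muniC /unmuni /= map_polyC /= horner_evalE hornerC mwidenC.
have [->|[j ->]] := widen_or_max i.
  by rewrite muni_Xmax /unmuni /= map_polyX horner_evalE hornerX.
rewrite muni_Xwiden /unmuni /= map_polyC /= horner_evalE hornerC mwidenX; congr 'X_[_].
exact: mnmwiden1.
Qed.

Lemma muni_widen (p : {mpoly R[n]}) : muni (mwiden p) = p%:P.
Proof.
move: p; apply: (@mpoly_rmorph_eq _ _ _ (@muni n R \o @mwiden n R) polyC) => [c|i] /=.
  by rewrite mwidenC muniC.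
by rewrite mwidenX mnmwiden1 muni_Xwiden.
Qed.

Lemma unmuniK : cancel unmuni (@muni n R).
Proof.
move=> p; rewrite /unmuni /= horner_evalE -{2}[p]coefK poly_def.
rewrite horner_coef rmorph_sum size_map_inj_poly ?rmorph0 //; last exact: inj_mwiden.
apply: eq_bigr => i _; rewrite rmorphM rmorphXn /= muni_Xmax coef_map /= muni_widen.
by rewrite mul_polyC.
Qed.

Lemma meval_muni (p : {mpoly R[n.+1]}) (v : 'I_n.+1 -> R) :
  p.@[v] = (map_poly (meval (fun i => v (widen_ord (leqnSn n) i))) (muni p)).[v ord_max].
Proof.
set v' := fun i : 'I_n => _.
move: p; apply: (@mpoly_rmorph_eq _ _ _ (meval v)
  (horner_eval (v ord_max) \o map_poly (meval v') \o @muni n R)) => [c|i] /=.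
  by rewrite mevalC muniC map_polyC /= horner_evalE hornerC mevalC.
rewrite mevalXU; have [->|[j ->]] := widen_or_max i.
  by rewrite muni_Xmax map_polyX horner_evalE hornerX.
by rewrite muni_Xwiden map_polyC /= horner_evalE hornerC mevalXU.
Qed.

End Uni.

Lemma mpoly_unitE (F : fieldType) n (p : {mpoly F[n]}) :
  (p \is a GRing.unit) = (msize p == 1%N).
Proof.
apply/idP/idP => [/andP[/eqP pE u]|/msize_poly1P [c c0 ->]].
  by rewrite pE msizeC -unitfE u.
by rewrite rmorph_unit ?unitfE.
Qed.

Lemma factorial_mpoly (F : fieldType) n : factorial_ring {mpoly F[n]}.
Proof.
elim: n => [|n IH].
  move=> a a0; exists a, [::]; rewrite big_nil mulr1; split=> //.
  by move: a0; rewrite (nvar0_mpolyC a) mpolyC_eq0 => a0; rewrite rmorph_unit ?unitfE.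
have fP : factorial_ring {poly {mpoly F[n]}} by apply: factorial_poly.
exact: (@factorial_iso {poly {mpoly F[n]}} {mpoly F[n.+1]} (@unmuni F n) (@muni n F)
  (@unmuniK F n) (@muniK F n) (rmorph0 _) (rmorph1 _) (rmorphM _) fP).
Qed.

(** * Polynomials are determined by their values *)

Lemma poly_nonroot (F : numDomainType) (p : {poly F}) : p != 0 -> exists x, p.[x] != 0.
Proof.
move=> p0; apply: NNPP => H.
pose s := [seq (i%:R : F) | i <- iota 0 (size p)].
have := @max_poly_roots _ p s p0; rewrite size_map size_iota ltnn => h.
apply: notF; apply: h.
  by apply/allP => x _; apply/negPn/negP => px; apply: H; exists x.
rewrite map_inj_uniq ?iota_uniq // => i j /eqP; rewrite eqr_nat; exact: eqP.
Qed.

(** Choose the first [n] coordinates off the zeros of the leading coefficient in the last variable;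
    a nonzero univariate polynomial remains. *)
Lemma mpoly_nonroot (F : numDomainType) n (p : {mpoly F[n]}) :
  p != 0 -> exists v, p.@[v] != 0.
Proof.
elim: n p => [|n IH] p p0.
  exists (fun=> 0); rewrite (nvar0_mpolyC p) mevalC.
  by apply: contraNneq p0 => p0; rewrite (nvar0_mpolyC p) p0 mpolyC0.
have q0 : lead_coef (muni p) != 0.
  by rewrite lead_coef_eq0 (can2_eq (@muniK _ _) (@unmuniK _ _)) rmorph0.
have [v' v'0] := IH _ q0; have [|x x0] := @poly_nonroot _ (map_poly (meval v') (muni p)).
  apply: contraNneq v'0 => /(congr1 (fun q : {poly F} => q`_(size (muni p)).-1)).
  by rewrite coef_map coef0 /= -lead_coefE => ->.
exists (fun i => if insub (i : nat) is Some j then v' j else x).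
rewrite meval_muni insubF ?ltnn // (eq_map_poly (g := meval v')) // => q.
by apply: meval_eq => i; rewrite insubT /=; [exact: ltn_ord | move=> lt; congr v'; apply/val_inj].
Qed.

Lemma mpoly_eq0P (F : numDomainType) n (p : {mpoly F[n]}) :
  (forall v, p.@[v] = 0) -> p = 0.
Proof.
move=> H; apply/eqP; apply: contraT => /mpoly_nonroot [v].
by rewrite H eqxx.
Qed.

Lemma mpoly_eqP_eval (F : numDomainType) n (p q : {mpoly F[n]}) :
  (forall v, p.@[v] = q.@[v]) -> p = q.
Proof.
by move=> H; apply/eqP; rewrite -subr_eq0; apply/eqP/mpoly_eq0P => v; rewrite rmorphB /= H subrr.
Qed.

(** * Jordan-Kronecker decompositions *)

Definition jk_blk (F : fieldType) (first : bool) (b : jkblock F) : 'M[F]_(jk_size b) :=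
  \matrix_(u, v) jk_entry first b u v.

Section JKBlocks.
Variable F : fieldType.
Implicit Types (b : jkblock F) (bs : seq (jkblock F)).

Lemma jk_mx_cons n first b bs :
  jk_mx (jk_size b + n) first (b :: bs) =
  block_mx (jk_blk first b) 0 0 (jk_mx n first bs).
Proof.
apply/matrixP => i j; rewrite mxE /=.
rewrite -[ i ]splitK -[j]splitK; case: (split i) => u; case: (split j) => v /=;
  rewrite ?(block_mxEul, block_mxEur, block_mxEdl, block_mxEdr) mxE.
- by rewrite !ltn_ord /=.
- rewrite ltn_ord ltnNge leq_addr /= addKn.
  by case: (jk_locate bs v) => [[]|].
- rewrite ltn_ord ltnNge leq_addr /= addKn.
  by case: (jk_locate bs u) => [[]|].
- rewrite !ltnNge !leq_addr /= !addKn.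
  by case: (jk_locate bs u) (jk_locate bs v) => [[]|] // ? ? [[]|].
Qed.

Lemma jk_decomp_nil (A B : 'M[F]_0) : jk_decomp A B [::].
Proof.
split=> //; split; first by rewrite big_nil.
exists 1%:M; rewrite unitmx1.
by split=> //; split; apply/matrixP => -[].
Qed.

(** The rows of [W1] and [W2] form a basis in which both forms are block diagonal; skewness turns
    one vanishing off-diagonal block into the other. Basis vectors are rows here, so the congruence
    matrix is a transpose. *)
Lemma jk_decomp_cons b bs n n' (A B : 'M[F]_n) (W1 : 'M_(jk_size b, n)) (W2 : 'M_(n', n)) :
  jk_valid b -> (jk_size b + n')%N = n -> A^T = - A -> B^T = - B ->
  row_free (col_mx W1 W2) ->
  W1 *m A *m W1^T = jk_blk true b -> W1 *m B *m W1^T = jk_blk false b ->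
  W1 *m A *m W2^T = 0 -> W1 *m B *m W2^T = 0 ->
  jk_decomp (W2 *m A *m W2^T) (W2 *m B *m W2^T) bs ->
  jk_decomp A B (b :: bs).
Proof.
move=> bP nE; case: n / nE A B W1 W2 => A B W1 W2 skA skB Wfree.
move=> A11 B11 A12 B12 [bsP [bsS [P [Pu [AP BP]]]]].
split; first by rewrite /= bP.
split; first by rewrite big_cons bsS.
have block_tr (M : 'M_(jk_size b + n')) : M^T = - M -> W1 *m M *m W2^T = 0 ->
    col_mx W1 W2 *m M *m (col_mx W1 W2)^T =
    block_mx (W1 *m M *m W1^T) 0 0 (W2 *m M *m W2^T).
  move=> skM M12; rewrite tr_col_mx mul_col_mx mul_col_row M12.
  congr block_mx; apply: trmx_inj; rewrite !trmx_mul trmxK skM mulNmx mulmxN mulmxA M12.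
  by rewrite oppr0 trmx0.
pose Q := block_mx 1%:M 0 0 P^T *m col_mx W1 W2.
have Qu : Q \in unitmx.
  rewrite unitmx_mul; apply/andP; split; last by rewrite -row_free_unit.
  by rewrite unitmxE det_ublock det1 mul1r -unitmxE unitmx_tr.
exists Q^T; rewrite unitmx_tr Qu trmxK !jk_mx_cons -A11 -B11 -AP -BP.
have mulQ M : Q *m M *m Q^T = block_mx 1%:M 0 0 P^T *m (col_mx W1 W2 *m M *m (col_mx W1 W2)^T) *m
   (block_mx 1%:M 0 0 P^T)^T by rewrite trmx_mul !mulmxA.
split=> //; rewrite !mulQ !block_tr //.
by split; rewrite tr_block_mx !mulmx_block !(trmx0, trmx1, trmxK, mulmx0, mul0mx, addr0, add0r, mul1mx, mulmx1, mulmxA).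
Qed.

End JKBlocks.

Section SkewForms.
Variable F : numFieldType.

Lemma skew_form0 n (A : 'M[F]_n) (u : 'rV_n) : A^T = - A -> u *m A *m u^T = 0.
Proof.
move=> skA; set x := u *m A *m u^T.
have : x^T = - x by rewrite !trmx_mul trmxK skA mulNmx mulmxN mulmxA.
have -> : x^T = x by rewrite [x]mx11_scalar tr_scalar_mx.
move/eqP; rewrite -addr_eq0 -mulr2n -scaler_nat scaler_eq0 pnatr_eq0 /=.
by move/eqP.
Qed.

Lemma skew_congr n m (A : 'M[F]_n) (W : 'M_(m, n)) : A^T = - A ->
  (W *m A *m W^T)^T = - (W *m A *m W^T).
Proof. by move=> skA; rewrite !trmx_mul trmxK skA mulNmx mulmxN mulmxA. Qed.

Lemma skew_comm0 n m1 m2 (A : 'M[F]_n) (W1 : 'M_(m1, n)) (W2 : 'M_(m2, n)) :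
  A^T = - A -> W1 *m A *m W2^T = 0 -> W2 *m A *m W1^T = 0.
Proof.
move=> skA E; apply: trmx_inj; rewrite !trmx_mul trmxK skA mulNmx mulmxN mulmxA E.
by rewrite oppr0 trmx0.
Qed.

End SkewForms.

Section JordanBlock.
Variable F : fieldType.

Definition jordan_mx (first : bool) (l : F) r : 'M[F]_r :=
  \matrix_(a, b) if first then jordan_entry l a b else id_entry F a b.

Lemma jk_blk_jordan first (l : F) r :
  jk_blk first (Some (Some l), r) =
  castmx (addnn r, addnn r)
    (block_mx 0 (jordan_mx first l r) (- (jordan_mx first l r)^T) 0).
Proof.
apply/matrixP => i j; rewrite castmxE mxE /jk_entry /=.
set i' := cast_ord _ i; set j' := cast_ord _ j.
have -> : nat_of_ord i = i' by []. have -> : nat_of_ord j = j' by [].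
rewrite -[i']splitK -[j']splitK; case: (split i') => u; case: (split j') => v /=;
  rewrite ?(block_mxEul, block_mxEur, block_mxEdl, block_mxEdr) ?mxE /skew_entry;
  rewrite ?ltn_ord ?[(r <= nat_of_ord _)%N]leqNgt ?ltn_ord /=;
  rewrite ?[(r + _ < r)%N]ltnNge ?leq_addr //= ?addKn; by case: first.
Qed.

Lemma jordan_mx_id l r : jordan_mx false l r = 1%:M.
Proof. by apply/matrixP => a b; rewrite !mxE. Qed.

Lemma castmx_unitmx m n (e : m = n) (A : 'M[F]_m) :
  (castmx (e, e) A \in unitmx) = (A \in unitmx).
Proof. by case: n / e; rewrite castmx_id. Qed.

Lemma jk_blk_jordan_unit (l : F) r : jk_blk false (Some (Some l), r) \in unitmx.
Proof.
rewrite jk_blk_jordan castmx_unitmx jordan_mx_id trmx1.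
suff /mulmx1_unit [] : block_mx 0 1%:M (- 1%:M) 0 *m block_mx 0 (-1%:M) 1%:M 0 = 1%:M :> 'M[F]_(r + r) by [].
rewrite mulmx_block !(mul0mx, mulmx0, mul1mx, add0r, addr0).
by rewrite mulmxN mulmx1 opprK -scalar_mx_block.
Qed.

End JordanBlock.

(** * Simultaneous Jordan form of two skew forms *)

Section Step.
Variable F : numClosedFieldType.

(** The hypothesis says that [T] is self-adjoint for the form [B]; polynomials in [T], in particular
    its spectral projectors, inherit this. *)
Lemma horner_mx_adjoint n (T B : 'M[F]_n.+1) p :
  T *m B = B *m T^T -> horner_mx T p *m B = B *m (horner_mx T p)^T.
Proof.
move=> TB; elim/poly_ind: p => [|p c IH]; first by rewrite rmorph0 trmx0 mul0mx mulmx0.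
rewrite rmorphD rmorphM /= horner_mx_X horner_mx_C mulmxDl linearD /= mulmxDr.
congr (_ + _); last by rewrite tr_scalar_mx scalar_mxC.
have cTp : T * horner_mx T p = horner_mx T p * T by have := rmorphM (horner_mx T) 'X p; rewrite mulrC rmorphM /= horner_mx_X.
rewrite -[_ * _]/(_ *m _) trmx_mul -mulmxA TB mulmxA IH -mulmxA -!trmx_mul.
by rewrite -[T *m _]/(T * _) cTp.
Qed.

(** Two chains of maximal length at one eigenvalue, dual to each other under [B]: [r] is the
    multiplicity of [l] in the minimal polynomial, so some chain in the generalized eigenspace
    really has length [r]. *)
Lemma eigen_chain n (T B : 'M[F]_n.+1) :
  B \in unitmx -> T *m B = B *m T^T ->
  exists l r (u v : 'rV[F]_n.+1), let S := T - l%:M in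
    [/\ (0 < r)%N, u *m S ^+ r = 0, v *m S ^+ r = 0 &
        forall i, (i < r)%N -> u *m S ^+ i *m B *m v^T = (i == r.-1)%:R%:M].
Proof.
move=> Bu TB; pose p := mxminpoly T.
have p0 : p != 0 by rewrite monic_neq0 ?mxminpoly_monic.
have /closed_rootP [l pl] : size p != 1.
  by rewrite size_mxminpoly eqSS -lt0n mxminpoly_nonconstant.
have [[|r] [q ql pE]] := multiplicity_XsubC p l.
  by move: ql; rewrite p0 /= -[q]mulr1 -(expr0 ('X - l%:P)) -pE pl.
move: ql; rewrite p0 /= => ql.
have cop : coprimep (('X - l%:P) ^+ r.+1) q by rewrite coprimep_expl // coprimep_sym coprimep_XsubC.
have /Bezout_eq1_coprimepP [[a b] /= ab] := cop.
(* By the Bezout identity [E] is the spectral projector onto the generalized eigenspace of [l].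
   After the case split the multiplicity is [r.+1]. *)
pose S : 'M[F]_n.+1 := horner_mx T ('X - l%:P); pose E : 'M[F]_n.+1 := horner_mx T (b * q).
have SE : S = T - l%:M by rewrite /S rmorphB /= horner_mx_X horner_mx_C.
have hp s : horner_mx T (s * p) = 0 by rewrite rmorphM /= mx_root_minpoly mulr0.
have ES : E * S ^+ r.+1 = 0.
  by rewrite -rmorphXn -rmorphM /= -mulrA -pE hp.
have EE : E * E = E.
  apply/eqP; rewrite -subr_eq0 -{3}[E]mulr1 -mulrBr; apply/eqP.
  rewrite -[1](rmorph1 (horner_mx T)) -rmorphB -rmorphM -ab /=.
  rewrite [_ - (_ + _)](_ : _ = - (a * ('X - l%:P) ^+ r.+1)); last by rewrite opprD addrC subrK.
  by rewrite mulrN rmorphN /= mulrACA -pE hp oppr0.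
have SrE0 : E * S ^+ r != 0.
  (* Were it zero, the minimal polynomial would divide [g * b], so [X - l] would divide [b], against
     the Bezout identity evaluated at [l]. *)
  pose g := ('X - l%:P) ^+ r * q.
  have pg : p = g * ('X - l%:P) by rewrite pE exprSr mulrA [q * _]mulrC.
  have -> : E * S ^+ r = horner_mx T (g * b).
    rewrite [g * b](_ : _ = b * q * ('X - l%:P) ^+ r); last first.
      by rewrite [g * b]mulrC /g [_ * q]mulrC mulrA.
    by rewrite [in RHS]rmorphM rmorphXn.
  rewrite -dvd_mxminpoly -/p pg.
  rewrite dvdp_mul2l; last first.
    by apply: contra_neq p0 => e0; rewrite pg e0 mul0r.
  rewrite dvdp_XsubCl; apply: contra ql => /rootP bl.
  by have /(congr1 (horner^~ l)) := ab; rewrite !hornerE subrr bl expr0n /= mulr0 mul0r addr0 => /eqP; rewrite eq_sym oner_eq0.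
have [i ui] : exists i, row i (E * S ^+ r) != 0.
  have /row_subPn [ i] : ~~ ((E * S ^+ r)%R <= (0 : 'M[F]_n.+1))%MS by rewrite submx0.
  by rewrite submx0; exists i.
pose u := row i E.
have uE : u *m E = u by rewrite -row_mul [_ *m _]EE.
have uS k : u *m S ^+ k = row i (E * S ^+ k) by rewrite -row_mul.
pose U := \matrix_(k < r.+1) (u *m S ^+ k).
have Ufree : row_free (U *m B).
  rewrite /row_free mxrankMfree ?row_free_unit //.
  apply: inj_row_free => c cU.
  have cU' : \sum_(k < r.+1) c 0 k *: (u *m S ^+ k) = 0.
    by rewrite -[RHS]cU mulmx_sum_row; apply: eq_bigr => k _; rewrite rowK.
  suff H k : (k < r.+1)%N -> forall k' : 'I_r.+1, k' = k :> nat -> c 0 k' = 0.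
    by apply/rowP => k; rewrite mxE (H k).
  elim/ltn_ind: k => k IH kr k' kk'.
  have := congr1 (fun w => w *m S ^+ (r - k)) cU'.
  rewrite mul0mx mulmx_suml (bigD1 k') //= big1 ?addr0 => [|j jk].
    rewrite -scalemxAl -mulmxA -[S ^+ _ *m _]exprD kk' subnKC // uS.
    by move/eqP; rewrite scaler_eq0 (negPf ui) orbF => /eqP.
  rewrite -scalemxAl -mulmxA -[S ^+ _ *m _]exprD.
  have [jk'|kj] := ltnP j k; first by rewrite (IH j) // scale0r.
  have rj : (r < j + (r - k))%N.
    by rewrite -{1}(subnKC (_ : (k <= r)%N)) // ltn_add2r ltn_neqAle kj andbT -kk' eq_sym.
  by rewrite uS -(subnKC rj) exprD mulrA ES mul0r row0 scaler0.
have [X UX] := row_freeP Ufree.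
(* [X] is a right inverse of [U *m B], so its last column pairs to 1 with the end of the chain and
   to 0 with the rest. Applying [E] moves it into the generalized eigenspace without changing the
   pairing, as [E] is self-adjoint and fixes [u]. *)
pose v : 'rV[F]_n.+1 := (X *m delta_mx (ord_max : 'I_r.+1) (0 : 'I_1))^T *m E.
have SB : S *m B = B *m S^T := horner_mx_adjoint _ TB.
exists l, r.+1, u, v; rewrite -SE; split=> //=.
- by rewrite uS ES row0.
- by rewrite -mulmxA [E *m _]ES mulmx0.
have BE : B *m E^T = E *m B by rewrite horner_mx_adjoint.
have SkE k : S ^+ k *m E = E *m S ^+ k.
  by rewrite -rmorphXn -[_ *m _]/(_ * _) -[in RHS]/(_ * _) -!rmorphM mulrC.
move=> k kr; rewrite trmx_mul trmxK -!mulmxA [B *m (E^T *m _)]mulmxA BE -mulmxA.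
rewrite [S ^+ k *m (E *m _)]mulmxA SkE -mulmxA [u *m (E *m _)]mulmxA uE !mulmxA.
have -> : u *m S ^+ k *m B = row (Ordinal kr) (U *m B) by rewrite row_mul rowK.
rewrite -!row_mul UX mul1mx.
by apply/matrixP => x y; rewrite !ord1 !mxE eqxx andbT mulr1n -val_eqE.
Qed.
End Step.

Lemma gram_entry (F : fieldType) n m1 m2 (W1 : 'M[F]_(m1, n)) (W2 : 'M_(m2, n)) (A : 'M_n) i j :
  (W1 *m A *m W2^T) i j = (row i W1 *m A *m (row j W2)^T) 0 0.
Proof. by rewrite -row_mul tr_row mxE [RHS]mxE; apply: eq_bigr => k _; rewrite !mxE. Qed.

Section Split.
Variable F : numClosedFieldType.

(** The operator [A *m invmx B] is self-adjoint for [B] because both forms are skew. Every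
    [S ^+ k *m B] is then skew too, which makes each of the two chains isotropic. The last clause
    holds because the span of the chains is invariant. *)
Lemma jordan_split n (A B : 'M[F]_n.+1) :
  B \in unitmx -> A^T = - A -> B^T = - B ->
  exists l r (W : 'M[F]_(r.*2, n.+1)),
    [/\ (0 < r)%N,
        W *m A *m W^T = jk_blk true (Some (Some l), r),
        W *m B *m W^T = jk_blk false (Some (Some l), r) &
        forall m (W2 : 'M_(m, n.+1)), W *m B *m W2^T = 0 -> W *m A *m W2^T = 0].
Proof.
move=> Bu skA skB; pose T := A *m invmx B.
have TB : T *m B = A by rewrite mulmxKV.
have BT : B *m T^T = A by rewrite -[B]opprK -skB mulNmx -trmx_mul TB skA opprK.
have [l [r [u [v [r0 uS vS uv]]]]] := eigen_chain Bu (etrans TB (esym BT)).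
pose S := T - l%:M; rewrite -/S in uS vS uv.
have SB : S *m B = B *m S^T.
  by rewrite mulmxBl TB linearB /= mulmxBr BT tr_scalar_mx scalar_mxC.
have AE : A = S *m B + l *: B by rewrite mulmxBl TB mul_scalar_mx subrK.
have SpD a b : S ^+ a *m S ^+ b = S ^+ (a + b) by rewrite exprD.
have SpS a : S ^+ a *m S = S ^+ a.+1 by rewrite exprSr.
have SSp a : S *m S ^+ a = S ^+ a.+1 by rewrite exprS.
have SkB k : S ^+ k *m B = B *m (S ^+ k)^T.
  elim: k => [|k IH]; first by rewrite expr0 trmx1 mul1mx mulmx1.
  by rewrite -[in LHS]SpS -mulmxA SB mulmxA IH -mulmxA -trmx_mul SSp.
have skS k : (S ^+ k *m B)^T = - (S ^+ k *m B).
  by rewrite SkB trmx_mul trmxK skB mulmxN SkB.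
have uSr k : (r <= k)%N -> u *m S ^+ k = 0.
  by move=> /subnKC <-; rewrite -SpD mulmxA uS mul0mx.
have vSr k : (r <= k)%N -> v *m S ^+ k = 0.
  by move=> /subnKC <-; rewrite -SpD mulmxA vS mul0mx.
have formS w1 w2 a b : (w1 *m S ^+ a) *m B *m (w2 *m S ^+ b)^T = w1 *m S ^+ (a + b) *m B *m w2^T.
  rewrite trmx_mul !mulmxA -[_ *m B *m (S ^+ b)^T]mulmxA -SkB !mulmxA.
  by rewrite -[_ *m S ^+ a *m _]mulmxA SpD.
have formA w1 w2 a b : (w1 *m S ^+ a) *m A *m (w2 *m S ^+ b)^T =
    w1 *m S ^+ (a + b).+1 *m B *m w2^T + l *: (w1 *m S ^+ (a + b) *m B *m w2^T).
  rewrite AE mulmxDr mulmxDl -scalemxAr -scalemxAl formS; congr (_ + _).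
  by rewrite mulmxA -[_ *m S ^+ a *m S]mulmxA SpS formS addSn.
have form0 (w : 'rV_n.+1) k : w *m S ^+ k *m B *m w^T = 0.
  by have := skew_form0 w (skS k); rewrite mulmxA.
have formuv k : u *m S ^+ k *m B *m v^T = (k == r.-1)%:R%:M.
  have [|kr] := ltnP k r; first exact: uv.
  by rewrite uSr // !mul0mx; case: eqP => [|_]; [lia | rewrite mulr0n raddf0].
have formvu k : v *m S ^+ k *m B *m u^T = - (k == r.-1)%:R%:M.
  apply: trmx_inj; rewrite linearN /= tr_scalar_mx -formuv -[v *m _ *m B]mulmxA.
  move: (skS k) (mulmxA u (S ^+ k) B); set M := S ^+ k *m B; clearbody M => skM <-.
  by rewrite !trmx_mul trmxK skM mulNmx mulmxN mulmxA.
(* The second chain is reversed, so that [B] pairs row [i] with row [r + i], and [A], equal to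
   [S *m B + l *: B], gives the Jordan block. *)
pose W := \matrix_(i < r.*2) (if (i < r)%N then u *m S ^+ i else v *m S ^+ (r.-1 - (i - r))).
have rowW i : row i W = if (i < r)%N then u *m S ^+ i else v *m S ^+ (r.-1 - (i - r)) by rewrite rowK.
exists l, r, W; split=> //.
- apply/matrixP => i j; rewrite gram_entry !rowW [RHS]mxE /jk_entry /= /skew_entry.
  case: (ltnP i r) => ir; case: (ltnP j r) => jr; rewrite /= formA ?form0 ?formuv ?formvu ?scaler0 ?addr0 ?mxE //.
  + rewrite mulr1n /jordan_entry addrC; congr (_ + _).
      rewrite (_ : (_ == r.-1) = (i == j - r :> nat)%N); last by apply/eqP/eqP; have : (j < r.*2)%N := ltn_ord j; rewrite /jk_size /=; lia.
      by case: eqP => _; rewrite ?mulr1 ?mulr0.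
    rewrite (_ : (_ == r.-1) = (i.+1 == j - r :> nat)%N); last by apply/eqP/eqP; have : (j < r.*2)%N := ltn_ord j; rewrite /jk_size /=; lia.
    by case: eqP.
  + rewrite !mulrN -opprD addrC /jordan_entry; congr (- (_ + _)).
      rewrite (_ : (_ == r.-1) = (j == i - r :> nat)%N); last by apply/eqP/eqP; have : (i < r.*2)%N := ltn_ord i; rewrite /jk_size /=; lia.
      by case: eqP => _; rewrite ?mulr1 ?mulr0.
    rewrite (_ : (_ == r.-1) = (j.+1 == i - r :> nat)%N); last by apply/eqP/eqP; have : (i < r.*2)%N := ltn_ord i; rewrite /jk_size /=; lia.
    by case: eqP.
- apply/matrixP => i j; rewrite gram_entry !rowW [RHS]mxE /jk_entry /= /skew_entry.
  case: (ltnP i r) => ir; case: (ltnP j r) => jr; rewrite /= formS ?form0 ?formuv ?formvu ?mxE //.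
  + rewrite mulr1n /id_entry; congr ((_ : bool)%:R); apply/eqP/eqP; have : (j < r.*2)%N := ltn_ord j; rewrite /jk_size /=; lia.
  + rewrite mulr1n /id_entry; congr (- (_ : bool)%:R); apply/eqP/eqP; have : (i < r.*2)%N := ltn_ord i; rewrite /jk_size /=; lia.
move=> m W2 W2B.
have rowB i : row i W *m B *m W2^T = 0 by rewrite -!row_mul W2B row0.
have uB k : u *m S ^+ k *m B *m W2^T = 0.
  have [kr|rk] := ltnP k r; last by rewrite uSr ?mul0mx.
  have kr2 : (k < r.*2)%N by lia.
  by have := rowB (Ordinal kr2); rewrite rowW /= kr.
have vB k : v *m S ^+ k *m B *m W2^T = 0.
  have [kr|rk] := ltnP k r; last by rewrite vSr ?mul0mx.
  have kr2 : (r + (r.-1 - k) < r.*2)%N by lia.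
  have := rowB (Ordinal kr2); rewrite rowW /= ltnNge leq_addr /=.
  by rewrite (_ : (r.-1 - _)%N = k) //; lia.
apply/row_matrixP => i; rewrite !row_mul row0 rowW AE mulmxDr mulmxDl -scalemxAr -scalemxAl mulmxA.
case: ifP => _; rewrite -[_ *m S ^+ _ *m S]mulmxA SpS ?uB ?vB scaler0 addr0 //.
Qed.

(** Nondegeneracy on the span of [W1] makes that span meet its orthogonal complement trivially. A
    vector in the radical of the form on the complement is then orthogonal to everything. *)
Lemma orthogonal_split n m (B : 'M[F]_n) (W1 : 'M_(m, n)) :
  B^T = - B -> W1 *m B *m W1^T \in unitmx ->
  exists n' (W2 : 'M[F]_(n', n)),
    [/\ (m + n')%N = n, row_free (col_mx W1 W2), W1 *m B *m W2^T = 0 &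
        B \in unitmx -> W2 *m B *m W2^T \in unitmx].
Proof.
move=> skB Wu; pose W2 := row_base (kermx (B *m W1^T)).
have W21 : W2 *m B *m W1^T = 0.
  by apply/eqP; rewrite -mulmxA -sub_kermx eq_row_base.
have W12 : W1 *m B *m W2^T = 0 by apply: skew_comm0 W21.
have nE : (m + \rank (kermx (B *m W1^T)))%N = n.
  have rk : \rank (B *m W1^T) = m.
    apply/eqP; rewrite eqn_leq rank_leq_col -{1}(mxrank_unit Wu) -mulmxA.
    exact: mxrankM_maxr.
  by rewrite mxrank_ker rk subnKC // -rk rank_leq_row.
have W2free v : v *m W2 = 0 -> v = 0 :> 'rV_(\rank (kermx (B *m W1^T))).
  by move=> v0; apply: (row_free_inj (row_base_free _)); rewrite -/W2 v0 mul0mx.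
have Wfree : row_free (col_mx W1 W2).
  apply: inj_row_free => v; rewrite -[v]hsubmxK mul_row_col => v0.
  have v1 : lsubmx v = 0.
    have := congr1 (fun w => w *m B *m W1^T) v0.
    rewrite !mulmxDl -[_ *m W2 *m B]mulmxA -[_ *m (W2 *m B) *m _]mulmxA W21 mulmx0 addr0 !mul0mx.
    rewrite -[_ *m W1 *m B]mulmxA -mulmxA => /(congr1 (mulmx^~ (invmx (W1 *m B *m W1^T)))).
    by rewrite mulmxK // mul0mx.
  move: v0; rewrite v1 mul0mx add0r => /W2free ->; exact: row_mx0.
exists _, W2; split=> // Bu.
rewrite -row_free_unit; apply: inj_row_free => v v0.
have full : row_full (col_mx W1 W2) by rewrite /row_full (eqP Wfree) nE.
have [X XW] := row_fullP full.
have : v *m W2 *m B *m (col_mx W1 W2)^T = 0.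
  have e k (W : 'M_(k, n)) : v *m W2 *m B *m W^T = v *m (W2 *m B *m W^T) by rewrite !mulmxA.
  by rewrite tr_col_mx mul_mx_row !e W21 v0 mulmx0 row_mx0.
move/(congr1 (mulmx^~ X^T)); rewrite -mulmxA -trmx_mul XW trmx1 mulmx1 mul0mx.
by move/(congr1 (mulmx^~ (invmx B))); rewrite mulmxK // mul0mx => /W2free.
Qed.

Theorem skew_jordan n (A B : 'M[F]_n) :
  B \in unitmx -> A^T = - A -> B^T = - B ->
  exists bs, (forall b, b \in bs -> exists l, b.1 = Some (Some l)) /\ jk_decomp A B bs.
Proof.
elim/ltn_ind: n A B => -[|n] IH A B Bu skA skB.
  by exists [::]; split=> //; apply: jk_decomp_nil.
have [l [r [W1 [r0 WA WB W2A]]]] := jordan_split Bu skA skB.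
have Wu : W1 *m B *m W1^T \in unitmx by rewrite WB; exact: jk_blk_jordan_unit.
have [n' [W2 [nE Wfree W12 /(_ Bu) B2u]]] := orthogonal_split skB Wu.
have [|||bs [bsl dec]] := IH n' _ (W2 *m A *m W2^T) (W2 *m B *m W2^T) B2u.
- by rewrite -nE -addn1 addnC leq_add2r; lia.
- exact: skew_congr.
- exact: skew_congr.
exists ((Some (Some l), r) :: bs); split.
  by move=> b; rewrite inE => /orP[/eqP->|/bsl//]; exists l.
by apply: (@jk_decomp_cons _ (Some (Some l), r) bs n.+1 n' A B W1 W2) => //; apply: W2A.
Qed.

End Split.

(** * Jordan sizes and ranks of powers *)

Section JordanType.
Variable F : fieldType.

Definition shift_mx r j : 'M[F]_r := \matrix_(a, b) (a + j == b)%N%:R.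

Lemma rank_shift_mx r j : \rank (shift_mx r j) = (r - j)%N.
Proof.
pose L : 'M[F]_(r, r - j) := \matrix_(a, c) (a == c :> nat)%:R.
pose D : 'M[F]_(r - j, r) := \matrix_(c, b) (c + j == b)%N%:R.
have -> : shift_mx r j = L *m D.
  apply/matrixP => a b; rewrite !mxE.
  have [lt|ge] := ltnP a (r - j).
    rewrite (bigD1 (Ordinal lt)) //= !mxE eqxx mul1r big1 ?addr0 // => c ca.
    by rewrite !mxE; case: (nat_of_ord a =P c) ca => [ac|_ _]; rewrite ?mul0r // => /eqP[]; apply/val_inj => /=; lia.
  rewrite big1 => [|c _]; last by rewrite !mxE; case: eqP => [ac|]; rewrite ?mul0r //; have := ltn_ord c; lia.
  by case: eqP => // e; have := ltn_ord b; lia.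
have DD : D *m D^T = 1%:M.
  apply/matrixP => c c'; rewrite !mxE.
  have lt : (c + j < r)%N by have := ltn_ord c; lia.
  rewrite (bigD1 (Ordinal lt)) //= !mxE eqxx mul1r big1 ?addr0 => [|b bc].
    by congr ((_ : bool)%:R); apply/eqP/eqP => /= e; [apply/val_inj => /=; lia | rewrite e].
  by rewrite !mxE; case: ((c + j)%N =P b) bc => [e|_ _]; rewrite ?mul0r // => /eqP[]; apply/val_inj => /=; lia.
have LL : L^T *m L = 1%:M.
  apply/matrixP => c c'; rewrite !mxE.
  have lt : (c < r)%N by have := ltn_ord c; lia.
  rewrite (bigD1 (Ordinal lt)) //= !mxE eqxx mul1r big1 ?addr0 // => b bc.
  by rewrite !mxE; case: (nat_of_ord b =P c) bc => [e|_ _]; rewrite ?mul0r // => /eqP[]; apply/val_inj => /=; lia.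
rewrite mxrankMfree; last by apply/row_freeP; exists D^T.
by rewrite -mxrank_tr; apply/eqP; apply/row_freeP; exists L.
Qed.

Lemma jordan_mx_exp r j : jordan_mx true 0 r ^+ j = shift_mx r j :> 'M[F]_r.
Proof.
elim: j => [|j IH].
  by rewrite expr0; apply/matrixP => a b; rewrite !mxE addn0.
rewrite exprSr IH; apply/matrixP => a b; rewrite !mxE.
have [lt|ge] := ltnP (a + j) r.
  rewrite (bigD1 (Ordinal lt)) //= !mxE eqxx mul1r big1 ?addr0 => [|c ca].
    by rewrite /jordan_entry if_same add0r addnS; case: eqP.
  by rewrite !mxE; case: ((a + j)%N =P c) ca => [e|_ _]; rewrite ?mul0r // => /eqP[]; apply/val_inj => /=; lia.
rewrite big1 => [|c _]; last by rewrite !mxE; case: eqP => [e|]; rewrite ?mul0r //; have := ltn_ord c; lia.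
by case: eqP => // e; have := ltn_ord b; lia.
Qed.

Lemma jordan_mx_unit (l : F) r : l != 0 -> jordan_mx true l r \in unitmx.
Proof.
move=> l0; rewrite -unitmx_tr unitmxE det_trig; last first.
  apply/is_trig_mxP => a b ab; rewrite !mxE /jordan_entry.
  by rewrite [(_ == _)%N]gtn_eqF // [(_ == _)%N]gtn_eqF ?addr0 // ltnW.
rewrite unitfE prodf_seq_neq0; apply/allP => a _.
by rewrite !mxE /jordan_entry eqxx gtn_eqF ?addr0.
Qed.

Lemma rank_jordan_exp (l : F) r j :
  (\rank (jordan_mx true l r ^+ j) + (if l == 0%R then minn r j else 0%N))%N = r.
Proof.
case: eqP => [->|/eqP l0]; first by rewrite jordan_mx_exp rank_shift_mx; lia.
rewrite addn0 mxrank_unit //.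
elim: j => [|j IH]; first by rewrite expr0 unitmx1.
by rewrite exprS unitmx_mul IH jordan_mx_unit.
Qed.

Lemma exp_diag_block n1 n2 (X : 'M[F]_n1) (Y : 'M[F]_n2) j :
  block_mx X 0 0 Y ^+ j = block_mx (X ^+ j) 0 0 (Y ^+ j).
Proof.
elim: j => [|j IH]; first by rewrite !expr0 -scalar_mx_block.
rewrite !exprS IH -[_ * block_mx _ _ _ _]/(_ *m _) mulmx_block.
by rewrite !(mul0mx, mulmx0, addr0, add0r).
Qed.

Definition pencil_op n (A B : 'M[F]_n) l := (A - l *: B) *m invmx B.

Lemma pencil_opP n (A B T : 'M[F]_n) l : B \in unitmx -> T *m B = A - l *: B -> pencil_op A B l = T.
Proof. by move=> Bu TB; rewrite /pencil_op -TB mulmxK. Qed.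

(** Contribution of a block to the kernel dimension of [pencil_op A B l ^+ j]: it consists of two
    Jordan cells of order [b.2], each giving [minn b.2 j] at its own eigenvalue and nothing at
    another. *)
Definition jk_height l j (b : jkblock F) : nat :=
  if b.1 == Some (Some l) then (minn b.2 j).*2 else 0%N.

Lemma castmx_pencil m n (e : m = n) (T A B : 'M[F]_m) l : T *m B = A - l *: B ->
  castmx (e, e) T *m castmx (e, e) B = castmx (e, e) A - l *: castmx (e, e) B.
Proof. by case: n / e; rewrite !castmx_id. Qed.

Lemma rank_castmx_exp m n (e : m = n) (T : 'M[F]_m) j :
  \rank (castmx (e, e) T ^+ j) = \rank (T ^+ j).
Proof. by case: n / e; rewrite castmx_id. Qed.

Lemma rank_jordan_block (l0 : F) r l j :
  (\rank (pencil_op (jk_blk true (Some (Some l0), r)) (jk_blk false (Some (Some l0), r)) l ^+ j)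
   + jk_height l j (Some (Some l0), r))%N = r.*2.
Proof.
have Bu := jk_blk_jordan_unit l0 r.
pose X := jordan_mx true (l0 - l) r.
have XE : jordan_mx true l0 r - l *: 1%:M = X.
  apply/matrixP => a b; rewrite !mxE /jordan_entry addrAC; congr (_ + _).
  by rewrite -[(a == b)]/(a == b :> nat); case: eqP => _; rewrite ?mulr1 ?mulr0 ?subr0.
pose T := castmx (addnn r, addnn r) (block_mx X 0 0 X^T).
have TE : pencil_op (jk_blk true (Some (Some l0), r)) (jk_blk false (Some (Some l0), r)) l = T.
  apply: pencil_opP => //; rewrite !jk_blk_jordan; apply: castmx_pencil.
  rewrite mulmx_block !(mul0mx, mulmx0, addr0, add0r).
  rewrite jordan_mx_id trmx1 mulmx1 mulmxN mulmx1 scale_block_mx opp_block_mx add_block_mx.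
  rewrite !(scaler0, oppr0, addr0, scalerN) -XE linearB /=.
  have -> : (l *: 1%:M)^T = l *: 1%:M :> 'M_r by rewrite scalemx1 tr_scalar_mx.
  congr block_mx; apply/matrixP => a b; rewrite !mxE.
  by rewrite opprD.
rewrite TE.
have -> : \rank (T ^+ j) = (\rank (X ^+ j)).*2.
  rewrite /T rank_castmx_exp exp_diag_block rank_diag_block_mx.
  have -> : X^T ^+ j = (X ^+ j)^T.
    elim: j => [|j IH]; first by rewrite !expr0 trmx1.
    by rewrite exprS exprSr IH -[_ * _]/(_ *m _) -trmx_mul.
  by rewrite mxrank_tr addnn.
have := rank_jordan_exp (l0 - l) r j; rewrite subr_eq0 /jk_height /=.
rewrite (inj_eq (inj_comp (@Some_inj _) (@Some_inj _))).
by case: eqP => _; rewrite -/X; lia.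
Qed.

Lemma jk_mx_unit n (bs : seq (jkblock F)) : (\sum_(b <- bs) jk_size b)%N = n ->
  (forall b, b \in bs -> exists l, b.1 = Some (Some l)) ->
  (jk_mx n false bs : 'M[F]_n) \in unitmx.
Proof.
elim: bs n => [|b bs IH] n; first by rewrite big_nil => <- _; rewrite unitmxE det_mx00 unitr1.
rewrite big_cons => <- bsl; rewrite jk_mx_cons unitmxE det_ublock unitrM -!unitmxE.
rewrite IH // => [|b' b's]; last by apply: bsl; rewrite inE b's orbT.
have [l] := bsl b (mem_head _ _); case: b {bsl} => [_ r] /= ->.
by rewrite jk_blk_jordan_unit.
Qed.

Lemma rank_jk_list n (bs : seq (jkblock F)) l j : (\sum_(b <- bs) jk_size b)%N = n ->
  (forall b, b \in bs -> exists l, b.1 = Some (Some l)) ->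
  (\rank (pencil_op (jk_mx n true bs) (jk_mx n false bs) l ^+ j)
   + (\sum_(b <- bs) jk_height l j b))%N = n.
Proof.
elim: bs n => [|b bs IH] n.
  by rewrite !big_nil => <- _; rewrite addn0; apply/eqP; rewrite -leqn0 rank_leq_row.
rewrite !big_cons => <- bsl; rewrite !jk_mx_cons.
have bsl' b' : b' \in bs -> exists l, b'.1 = Some (Some l).
  by move=> b's; apply: bsl; rewrite inE b's orbT.
have bu : jk_blk false b \in unitmx.
  have [l'] := bsl b (mem_head _ _); case: b {bsl} => [_ r] /= ->.
  exact: jk_blk_jordan_unit.
have bsu := jk_mx_unit erefl bsl'.
rewrite (@pencil_opP _ _ _ (block_mx (pencil_op (jk_blk true b) (jk_blk false b) l) 0 0
   (pencil_op (jk_mx _ true bs) (jk_mx _ false bs) l))).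
- rewrite exp_diag_block rank_diag_block_mx addnACA IH //; congr (_ + _)%N.
  have [l'] := bsl b (mem_head _ _); case: b {bsl bu} => [_ r] /= ->.
  exact: rank_jordan_block.
- by rewrite unitmxE det_ublock unitrM -!unitmxE bu.
rewrite mulmx_block !(mul0mx, mulmx0, addr0, add0r) !mulmxKV //.
by rewrite scale_block_mx opp_block_mx add_block_mx !(scaler0, oppr0, addr0).
Qed.

(** A congruence of the pair by [P] conjugates [pencil_op] by [P^T], so the ranks can be read off
    the canonical form. *)
Lemma rank_jk_decomp n (A B : 'M[F]_n) bs l j : B \in unitmx -> jk_decomp A B bs ->
  (forall b, b \in bs -> exists l, b.1 = Some (Some l)) ->
  (\rank (pencil_op A B l ^+ j) + (\sum_(b <- bs) jk_height l j b))%N = n.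
Proof.
move=> Bu [_ [szE [P [Pu [AP BP]]]]] bsl.
rewrite -[RHS](rank_jk_list l j szE bsl); congr (_ + _)%N.
rewrite -AP -BP; have : pencil_op A B l *m B = A - l *: B by rewrite mulmxKV.
move: (pencil_op A B l) => T TB.
rewrite (@pencil_opP _ _ _ (P^T *m T *m invmx P^T)); last first.
- rewrite -!mulmxA (mulmxA (invmx _)) mulVmx ?unitmx_tr // mul1mx.
  by rewrite (mulmxA T) TB mulmxBl mulmxBr -scalemxAl -scalemxAr !mulmxA.
- by rewrite !unitmx_mul unitmx_tr Pu Bu.
have -> : (P^T *m T *m invmx P^T) ^+ j = P^T *m T ^+ j *m invmx P^T.
  elim: j => [|j IH]; first by rewrite !expr0 mulmx1 mulmxV // unitmx_tr.
  rewrite !exprS IH -![_ * _]/(_ *m _) -!mulmxA (mulmxA (invmx _)) mulVmx ?unitmx_tr // mul1mx.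
  by rewrite !mulmxA.
rewrite mxrankMfree ?row_free_unit ?unitmx_inv ?unitmx_tr //.
by rewrite -[RHS]mxrank_tr trmx_mul mxrankMfree ?mxrank_tr // trmxK row_free_unit.
Qed.

End JordanType.

(** * Pfaffians *)

Section EvenOdd.
Variable m : nat.

Lemma even_ord_subproof (j : 'I_m) : (j.*2 < m.*2)%N.
Proof. by rewrite ltn_double. Qed.
Lemma odd_ord_subproof (j : 'I_m) : (j.*2.+1 < m.*2)%N.
Proof. have := ltn_ord j; lia. Qed.
Definition even_ord j := Ordinal (even_ord_subproof j).
Definition odd_ord j := Ordinal (odd_ord_subproof j).

Lemma half_subproof (i : 'I_(m.*2)) : (i./2 < m)%N.
Proof. have := ltn_ord i; lia. Qed.
Definition half_ord i := Ordinal (half_subproof i).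

Lemma ev_halfK (i : 'I_(m.*2)) : ~~ odd i -> even_ord (half_ord i) = i.
Proof. by move=> oi; apply/val_inj => /=; lia. Qed.

Lemma od_halfK (i : 'I_(m.*2)) : odd i -> odd_ord (half_ord i) = i.
Proof. by move=> oi; apply/val_inj => /=; lia. Qed.

Lemma half_ev j : half_ord (even_ord j) = j.
Proof. by apply/val_inj => /=; lia. Qed.

Lemma half_od j : half_ord (odd_ord j) = j.
Proof. by apply/val_inj => /=; lia. Qed.

Lemma ordS_ev j : ordS (even_ord j) = odd_ord j.
Proof. by apply/val_inj; rewrite /= modn_small //; exact: odd_ord_subproof. Qed.

Lemma prod_even (R : comNzRingType) (G : 'I_(m.*2) -> R) :
  \prod_(i : 'I_(m.*2) | ~~ odd i) G i = \prod_(j < m) G (even_ord j).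
Proof.
rewrite (reindex_onto even_ord half_ord) => [|i]; last exact: ev_halfK.
by apply: eq_bigl => j; rewrite half_ev eqxx andbT /= odd_double.
Qed.

Lemma prod_odd (R : comNzRingType) (G : 'I_(m.*2) -> R) :
  \prod_(i : 'I_(m.*2) | odd i) G i = \prod_(j < m) G (odd_ord j).
Proof.
rewrite (reindex_onto odd_ord half_ord) => [|i]; last exact: od_halfK.
by apply: eq_bigl => j; rewrite half_od eqxx andbT /= odd_double.
Qed.

Lemma prod_even_odd (R : comNzRingType) (G : 'I_(m.*2) -> R) :
  \prod_i G i = \prod_(j < m) G (even_ord j) * \prod_(j < m) G (odd_ord j).
Proof. by rewrite (bigID (fun i : 'I__ => odd i)) /= mulrC prod_even prod_odd. Qed.

End EvenOdd.

Section Pfaffian.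
Variable R : comNzRingType.

(** The Pfaffian without its factor 1/(2^m m!), so that it makes sense over every commutative
    ring. *)
Definition pf_sum m (A : 'M[R]_(m.*2)) : R :=
  \sum_(s : 'S_(m.*2)) (-1) ^+ s * \prod_(j < m) A (s (even_ord j)) (s (odd_ord j)).

Lemma det_colsub_sum k (B : 'M[R]_k) (f : 'I_k -> 'I_k) :
  \sum_(s : 'S_k) (-1) ^+ s * \prod_i B (s i) (f i) = \det (colsub f B).
Proof.
rewrite -det_tr; apply: eq_bigr => s _; congr (_ * _).
by apply: eq_bigr => i _; rewrite !mxE.
Qed.

(** Expand over all index functions [h]: the sum over permutations becomes the determinant of [B]
    with columns chosen by [h], which vanishes unless [h] is a permutation. *)
Lemma pf_sum_congr m (A B : 'M[R]_(m.*2)) :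
  pf_sum (B *m A *m B^T) = \det B * pf_sum A.
Proof.
pose k := m.*2; pose FF := {ffun 'I_k -> 'I_k}.
(* [g] interlaces [m] pairs into one function on the [m.*2] indices; [g'] is its inverse. *)
pose g (f : {ffun 'I_m -> 'I_k * 'I_k}) : FF :=
  [ffun i : 'I_(m.*2) => if odd i then (f (half_ord i)).2 else (f (half_ord i)).1].
pose g' (h : FF) : {ffun 'I_m -> 'I_k * 'I_k} := [ffun j => (h (even_ord j), h (odd_ord j))].
have gK : cancel g g'.
  move=> f; apply/ffunP => j; rewrite !ffunE /= odd_double /= half_ev half_od.
  by case: (f j).
have g'K : cancel g' g.
  move=> h; apply/ffunP => i; rewrite !ffunE.
  by case: ifP => oi; rewrite /= ?od_halfK ?ev_halfK ?oi.
transitivity (\sum_(h : FF) (\sum_(s : 'S_k) (-1) ^+ s * \prod_i B (s i) (h i)) *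
    \prod_(j < m) A (h (even_ord j)) (h (odd_ord j))).
  under [RHS]eq_bigr => h _ do rewrite big_distrl /=.
  rewrite exchange_big; apply: eq_bigr => /= s _.
  under [RHS]eq_bigr => h _ do rewrite -mulrA.
  rewrite -big_distrr /=; congr (_ * _).
  pose G j (p : 'I_k * 'I_k) := B (s (even_ord j)) p.1 * A p.1 p.2 * B (s (odd_ord j)) p.2.
  transitivity (\prod_(j < m) \sum_p G j p).
    apply: eq_bigr => j _; rewrite mxE.
    under eq_bigr => b _ do rewrite mxE big_distrl /=.
    rewrite exchange_big pair_bigA /=; apply: eq_bigr => p _.
    by rewrite mxE.
  rewrite bigA_distr_bigA /= (reindex g') /=; last by apply: onW_bij; exists g.
  apply: eq_bigr => h _; rewrite prod_even_odd -!big_split /=.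
  apply: eq_bigr => j _; rewrite /G ffunE /=; exact: mulrAC.
under eq_bigr => h _ do rewrite det_colsub_sum.
rewrite (bigID (fun h : FF => injectiveb h)) /= addrC big1 ?add0r => [|h /injectivePn [i [j ij hij]]].
  rewrite (reindex (@pval _)) /=; last first.
    pose in_Sn := insubd (1%g : 'S_k).
    by exists in_Sn => /= f Uf; first apply: val_inj; apply: insubdK.
  rewrite /pf_sum big_distrr /=; apply: eq_big => [s|s _]; first exact: (valP s).
  have -> : colsub (pval s) B = col_perm s B by apply/matrixP => a b; rewrite !mxE pvalE.
  rewrite col_permE det_mulmx det_perm odd_permV -mulrA.
  by congr (_ * (_ * _)); apply: eq_bigr => j _; rewrite -!pvalE.
rewrite -det_tr (determinant_alternate ij) ?mul0r // => b.
by rewrite !mxE hij.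
Qed.

Lemma pf_sum_zero m (A : 'M[R]_(m.*2)) i :
  (forall j, A i j = 0) -> (forall j, A j i = 0) -> pf_sum A = 0.
Proof.
move=> Ai0 A0i; apply: big1 => s _.
suff -> : \prod_(j < m) A (s (even_ord j)) (s (odd_ord j)) = 0 by rewrite mulr0.
pose l := (s^-1)%g i; have sl : s l = i by rewrite permKV.
rewrite (bigD1 (half_ord l)) //=; have [ol|el] := boolP (odd l).
  by rewrite od_halfK // sl A0i mul0r.
by rewrite ev_halfK // sl Ai0 mul0r.
Qed.

End Pfaffian.

Section PfaffianDet.
Variable F : numClosedFieldType.

(** Replace a basis vector by a kernel vector whose coordinate there is nonzero; the congruent
    matrix has a zero row and a zero column. *)
Lemma pf_sum_singular m (A : 'M[F]_(m.*2)) : A^T = - A -> A \notin unitmx -> pf_sum A = 0.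
Proof.
move=> skA; rewrite -row_free_unit -kermx_eq0 => /rowV0Pn [v /sub_kermxP vA v0].
have [i vi] : exists i, v 0 i != 0.
  by apply/existsP; apply: contraR v0 => /existsPn H; apply/eqP/rowP => i; rewrite mxE; exact/eqP/negPn/H.
pose B := \matrix_j (if j == i then v else delta_mx 0 j).
have Bu : B \in unitmx.
  rewrite -row_free_unit; apply: inj_row_free => x xB.
  have xE : \sum_j x 0 j *: row j B = 0 by rewrite -mulmx_sum_row xB.
  have xi : x 0 i = 0.
    have /matrixP/(_ 0 i) := xE; rewrite summxE (bigD1 i) //= rowK !mxE eqxx big1 ?addr0 => [/eqP|j ji].
      by rewrite mulf_eq0 (negPf vi) orbF => /eqP.
    by rewrite !mxE (negPf ji) !mxE eqxx [i == j]eq_sym (negPf ji) mulr0.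
  apply/rowP => j; rewrite mxE; have [->//|ji] := eqVneq j i.
  have /matrixP/(_ 0 j) := xE; rewrite summxE (bigD1 j) //= big1 ?addr0 => [|l lj].
    by rewrite !mxE (negPf ji) !mxE !eqxx mulr1.
  rewrite !mxE; have [->|li] := eqVneq l i; first by rewrite xi mul0r.
  by rewrite !mxE eqxx [j == l]eq_sym (negPf lj) mulr0.
have BA : row i (B *m A *m B^T) = 0 by rewrite !row_mul rowK eqxx vA mul0mx.
have skB : (B *m A *m B^T)^T = - (B *m A *m B^T) := skew_congr B skA.
have := pf_sum_congr A B; rewrite (pf_sum_zero (i := i)) => [/esym/eqP|j|j].
- by rewrite mulf_eq0 => /orP[/eqP d0|/eqP//]; move: Bu; rewrite unitmxE d0 unitr0.
- by move/rowP/(_ j): BA; rewrite !mxE.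
- have := congr1 (fun M : 'M_ _ => M i j) skB; rewrite mxE [RHS]mxE.
  by move/rowP/(_ j): BA; rewrite [LHS]mxE [RHS]mxE => ->; rewrite oppr0.
Qed.

(** Apply the Jordan form to the pair [(0, A)]: the operator is zero, so counting kernel dimensions
    forces every block to have eigenvalue 0 and order 2. *)
Lemma skew_canonical m (A : 'M[F]_(m.*2)) : A^T = - A -> A \in unitmx ->
  exists2 P, P \in unitmx & P^T *m A *m P = jk_mx (m.*2) false (nseq m (Some (Some 0), 1%N)).
Proof.
move=> skA Au; have sk0 : (0 : 'M[F]_(m.*2))^T = - 0 by rewrite trmx0 oppr0.
have [bs [bsl dec]] := skew_jordan Au sk0 skA.
have := rank_jk_decomp 0 1 Au dec bsl.
rewrite /pencil_op scale0r subr0 mul0mx expr1 mxrank0 add0n => hE.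
have [bsv [szE [P [Pu [_ BP]]]]] := dec.
have {}szE : (\sum_(b <- bs) jk_size b)%N = m.*2 := szE.
suff bsE : bs = nseq (size bs) (Some (Some 0), 1%N).
  exists P => //; rewrite BP bsE; congr (jk_mx _ _ (nseq _ _)).
  by move: szE; rewrite {1}bsE big_nseq iter_addn_0 /jk_size /=; lia.
have leh b : b \in bs -> (jk_height 0%R 1 b <= jk_size b)%N.
  move=> bbs; have [l] := bsl b bbs; rewrite /jk_height /jk_size; case: (b) => a r /= ->.
  by case: ifP => _; lia.
apply/all_pred1P/allP => b bbs /=.
have hb : jk_height 0%R 1 b = jk_size b.
  apply/eqP; rewrite eqn_leq leh //=.
  have e : (\sum_(b <- bs) jk_height 0%R 1 b = \sum_(b <- bs) jk_size b)%N by rewrite hE szE.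
  move: e; rewrite !(big_rem b bbs) /= => e.
  have le : (\sum_(y <- rem b bs) jk_height 0%R 1 y <= \sum_(y <- rem b bs) jk_size y)%N.
    by rewrite !big_seq; apply: leq_sum => y /mem_rem /leh.
  by rewrite -(leq_add2r (\sum_(y <- rem b bs) jk_size y)) -e leq_add2l.
have [l] := bsl b bbs; have := allP bsv b bbs; rewrite /jk_valid.
case: b hb {bbs} => a r /= hb r0 bE; move: hb; rewrite bE /jk_height /jk_size /=.
case: eqP => [[->]|_] h; last by lia.
by rewrite (_ : r = 1%N) //; lia.
Qed.

(** Invertible skew matrices are all congruent to one canonical form, so the ratio of determinant to
    squared Pfaffian is the same for all. Comparing with a reference [A0] avoids computing this
    ratio. *)
Lemma pf_sum_det m (A A0 : 'M[F]_(m.*2)) : A^T = - A -> A0^T = - A0 -> pf_sum A0 != 0 ->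
  \det A * pf_sum A0 ^+ 2 = \det A0 * pf_sum A ^+ 2.
Proof.
move=> skA skA0 pf0.
have A0u : A0 \in unitmx by apply: contraR pf0 => /(pf_sum_singular skA0) ->.
have [Au|An] := boolP (A \in unitmx); last first.
  rewrite (pf_sum_singular skA An) expr0n mulr0.
  by move: An; rewrite unitmxE unitfE negbK => /eqP ->; rewrite mul0r.
have [P Pu AP] := skew_canonical skA Au; have [Q Qu A0Q] := skew_canonical skA0 A0u.
have := pf_sum_congr A P^T; have := pf_sum_congr A0 Q^T.
rewrite !trmxK AP A0Q !det_tr => -> pfE.
have : \det (P^T *m A *m P) = \det (Q^T *m A0 *m Q) by rewrite AP A0Q.
rewrite !det_mulmx !det_tr => dE.
have P0 : \det P != 0 by move: Pu; rewrite unitmxE unitfE.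
have Q0 : \det Q != 0 by move: Qu; rewrite unitmxE unitfE.
apply: (mulfI (mulf_neq0 (expf_neq0 2 P0) (expf_neq0 2 Q0))).
transitivity ((\det P * \det A * \det P) * (\det Q * pf_sum A0) ^+ 2).
  by rewrite exprMn !expr2; ring.
by rewrite pfE dE exprMn !expr2; ring.
Qed.

End PfaffianDet.

Lemma pfaff_pf_sum (F : fieldType) (R : comAlgType F) m (A : 'M[R]_(m.*2)) :
  pfaff A = ((2 ^ m * m`!)%:R : F)^-1 *: pf_sum A.
Proof.
rewrite /pfaff odd_double doubleK; congr (_ *: _).
apply: eq_bigr => s _; congr (_ * _); rewrite prod_even.
by apply: eq_bigr => j _; rewrite ordS_ev.
Qed.

Lemma map_pf_sum (R S : comNzRingType) (f : {rmorphism R -> S}) m (A : 'M[R]_(m.*2)) :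
  f (pf_sum A) = pf_sum (map_mx f A).
Proof.
rewrite rmorph_sum; apply: eq_bigr => s _.
rewrite rmorphM rmorphXn rmorphN1 rmorph_prod; congr (_ * _).
by apply: eq_bigr => j _; rewrite mxE.
Qed.

Lemma pf_sum_perm (R : comNzRingType) m (A : 'M[R]_(m.*2)) (t : 'S_(m.*2)) :
  pf_sum (mxsub t t A) = (-1) ^+ t * pf_sum A.
Proof.
rewrite -[(-1) ^+ t](det_perm R) -pf_sum_congr; congr pf_sum.
rewrite -row_permE tr_perm_mx -col_permE.
by apply/matrixP => i j; rewrite !mxE.
Qed.

(** The Pfaffians in the definition of the fundamental semi-invariant run over ordered index
    choices; up to a permutation each of these drops a single index. *)
Lemma injection_lift k (f : 'I_k -> 'I_k.+1) : injective f ->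
  exists (l : 'I_k.+1) (t : 'S_k), forall i, f i = lift l (t i).
Proof.
move=> fI; have [l lf] : exists l, l \notin codom f.
  apply/existsP; apply: contraT => /existsPn H.
  have : (#|'I_k.+1| <= #|codom f|)%N.
    by apply: subset_leq_card; apply/subsetP => x _; apply/negPn/H.
  by rewrite card_codom // !card_ord ltnn.
have lfi i : l != f i by apply: contraNneq lf => ->; exact: codom_f.
have [g gP] : exists g : 'I_k -> 'I_k, forall i, f i = lift l (g i).
  exists (fun i => sval (unlift_some (lfi i))) => i.
  by case: (unlift_some (lfi i)).
have gI : injective g by move=> i j e; apply: fI; rewrite !gP e.
by exists l, (perm gI) => i; rewrite permE.
Qed.

(** * Adjugates of skew matrices of odd order *)

Section SkewOdd.
Variable F : numFieldType.

Lemma skew_odd_det m (A : 'M[F]_(m.*2.+1)) : A^T = - A -> \det A = 0.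
Proof.
move=> skA; have := det_tr A; rewrite skA -scaleN1r detZ -signr_odd /= odd_double /= mulN1r.
by move/eqP; rewrite eq_sym -addr_eq0 -mulr2n mulrn_eq0 /= => /eqP.
Qed.

Lemma skew_odd_adj m (A : 'M[F]_(m.*2.+1)) : A^T = - A -> (\adj A)^T = \adj A.
Proof.
by move=> skA; rewrite trmx_adj skA -scaleN1r adjZ /= -signr_odd odd_double scale1r.
Qed.

Lemma rank_adj0 k (A : 'M[F]_k.+1) : (\rank A < k)%N -> \adj A = 0.
Proof.
move=> rA; apply/matrixP => i j; rewrite !mxE /cofactor.
suff -> : \det (row' j (col' i A)) = 0 by rewrite mulr0.
apply/eqP; apply: contraLR rA => d0; rewrite -leqNgt.
have rk : \rank (row' j (col' i A)) = k by apply: mxrank_unit; rewrite unitmxE unitfE.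
apply: leq_trans (eq_leq (esym rk)) _.
have -> : row' j (col' i A) = rowsub (lift j) 1%:M *m A *m colsub (lift i) 1%:M.
  by rewrite mul_rowsub_mx mul1mx mulmx_colsub mulmx1; apply/matrixP => x y; rewrite !mxE.
by apply: leq_trans (mxrankM_maxl _ _) (mxrankM_maxr _ _).
Qed.

Lemma adj_neq0_rank k (A : 'M[F]_k.+1) : \adj A != 0 -> (k <= \rank A)%N.
Proof. by rewrite leqNgt; apply: contra => /rank_adj0 ->. Qed.

(** If the adjugate is nonzero, [A] has corank one, and [\adj A *m A = 0] leaves rank one for the
    adjugate, which is also symmetric. *)
Lemma skew_odd_adj_sqr m (A : 'M[F]_(m.*2.+1)) i j : A^T = - A ->
  (\adj A) i j ^+ 2 = (\adj A) i i * (\adj A) j j.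
Proof.
move=> skA; have [->|a0] := eqVneq (\adj A) 0; first by rewrite !mxE mul0r expr0n.
have sym : (\adj A) i j = (\adj A) j i by rewrite -[in LHS](skew_odd_adj skA) mxE.
rewrite expr2 {2}sym.
have rk : (\rank (\adj A) <= 1)%N.
  have := mulmx0_rank_max (_ : \adj A *m A = 0); rewrite mul_adj_mx skew_odd_det // raddf0.
  by move=> /(_ erefl); have := adj_neq0_rank a0; lia.
rewrite -(mulmx_base (\adj A)); move: (col_base _) (row_base _); move: rk.
case: (\rank _) => [|[|//]] _ u v; first by rewrite !mxE !big_ord0 !mul0r.
by rewrite !mxE !big_ord1 mulrACA [v _ _ * v _ _]mulrC mulrACA.
Qed.

End SkewOdd.

Section PfaffianVector.
Variables (F : numClosedFieldType) (N m : nat) (A : 'M[{mpoly F[N]}]_(m.*2.+1)).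
Hypothesis skA : A^T = - A.

Definition sub_pf l := pf_sum (mxsub (lift l) (lift l) A).

Let evA v : (map_mx (meval v) A)^T = - map_mx (meval v) A.
Proof.
apply/matrixP => i j; rewrite !mxE.
have /= := congr1 (fun B : 'M_ _ => B i j) skA; rewrite !mxE => ->.
by rewrite rmorphN.
Qed.

(** The entry is a principal minor, hence proportional to the squared Pfaffian; one reference
    submatrix at [v0] gives the same constant [g] for all [l]. *)
Lemma adj_diag l0 : sub_pf l0 != 0 ->
  exists2 g : F, g != 0 & forall l, (\adj A) l l = g *: sub_pf l ^+ 2.
Proof.
move=> /mpoly_nonroot [v0 v00].
pose A0 := map_mx (meval v0) (mxsub (lift l0) (lift l0) A).
have skS v l : (map_mx (meval v) (mxsub (lift l) (lift l) A))^T =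
    - map_mx (meval v) (mxsub (lift l) (lift l) A).
  by rewrite map_mxsub trmx_mxsub evA; apply/matrixP => i j; rewrite !mxE.
have pf0 : pf_sum A0 != 0 by rewrite -map_pf_sum.
have A0u : A0 \in unitmx by apply: contraR pf0 => /(pf_sum_singular (skS _ _)) ->.
exists (\det A0 / pf_sum A0 ^+ 2).
  by rewrite mulf_neq0 ?invr_eq0 ?expf_neq0 //; move: A0u; rewrite unitmxE unitfE.
move=> l; rewrite mxE /cofactor -signr_odd addnn odd_double mul1r.
apply: mpoly_eqP_eval => v; rewrite mevalZ rmorphXn /= map_pf_sum mulrAC.
rewrite -(@pf_sum_det _ _ (map_mx (meval v) (mxsub (lift l) (lift l) A)) A0 (skS v l) (skS v0 l0) pf0).
rewrite -mulrA mulfV ?expf_neq0 // mulr1.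
by rewrite -det_map_mx; congr (\det _); apply/matrixP => i j; rewrite !mxE.
Qed.

(** The squares determine an adjugate column up to signs, which [Q] absorbs. The kernel equation is
    [A *m \adj A = 0] with the factor [Q l0] cancelled. *)
Lemma pfaffian_vector l0 : sub_pf l0 != 0 ->
  exists (g : F) (Q : 'I_(m.*2.+1) -> {mpoly F[N]}),
    [/\ g != 0, Q l0 != 0, (forall i, Q i = sub_pf i \/ Q i = - sub_pf i),
        (forall i, (\adj A) i l0 = g *: (Q i * Q l0)) &
        (forall i, \sum_j A i j * Q j = 0)].
Proof.
move=> P0; have [g g0 diag] := adj_diag P0.
have sqr i : (\adj A) i l0 ^+ 2 = (g *: (sub_pf i * sub_pf l0)) ^+ 2.
  transitivity ((\adj A) i i * (\adj A) l0 l0).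
    have even_ord B v : (map_mx (meval v) B) i l0 = (B i l0).@[v] by rewrite mxE.
    apply: mpoly_eqP_eval => v; rewrite rmorphXn rmorphM /=.
    have := skew_odd_adj_sqr i l0 (evA v).
    by rewrite -map_mx_adj !mxE.
  by rewrite !diag -scalerAl -scalerAr scalerA -exprMn exprZn expr2.
pose Q i := if (\adj A) i l0 == g *: (sub_pf i * sub_pf l0) then sub_pf i else - sub_pf i.
have Ql0 : Q l0 = sub_pf l0 by rewrite /Q diag expr2 eqxx.
have QE i : (\adj A) i l0 = g *: (Q i * Q l0).
  rewrite Ql0 /Q; case: eqP => [//|ne].
  by have /eqP := sqr i; rewrite eqf_sqr => /orP[/eqP//|/eqP->]; rewrite mulNr scalerN.
exists g, Q; split=> //; first by rewrite Ql0.
  by move=> i; rewrite /Q; case: (_ == _); [left | right].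
move=> i; have det0 : \det A = 0.
  by apply: mpoly_eq0P => v; rewrite -det_map_mx; exact: skew_odd_det (evA v).
have E : (A *m \adj A) i l0 = g%:MP * (Q l0 * \sum_j A i j * Q j).
  rewrite mxE !mulr_sumr; apply: eq_bigr => j _.
  have sh (x y z t : {mpoly F[N]}) : x * (y * (z * t)) = y * (t * (x * z)) by ring.
  by rewrite QE -mul_mpolyC; exact: sh.
have {E} : g%:MP * (Q l0 * \sum_j A i j * Q j) = 0.
  by rewrite -E mul_mx_adj mxE det0 mul0rn.
move/eqP; rewrite mulf_eq0 mpolyC_eq0 (negPf g0) mulf_eq0 Ql0 (negPf P0).
by move/eqP.
Qed.

Lemma gcd_sub_pf p :
  is_gcd_of (fun q => exists f : 'I_(m.*2.+1 - 1) -> 'I_(m.*2.+1),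
     injective f /\ q = pfaff (mxsub f f A)) p ->
  (forall l, rdvd p (sub_pf l)) /\ (forall d, (forall l, rdvd d (sub_pf l)) -> rdvd d p).
Proof.
(* The order [m.*2.+1 - 1] occurs inside types, so it is generalized before being replaced by
   [m.*2]. *)
have key k : k = m.*2 -> is_gcd_of (fun q => exists f : 'I_k -> 'I_(m.*2.+1),
     injective f /\ q = pfaff (mxsub f f A)) p ->
  (forall l, rdvd p (sub_pf l)) /\ (forall d, (forall l, rdvd d (sub_pf l)) -> rdvd d p).
  move=> -> [pdiv pmax].
  pose c0 : F := (2 ^ m * m`!)%:R.
  have c00 : c0 != 0 by rewrite pnatr_eq0 muln_eq0 expn_eq0 /= -lt0n fact_gt0.
  split=> [l|d dA].
    have [|r rE] := pdiv (c0^-1 *: sub_pf l).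
      exists (lift l); split; first exact: lift_inj.
      by rewrite pfaff_pf_sum.
    by exists (c0 *: r); rewrite -scalerAl -rE scalerA mulfV // scale1r.
  apply: pmax => _ [f [fI ->]]; have [l [t ft]] := injection_lift fI.
  rewrite pfaff_pf_sum; have -> : mxsub f f A = mxsub t t (mxsub (lift l) (lift l) A).
    by apply/matrixP => i j; rewrite !mxE !ft.
  by rewrite pf_sum_perm -mul_mpolyC; apply/rdvd_mull/rdvd_mull/dA.
by apply: key; rewrite subn1.
Qed.

End PfaffianVector.

(** * Homogeneous polynomials *)

Section Homogeneous.
Variables (F : fieldType) (n : nat).
Implicit Types (p q : {mpoly F[n]}).

(* p(t x_1, ..., t x_n) as a polynomial in t. *)
Definition dilate : {mpoly F[n]} -> {poly {mpoly F[n]}} :=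
  mmap (polyC \o @mpolyC n F) (fun i => 'X * ('X_i)%:P).
HB.instance Definition _ := GRing.RMorphism.on dilate.

Lemma dilateX (m : 'X_{1..n}) : dilate 'X_[m] = ('X_[m])%:P * 'X^(mdeg m).
Proof.
rewrite mpolyXE_id rmorph_prod mdegE -prodrXr rmorph_prod -big_split /=.
apply: eq_bigr => i _; rewrite !rmorphXn /= /dilate mmapX mmap1U exprMn mulrC.
by [].
Qed.

Lemma dilateE p d : (dilate p)`_d = pihomog mdeg d p.
Proof.
rewrite {1}(mpolyE p) rmorph_sum coef_sum pihomogE [RHS]big_mkcond /=.
apply: eq_bigr => m _; rewrite -mul_mpolyC rmorphM /= dilateX.
rewrite /dilate mmapC /= mulrA -polyCM coefCM coefXn mul_mpolyC eq_sym.
by case: eqP => _; rewrite ?mulr1 ?mulr0.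
Qed.

Lemma dilate_homog p d : (p \is d.-homog) = (dilate p == p%:P * 'X^d).
Proof.
apply/idP/eqP => [ph|e].
  apply/polyP => e; rewrite dilateE coefCM coefXn.
  case: eqP => [->|/eqP ed]; first by rewrite mulr1 pihomog_dE.
  by rewrite mulr0 (pihomog_ne0 (mf := mdeg) _ ph) // eq_sym.
by rewrite homog_piE -dilateE e coefCM coefXn eqxx mulr1.
Qed.

Lemma dilate1 p : (dilate p).[1] = p.
Proof.
move: p; apply: (@mpoly_rmorph_eq _ _ _ (horner_eval 1 \o dilate) idfun) => [c|i] /=.
  by rewrite horner_evalE /dilate mmapC /= hornerC.
by rewrite horner_evalE /dilate mmapX mmap1U hornerM hornerX mul1r hornerC.
Qed.

(** Split the exact power of the dilation parameter off both factors. The two cofactors multiply to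
    a constant in that parameter, so each is constant in it. *)
Lemma homog_factor p q d : q != 0 -> p * q != 0 -> p * q \is d.-homog ->
  exists2 e, p \is e.-homog & (e <= d)%N.
Proof.
move=> q0 pq0; rewrite dilate_homog rmorphM /= => /eqP E.
have [a [P Pr PE]] := multiplicity_XsubC (dilate p) 0.
have [b [Q Qr QE]] := multiplicity_XsubC (dilate q) 0.
have dil0 r : r != 0 -> dilate r != 0.
  by apply: contra_neq => r0; rewrite -(dilate1 r) r0 horner0.
have p0 : p != 0 by apply: contraNneq pq0 => ->; rewrite mul0r.
rewrite dil0 //= in Pr; rewrite dil0 //= in Qr.
rewrite subr0 in PE QE.
have E' : (P * Q) * 'X^(a + b) = (p * q)%:P * 'X^d.
  by rewrite -E PE QE exprD mulrACA.
have PQr : ~~ root (P * Q) 0 by rewrite rootM negb_or Pr.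
have abd : (a + b = d)%N.
  apply/eqP; move: PQr; apply: contraR => abd.
  have /(congr1 (fun r : {poly _} => r`_(a + b))) := E'.
  rewrite coefMXn ltnn subnn coefCM coefXn (negPf abd) mulr0 => PQ0.
  by rewrite /root horner_coef0 PQ0.
have PQ1 : P * Q = (p * q)%:P.
  by move: E'; rewrite abd => /(mulIf (monic_neq0 (monicXn _ _))).
have sP : size P == 1.
  have P0 : P != 0 by apply: contraNneq Pr => ->; rewrite root0.
  have Q0 : Q != 0 by apply: contraNneq Qr => ->; rewrite root0.
  have : size (P * Q) == 1 by rewrite PQ1 size_polyC pq0.
  by rewrite size_mul //; move: P0 Q0; rewrite -!size_poly_gt0; move: (size P) (size Q) => x y; lia.
have /size_poly1P [c c0 Pc] := sP.
exists a; last by rewrite -abd leq_addr.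
have pc : p = c by rewrite -(dilate1 p) PE Pc !hornerE expr1n mulr1.
by rewrite dilate_homog PE Pc -pc.
Qed.

Lemma eulerX (m : 'X_{1..n}) :
  \sum_i 'X_i * mderiv i 'X_[F, m] = 'X_[F, m] *+ mdeg m.
Proof.
rewrite mdegE -sumrMnr; apply: eq_bigr => i _; rewrite mderivX -scalerAr.
case: (posnP (m i)) => [->|mi]; first by rewrite scale0r mulr0n.
rewrite -mpolyXD addmC submK; first by rewrite scaler_nat.
by apply/mnm_lepP => j; rewrite mnm1E; case: eqP => [<-|].
Qed.

Lemma euler p d : p \is d.-homog -> \sum_i 'X_i * mderiv i p = p *+ d.
Proof.
move=> ph; transitivity (\sum_(m <- msupp p) p@_m *: ('X_[F, m] *+ mdeg m)).
  under eq_bigr => i _ do rewrite [X in mderiv i X](mpolyE p) linear_sum mulr_sumr.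
  rewrite exchange_big /=; apply: eq_bigr => m _; rewrite -eulerX scaler_sumr.
  by apply: eq_bigr => i _; rewrite linearZ /= -scalerAr.
rewrite [in RHS](mpolyE p) -sumrMnl big_seq [RHS]big_seq.
by apply: eq_bigr => m mp; rewrite (dhomog_mf ph mp) scalerMnr.
Qed.

Lemma mderiv_homog p d i : p \is d.-homog -> mderiv i p \is d.-1.-homog.
Proof.
move=> ph; apply/dhomogP => m; rewrite mcoeff_msupp mcoeff_mderiv.
case: (boolP ((m + U_(i))%MM \in msupp p)) => [/(dhomog_mf ph)|/memN_msupp_eq0 ->].
  by rewrite /= mdegD mdeg1 addn1 => <-.
by rewrite mul0rn eqxx.
Qed.

Lemma mderiv_homog0 p i : p \is 0.-homog -> mderiv i p = 0.
Proof.
move=> ph; apply/mpolyP => m; rewrite mcoeff_mderiv mcoeff0.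
case: (boolP ((m + U_(i))%MM \in msupp p)) => [/(dhomog_mf ph)|/memN_msupp_eq0 ->].
  by rewrite /= mdegD mdeg1 addn1.
by rewrite mul0rn.
Qed.

Lemma homog0_const p : p \is 0.-homog -> exists c, p = c%:MP.
Proof.
move=> ph; exists p@_0; apply: msize1_polyC; rewrite msizeE.
by apply/bigmax_leqP_seq => m mp _; rewrite (dhomog_mf ph mp).
Qed.

Lemma homog_mdegree p d : p != 0 -> p \is d.-homog -> mdegree p = d.
Proof.
by move=> p0 ph; exact: dhomog_uniq p0 (dhomog_msize ph) ph.
Qed.

End Homogeneous.

(** * The Lie-Poisson bracket *)

Section DetDerivation.
Variables (R : comNzRingType) (D : R -> R).
Hypotheses (DD : {morph D : x y / x + y}) (DM : forall x y, D (x * y) = D x * y + x * D y).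

Let D0 : D 0 = 0.
Proof. by apply: (addrI (D 0)); rewrite -DD !addr0. Qed.

Let D1 : D 1 = 0.
Proof. by apply: (addrI (D 1)); rewrite addr0 -{3}[1]mulr1 DM mulr1 mul1r. Qed.

Let DN x : D (- x) = - D x.
Proof. by apply: (addrI (D x)); rewrite -DD !subrr D0. Qed.

Lemma deriv_prod (I : finType) (g : I -> R) :
  D (\prod_i g i) = \sum_i D (g i) * \prod_(j | j != i) g j.
Proof.
elim: (index_enum I) (index_enum_uniq I) => [|x s IH].
  by rewrite !big_nil D1.
rewrite cons_uniq => /andP[xs us]; rewrite !big_cons DM IH // eqxx /=; congr (_ * _ + _).
  rewrite big_seq_cond [RHS]big_seq_cond; apply: eq_bigl => j; rewrite andbT.
  by case: (boolP (j \in s)) => //= js; apply/esym; apply: contraNneq xs => <-.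
rewrite mulr_sumr big_seq [RHS]big_seq; apply: eq_bigr => i i_s.
rewrite big_cons (_ : x != i) 1?mulrCA //.
by apply: contraNneq xs => ->.
Qed.

Lemma deriv_det n (X : 'M[R]_n) :
  D (\det X) = \sum_i \sum_j D (X i j) * (\adj X) j i.
Proof.
have Dsum (I : finType) (G : I -> R) : D (\sum_i G i) = \sum_i D (G i).
  exact: (big_morph D DD D0).
have Dsign (s : 'S_n) x : D ((-1) ^+ s * x) = (-1) ^+ s * D x.
  by case: (s : bool); rewrite ?expr0 ?mul1r // expr1 !mulN1r DN.
rewrite Dsum; under eq_bigr => s _ do rewrite Dsign deriv_prod mulr_sumr.
rewrite exchange_big; apply: eq_bigr => i _ /=.
pose Y := \matrix_(a, b) (if a == i then D (X a b) else X a b).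
transitivity (\det Y).
  apply: eq_bigr => s _; congr (_ * _); rewrite [RHS](bigD1 i) //= !mxE eqxx; congr (_ * _).
  by apply: eq_bigr => j ji; rewrite !mxE (negPf ji).
rewrite (expand_det_row _ i); apply: eq_bigr => j _; rewrite !mxE eqxx; congr (_ * _).
rewrite /cofactor; congr (_ * \det _); apply/matrixP => a b.
by rewrite !mxE eq_sym (negPf (neq_lift _ _)).
Qed.

Lemma mul_adj_entry n (X : 'M[R]_n) i j :
  \sum_b X i b * (\adj X) b j = \det X *+ (i == j).
Proof. by have /matrixP/(_ i j) := mul_mx_adj X; rewrite mxE [RHS]mxE. Qed.

Lemma adj_mul_entry n (X : 'M[R]_n) i j :
  \sum_b (\adj X) i b * X b j = \det X *+ (i == j).
Proof. by have /matrixP/(_ i j) := mul_adj_mx X; rewrite mxE [RHS]mxE. Qed.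

(* For a singular A one has adj_ll A = det (A + E_ll), to which Jacobi's formula applies. *)
Lemma deriv_adj_diag n (A : 'M[R]_n) (M : 'I_n -> 'I_n -> R) l :
  (forall a b, D (A a b) = \sum_k (M a k * A k b + M b k * A a k)) ->
  \det A = 0 -> (\adj A)^T = \adj A ->
  D ((\adj A) l l) = ((\sum_a M a a) * (\adj A) l l - \sum_a M a l * (\adj A) a l) *+ 2.
Proof.
move=> DA det0 adjS; pose X := A + delta_mx l l.
have adjXl j : (\adj X) j l = (\adj A) j l.
  rewrite [LHS]mxE [RHS]mxE /cofactor; congr (_ * \det _).
  by apply/matrixP => a b; rewrite !mxE [lift l a == _]eq_sym (negPf (neq_lift _ _)) addr0.
have adjXr j : (\adj X) l j = (\adj A) l j.
  rewrite [LHS]mxE [RHS]mxE /cofactor; congr (_ * \det _).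
  by apply/matrixP => a b; rewrite !mxE [lift l b == _]eq_sym (negPf (neq_lift _ _)) andbF addr0.
have delta_sum (f : 'I_n -> R) k : \sum_b (delta_mx l l : 'M[R]_n) k b * f b = (k == l)%:R * f l.
  rewrite (bigD1 l) //= mxE eqxx andbT big1 ?addr0 // => b bl.
  by rewrite mxE (negPf bl) andbF mul0r.
have delta_sum' (f : 'I_n -> R) k : \sum_b f b * (delta_mx l l : 'M[R]_n) b k = (k == l)%:R * f l.
  rewrite (bigD1 l) //= mxE eqxx /= mulrC big1 ?addr0 // => b bl.
  by rewrite mxE (negPf bl) mulr0.
have XE a b : X a b = A a b + (delta_mx l l : 'M[R]_n) a b by rewrite mxE.
have detX : \det X = (\adj A) l l.
  have := mul_adj_entry X l l; rewrite eqxx mulr1n => <-.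
  under eq_bigr => b _ do rewrite XE mulrDl adjXl.
  by rewrite big_split /= delta_sum eqxx mul1r mul_adj_entry det0 mul0rn add0r.
have mulL k a : \sum_b A k b * (\adj X) b a = \det X *+ (k == a) - (k == l)%:R * (\adj X) l a.
  apply/eqP; rewrite eq_sym subr_eq -mul_adj_entry -(delta_sum (fun b => (\adj X) b a)) -big_split; apply/eqP.
  by apply: eq_bigr => b _; rewrite XE mulrDl.
have mulR b k : \sum_a (\adj X) b a * A a k = \det X *+ (b == k) - (k == l)%:R * (\adj X) b l.
  apply/eqP; rewrite eq_sym subr_eq -adj_mul_entry -(delta_sum' (fun a => (\adj X) b a)) -big_split; apply/eqP.
  by apply: eq_bigr => a _; rewrite XE mulrDr.
have DX a b : D (X a b) = \sum_k (M a k * A k b + M b k * A a k).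
  rewrite XE DD DA mxE; case: (_ && _); by rewrite ?D0 ?D1 addr0.
have pick (G : 'I_n -> 'I_n -> R) (f : 'I_n -> R) : (forall a k, G a k = \det X *+ (k == a) - (k == l)%:R * f a) ->
    \sum_a \sum_k M a k * G a k = (\sum_a M a a) * \det X - \sum_a M a l * f a.
  move=> GE; rewrite mulr_suml -sumrB; apply: eq_bigr => a _.
  under eq_bigr => k _ do rewrite GE mulrBr.
  rewrite sumrB; congr (_ - _).
    by rewrite (bigD1 a) //= eqxx mulr1n big1 ?addr0 // => k ka; rewrite (negPf ka) mulr0n mulr0.
  by rewrite (bigD1 l) //= eqxx mul1r big1 ?addr0 // => k kl; rewrite (negPf kl) mul0r mulr0.
have symE a : (\adj A) l a = (\adj A) a l by rewrite -{1}adjS mxE.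
rewrite -detX deriv_det; under eq_bigr => a _ do under eq_bigr => b _ do rewrite DX big_split mulrDl /=.
under eq_bigr => a _ do rewrite big_split /=.
(* The derivative is [M A + A M^T]; its two halves contribute equally because the adjugate of [A] is
   symmetric. *)
rewrite big_split /= mulr2n; congr (_ + _).
- transitivity (\sum_a \sum_k M a k * (\sum_b A k b * (\adj X) b a)).
    apply: eq_bigr => a _; under eq_bigr => b _ do rewrite mulr_suml.
    rewrite exchange_big; apply: eq_bigr => k _ /=; rewrite mulr_sumr.
    by apply: eq_bigr => b _; rewrite mulrA.
  rewrite (pick _ (fun a => (\adj A) a l)) // => a k.
  by rewrite mulL adjXr symE.
transitivity (\sum_b \sum_k M b k * (\sum_a (\adj X) b a * A a k)).
  rewrite exchange_big; apply: eq_bigr => b _; under eq_bigr => a _ do rewrite mulr_suml.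
  rewrite exchange_big; apply: eq_bigr => k _ /=; rewrite mulr_sumr.
  by apply: eq_bigr => a _; rewrite -mulrA; congr (_ * _); rewrite mulrC.
rewrite (pick _ (fun a => (\adj A) a l)) // => b k.
by rewrite mulR adjXl eq_sym.
Qed.

End DetDerivation.

Section Poisson.
Variables (F : numClosedFieldType) (n : nat) (c : 'I_n -> 'I_n -> 'I_n -> F).
Hypothesis lie : is_lie c.
Local Notation A := (poissonMx c).
Local Notation S := {mpoly F[n]}.

(** The Hamiltonian field of a coordinate, sending f to {x_i, f}. The bracket with any polynomial is
    a combination of these, so invariance is tested on them alone. *)
Definition ham i (f : S) : S := \sum_j mderiv j f * A i j.

Lemma pbracket_ham g f : pbracket c g f = \sum_i mderiv i g * ham i f.
Proof.
apply: eq_bigr => i _; rewrite mulr_sumr.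
by apply: eq_bigr => j _; rewrite mulrA.
Qed.

Lemma hamD i : {morph ham i : f g / f + g}.
Proof. by move=> f g; rewrite -big_split; apply: eq_bigr => j _; rewrite mderivD mulrDl. Qed.

Lemma ham0 i : ham i 0 = 0.
Proof. by rewrite /ham big1 // => j _; rewrite mderiv0 mul0r. Qed.

Lemma hamZ i a f : ham i (a *: f) = a *: ham i f.
Proof. by rewrite scaler_sumr; apply: eq_bigr => j _; rewrite mderivZ scalerAl. Qed.

Lemma hamM i f g : ham i (f * g) = ham i f * g + f * ham i g.
Proof.
rewrite mulr_suml mulr_sumr -big_split; apply: eq_bigr => j _.
by rewrite mderivM mulrDl /=; congr (_ + _); [exact: mulrAC | rewrite mulrA].
Qed.

Lemma ham_sum i (I : Type) (r : seq I) (P : pred I) (G : I -> S) :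
  ham i (\sum_(j <- r | P j) G j) = \sum_(j <- r | P j) ham i (G j).
Proof. exact: (big_morph (ham i) (@hamD i) (@ham0 i)). Qed.

Lemma mderiv_X (i j : 'I_n) : mderiv i ('X_j : S) = (i == j)%:R.
Proof.
rewrite mderivX mnm1E eq_sym; case: eqP => [->|_]; last by rewrite scale0r.

rewrite scale1r (_ : (U_(j) - U_(j))%MM = 0%MM) ?mpolyX0 //.
by apply/mnmP => k; rewrite mnmBE subnn mnm0E.
Qed.

Lemma hamX i j : ham i 'X_j = A i j.
Proof.
rewrite /ham (bigD1 j) //= mderiv_X eqxx mul1r big1 ?addr0 // => k kj.
by rewrite mderiv_X (negPf kj) mul0r.
Qed.

Lemma poissonE i j : A i j = \sum_k c i j k *: 'X_k.
Proof. by rewrite mxE. Qed.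

Lemma ham_poisson0 i j l : ham i (A j l) = \sum_k c j l k *: A i k.
Proof. by rewrite poissonE ham_sum; apply: eq_bigr => k _; rewrite hamZ hamX. Qed.

Lemma lie_skew i j k : c i j k = - c j i k.
Proof. by case: lie. Qed.

Lemma poisson_skew : A^T = - A.
Proof.
apply/matrixP => i j; rewrite !mxE -sumrN; apply: eq_bigr => k _.
by rewrite lie_skew scaleNr.
Qed.

(* This is the Jacobi identity. *)
Lemma ham_poisson i j l :
  ham i (A j l) = \sum_k (c i j k *: A k l + c i l k *: A j k).
Proof.
rewrite ham_poisson0; under eq_bigr => k _ do rewrite poissonE scaler_sumr.
under [RHS]eq_bigr => k _ do rewrite !poissonE !scaler_sumr -big_split /=.
rewrite exchange_big [RHS]exchange_big; apply: eq_bigr => m _ /=.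
under eq_bigr => k _ do rewrite scalerA.
under [RHS]eq_bigr => k _ do rewrite !scalerA -scalerDl.
rewrite -!scaler_suml; congr (_ *: _); apply/eqP; rewrite eq_sym -subr_eq0 -sumrB.
have [_ /(_ i j l m) jac] := lie.
rewrite -[X in _ == X]jac; apply/eqP; apply: eq_bigr => k _.
by rewrite (lie_skew l i) (lie_skew k j m) (lie_skew k i m); ring.
Qed.

Lemma poisson_homog i j : A i j \is 1.-homog.
Proof.
rewrite poissonE; apply: rpred_sum => k _; apply: rpredZ.
by rewrite dhomogX /= mdeg1.
Qed.

Lemma ham_homog i f d : f \is d.-homog -> ham i f \is d.-homog.
Proof.
case: d => [|d] fh; apply: rpred_sum => j _; first by rewrite mderiv_homog0 // mul0r rpred0.
rewrite -addn1; apply: dhomogM; last exact: poisson_homog.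
exact: mderiv_homog fh.
Qed.

Lemma invariant_ham f : is_invariant c f <-> forall i, ham i f = 0.
Proof.
split=> [fi i|fi g]; last by rewrite pbracket_ham big1 // => i _; rewrite fi mulr0.
have := fi 'X_i; rewrite pbracket_ham (bigD1 i) //= mderiv_X eqxx mul1r big1 ?addr0 // => k ki.
by rewrite mderiv_X (negPf ki) mul0r.
Qed.

Lemma semi_inv_ham f chi : f != 0 -> (forall i, ham i f = chi i *: f) -> semi_inv c f chi.
Proof.
move=> f0 fchi; split=> // g; rewrite pbracket_ham mulr_suml; apply: eq_bigr => i _.
by rewrite fchi -scalerAl -scalerAr.
Qed.

End Poisson.

(** * Invariants in index one *)

Lemma homog_div (F : fieldType) n (p q : {mpoly F[n]}) d e : q != 0 -> p != 0 ->
  q \is e.-homog -> p * q \is d.-homog -> p \is (d - e).-homog /\ (e <= d)%N.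
Proof.
move=> q0 p0 qh pqh; have pq0 : p * q != 0 by rewrite mulf_neq0.
have [e' ph _] := homog_factor q0 pq0 pqh.
have <- := dhomog_uniq pq0 (dhomogM ph qh) pqh.
by rewrite addnK leq_addl.
Qed.

(** Where [Q l0] does not vanish the adjugate is nonzero, so the kernel is a line containing the
    values of [u] and [Q]. The factor [Q l0] extends the identity to all points. *)
Lemma skew_kernel_line (F : numClosedFieldType) N m (A : 'M[{mpoly F[N]}]_(m.*2.+1)) l0
    (Q u : 'I_(m.*2.+1) -> {mpoly F[N]}) (g : F) :
  A^T = - A -> g != 0 -> Q l0 != 0 -> (forall i, (\adj A) i l0 = g *: (Q i * Q l0)) ->
  (forall i, \sum_j A i j * Q j = 0) -> (forall i, \sum_j A i j * u j = 0) ->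
  forall i j, u i * Q j = u j * Q i.
Proof.
move=> skA g0 Q0 adjQ kQ ku i j; apply: (mulIf Q0).
apply: mpoly_eqP_eval => v; rewrite !rmorphM /=.
have [->|Qv] := eqVneq (Q l0).@[v] 0; first by rewrite !mulr0.
congr (_ * _); pose M := map_mx (meval v) A.
have skM : M^T = - M.
  apply/matrixP => a b; rewrite !mxE.
  have /= := congr1 (fun B : 'M_ _ => B a b) skA; rewrite !mxE => ->.
  by rewrite rmorphN.
have adjM : \adj M != 0.
  apply: contraNneq Qv => /(congr1 (fun B : 'M_ _ => B l0 l0)).
  have -> : (\adj M) l0 l0 = ((\adj A) l0 l0).@[v] by rewrite -map_mx_adj mxE.
  rewrite adjQ mevalZ rmorphM [RHS]mxE /= => /eqP.
  by rewrite !mulf_eq0 (negPf g0) orbb.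
have kerM (z : 'I_(m.*2.+1) -> {mpoly F[N]}) : (forall i, \sum_j A i j * z j = 0) ->
    (\row_k (z k).@[v] <= kermx M)%MS.
  move=> kz; apply/sub_kermxP/rowP => k; rewrite !mxE.
  have key : \sum_l (A k l * z l).@[v] = 0 by rewrite -rmorph_sum kz rmorph0.
  apply/eqP; rewrite -oppr_eq0 -sumrN; apply/eqP; rewrite -[RHS]key.
  apply: eq_bigr => l _; have MA : M l k = - (A k l).@[v].
    by rewrite -[M]opprK -skM !mxE.
  by rewrite mxE MA mulrN opprK rmorphM mulrC.
have rk : (\rank (kermx M) <= 1)%N by rewrite mxrank_ker leq_subLR addn1 ltnS; apply: adj_neq0_rank.
have := kerM _ kQ; have := kerM _ ku.
rewrite -(eq_row_base (kermx M)) => ku'; rewrite -(eq_row_base (kermx M)); move: ku'.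
move: (row_base _) => B /submxP [x xE] /submxP [y yE].
have uE k : (u k).@[v] = (x *m B) 0 k by rewrite -xE mxE.
have QE k : (Q k).@[v] = (y *m B) 0 k by rewrite -yE mxE.
rewrite !uE !QE; case: (\rank _) rk x y B {xE yE uE QE} => [|[|//]] _ x y B.
  by rewrite !mxE !big_ord0 !mul0r.
by rewrite !mxE !big_ord1; ring.
Qed.

Section Invariants.
Variables (F : numClosedFieldType) (n : nat) (c : 'I_n -> 'I_n -> 'I_n -> F).
Hypothesis lie : is_lie c.
Local Notation A := (poissonMx c).
Local Notation S := {mpoly F[n]}.
Variables (w : 'I_n -> S) (e : nat) (l0 : 'I_n).
Hypothesis wker : forall i, \sum_j A i j * w j = 0.
Hypothesis wprim : forall p, prime_elt p -> exists i, ~ rdvd p (w i).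
Hypothesis whom : forall i, w i \is e.-homog.
Hypothesis wl0 : w l0 != 0.
Hypothesis wline : forall u : 'I_n -> S, (forall i, \sum_j A i j * u j = 0) ->
  forall i j, u i * w j = u j * w i.

Lemma kernel_multiple (u : 'I_n -> S) : (forall i, \sum_j A i j * u j = 0) ->
  exists q, forall i, u i = q * w i.
Proof.
move=> uker; apply: (proportional_family (@factorial_mpoly F n) wprim wl0).
by move=> i; apply: wline.
Qed.

(** Differentiating [A w = 0] along x_i and using the Jacobi identity shows that the derivative of
    [w], corrected by the coadjoint action, is again in the kernel. It is a multiple of [w] of the
    same degree, so the factor is constant. *)
Lemma ham_kernel : exists chi : 'I_n -> F,
  forall i j, ham c i (w j) = chi i *: w j - \sum_k c i k j *: w k.
Proof.
suff H i : exists a, forall j, ham c i (w j) + \sum_k c i k j *: w k = a *: w j.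
  have [a aP] := fin_all_exists H.
  by exists a => i j; rewrite -aP addrK.
pose u j := ham c i (w j) + \sum_k c i k j *: w k.
have [|q uq] := kernel_multiple (u := u).
  move=> l; rewrite /u; under eq_bigr => j _ do rewrite mulrDr.
  rewrite big_split /=.
  have E : \sum_j ham c i (A l j) * w j + \sum_j A l j * ham c i (w j) = 0.
    rewrite -big_split -[RHS](ham0 c i) -[in RHS](wker l) ham_sum.
    by apply: eq_bigr => j _; rewrite hamM.
  rewrite [X in X + _ = _](_ : _ = - \sum_j ham c i (A l j) * w j); last first.
    by apply/eqP; rewrite -addr_eq0 addrC E.
  rewrite addrC.
  apply/eqP; rewrite subr_eq0; apply/eqP.
  transitivity (\sum_j \sum_k c i j k *: A l k * w j).
    rewrite exchange_big /=; apply: eq_bigr => j _; rewrite mulr_sumr.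
    by apply: eq_bigr => k _; rewrite -scalerAr -scalerAl.
  apply/esym; under eq_bigr => j _ do rewrite ham_poisson // big_split mulrDl /=.
  rewrite big_split /= [X in X + _](_ : _ = 0) ?add0r; last first.
    under eq_bigr => j _ do rewrite mulr_suml.
    rewrite exchange_big big1 // => k _.
    by under eq_bigr => j _ do rewrite -scalerAl; rewrite -scaler_sumr wker scaler0.
  by apply: eq_bigr => j _; rewrite mulr_suml.
have hu j : q * w j \is e.-homog.
  rewrite -uq rpredD //; first exact: ham_homog.
  by apply: rpred_sum => k _; apply: rpredZ.
have [q0|q0] := eqVneq q 0; first by exists 0 => j; rewrite -[LHS]/(u j) uq q0 mul0r scale0r.
have [] := homog_div wl0 q0 (whom l0) (hu l0).
rewrite subnn => /homog0_const [a qa] _; exists a => j.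
by rewrite -[LHS]/(u j) uq qa mul_mpolyC.
Qed.

Definition radial : S := \sum_j 'X_j * w j.

Lemma radial_homog : radial \is e.+1.-homog.
Proof.
apply: rpred_sum => j _; rewrite -add1n; apply: dhomogM => //.
by rewrite dhomogX /= mdeg1.
Qed.

(** The derivative of the coordinates and the coadjoint term of [w] both give an entry of [A w],
    which is zero. *)
Lemma ham_radial chi : (forall i j, ham c i (w j) = chi i *: w j - \sum_k c i k j *: w k) ->
  forall i, ham c i radial = chi i *: radial.
Proof.
move=> wchi i; rewrite ham_sum; under eq_bigr => j _ do rewrite hamM hamX wchi mulrBr.
rewrite big_split /= wker add0r big_split /= sumrN scaler_sumr.
under eq_bigr => j _ do rewrite -scalerAr.
rewrite -[RHS]subr0; congr (_ - _); rewrite -[RHS](wker i).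
under eq_bigr => j _ do rewrite mulr_sumr.
rewrite exchange_big /=; apply: eq_bigr => k _; rewrite poissonE mulr_suml.
by apply: eq_bigr => j _; rewrite -scalerAr -scalerAl.
Qed.

Section Fundamental.
Variables (p : S) (g : F).
Hypothesis g0 : g != 0.
Hypothesis adjE : forall i, (\adj A) i l0 = g *: ((p * w i) * (p * w l0)).
Hypothesis adjS : (\adj A)^T = \adj A.
Hypothesis det0 : \det A = 0.
Hypothesis p0 : p != 0.

Lemma ham_adj i : ham c i ((\adj A) l0 l0) =
  ((\sum_a c i a a) *: (\adj A) l0 l0 - \sum_a c i a l0 *: (\adj A) a l0) *+ 2.
Proof.
rewrite (@deriv_adj_diag _ _ (@hamD _ _ c i) (@hamM _ _ c i) _ A (fun a b => (c i a b)%:MP)) //.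
  rewrite -mul_mpolyC rmorph_sum; congr ((_ - _) *+ 2).
  by apply: eq_bigr => a _; rewrite mul_mpolyC.
by move=> a b; rewrite ham_poisson //; apply: eq_bigr => k _; rewrite !mul_mpolyC.
Qed.

(** Differentiate [g *: (p * w l0) ^+ 2] by the product rule and by [ham_adj]. The coadjoint terms
    cancel, leaving the trace of ad x_i minus the weight of [w]. *)
Lemma ham_gcd chi : (forall i j, ham c i (w j) = chi i *: w j - \sum_k c i k j *: w k) ->
  forall i, ham c i p = (\sum_a c i a a - chi i) *: p.
Proof.
move=> wchi i; pose s := \sum_k c i k l0 *: w k; pose t := \sum_a c i a a.
have E1 : ham c i ((\adj A) l0 l0) =
    g%:MP * (((ham c i p * w l0 + p * ((chi i)%:MP * w l0 - s)) * (p * w l0)) *+ 2).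
  by rewrite adjE hamZ !hamM wchi -!mul_mpolyC /s; ring.
have E2 : \sum_a c i a l0 *: (\adj A) a l0 = g%:MP * (p * s * (p * w l0)).
  rewrite /s mulr_sumr mulr_suml mulr_sumr; apply: eq_bigr => a _.
  by rewrite adjE -!mul_mpolyC; ring.
have := ham_adj i; rewrite E1 E2 adjE -/t -!mul_mpolyC => E.
have {}E : (g%:MP * p * w l0 ^+ 2) *+ 2 * (ham c i p) = (g%:MP * p * w l0 ^+ 2) *+ 2 * ((t - chi i)%:MP * p).
  by apply/eqP; rewrite -subr_eq0; move/eqP: E; rewrite -subr_eq0 rmorphB /=; congr (_ == _); ring.
apply: (mulfI _ E).
by rewrite -scaler_nat scaler_eq0 pnatr_eq0 /= !mulf_neq0 ?expf_neq0 // mpolyC_eq0.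
Qed.

End Fundamental.

Hypothesis nss : no_proper_semi_inv c.

Lemma semi_inv_trivial f chi : f != 0 -> (forall i, ham c i f = chi i *: f) ->
  forall i, ham c i f = 0.
Proof.
by move=> f0 fchi i; rewrite fchi (nss (semi_inv_ham f0 fchi)) scale0r.
Qed.

Lemma invariant_gradient f : (forall i, ham c i f = 0) -> exists q, forall j, mderiv j f = q * w j.
Proof.
move=> hf; apply: kernel_multiple => i; rewrite -[RHS](hf i).
by apply: eq_bigr => j _; rewrite mulrC.
Qed.

Lemma invariant_euler f d : (forall i, ham c i f = 0) -> f \is d.-homog ->
  exists2 q, (forall j, mderiv j f = q * w j) & f *+ d = q * radial.
Proof.
move=> hf fh; have [q qE] := invariant_gradient hf; exists q => //.
rewrite -(euler fh) mulr_sumr; apply: eq_bigr => j _.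
by rewrite qE mulrCA.
Qed.

Section Generator.
Hypothesis rad0 : radial != 0.
Hypothesis ham_rad : forall i, ham c i radial = 0.

Lemma radial_gradient j : mderiv j radial = e.+1%:R *: w j.
Proof.
have [q qE /esym E] := invariant_euler ham_rad radial_homog.
rewrite qE -mul_mpolyC; congr (_ * _).
rewrite (_ : q = e.+1%:R) ?mpolyC_nat //.
by apply: (mulIf rad0); rewrite E mulr_natl.
Qed.

(** By Euler's identity [h] is, up to a scalar, [q * radial] with [q] the gradient factor; [q] is
    again an invariant, of smaller degree. *)
Lemma homog_invariant h d : (forall i, ham c i h = 0) -> h \is d.-homog -> h != 0 ->
  exists a j, h = a *: radial ^+ j /\ d = (j * e.+1)%N.
Proof.
elim/ltn_ind: d h => -[|d] IH h hh hd h0.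
  have [a ->] := homog0_const hd; exists a, 0%N.
  by rewrite expr0 alg_mpolyC.
have [q qE E] := invariant_euler hh hd.
have q0 : q != 0.
  by apply: contraNneq h0 => q0; move/eqP: E; rewrite q0 mul0r -scaler_nat scaler_eq0 pnatr_eq0.
have qwh : q * w l0 \is d.-homog by rewrite -qE; exact: mderiv_homog hd.
have [qh ed] := homog_div wl0 q0 (whom l0) qwh.
have hq i : ham c i q = 0.
  have := congr1 (ham c i) E; rewrite hamM ham_rad mulr0 addr0 -scaler_nat hamZ hh scaler0.
  by move/esym/eqP; rewrite mulf_eq0 (negPf rad0) orbF => /eqP.
have [|a [j [qj dj]]] := IH (d - e)%N _ q hq qh q0; first by rewrite ltnS leq_subr.
exists (d.+1%:R^-1 * a), j.+1; split; last by rewrite mulSn -dj addSn subnKC.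
rewrite -scalerA exprS [radial * _]mulrC scalerAl -qj -E -scaler_nat scalerA.
by rewrite mulVf ?scale1r // pnatr_eq0.
Qed.

Lemma peval_horner (q : {poly F}) f : peval q f = (map_poly (@mpolyC n F) q).[f].
Proof.
rewrite horner_coef size_map_inj_poly ?rmorph0 //; last exact: (can_inj (@mpolyCK n F)).
by apply: eq_bigr => i _; rewrite coef_map mul_mpolyC.
Qed.

Lemma hamXn i f k : ham c i f = 0 -> ham c i (f ^+ k) = 0.
Proof.
move=> hf; elim: k => [|k IH]; last by rewrite exprS hamM hf IH mul0r mulr0 addr0.
by rewrite expr0 /ham big1 // => j _; rewrite -[1]/(1%:MP) mderivC mul0r.
Qed.

Lemma ham_pihomog i d h : ham c i (pihomog mdeg d h) = pihomog mdeg d (ham c i h).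
Proof.
have pd k : pihomog mdeg d (ham c i (pihomog mdeg k h)) =
    if k == d then ham c i (pihomog mdeg k h) else 0.
  have hk : ham c i (pihomog mdeg k h) \is k.-homog by apply/ham_homog/pihomogP.
  case: eqP => [<-|/eqP kd]; first by rewrite pihomog_dE.
  by rewrite (pihomog_ne0 kd hk).
pose K := maxn (msize h) d.+1.
have hK : (msize h <= K)%N by rewrite leq_maxl.
have dK : (d < K)%N by rewrite leq_maxr.
have -> : ham c i h = \sum_(k < K) ham c i (pihomog mdeg k h).
  by rewrite -ham_sum -(pihomog_partitionE hK).
rewrite linear_sum (bigD1 (Ordinal dK)) //= pd eqxx.
by rewrite big1 ?addr0 // => k kd; rewrite pd ifN //; apply: contraNneq kd => kd; exact/eqP/val_inj.
Qed.

(** The bracket with a coordinate preserves degrees, so the homogeneous components of an invariant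
    are invariants. *)
Lemma invariant_peval h : is_invariant c h <-> exists q, h = peval q radial.
Proof.
rewrite invariant_ham; split=> [hh|[q ->] i]; last first.
  by rewrite ham_sum big1 // => k _; rewrite hamZ hamXn ?scaler0.
rewrite (pihomog_partitionE (leqnn (msize h))).
elim/big_ind: _ => [|f1 f2 [q1 ->] [q2 ->]|k _].
- by exists 0; rewrite /peval size_poly0 big_ord0.
- by exists (q1 + q2); rewrite !peval_horner rmorphD hornerD.
have [->|h0] := eqVneq (pihomog mdeg k h) 0.
  by exists 0; rewrite /peval size_poly0 big_ord0.
have hk i : ham c i (pihomog mdeg k h) = 0 by rewrite ham_pihomog hh pihomog0.
have [a [j [-> _]]] := homog_invariant hk (pihomogP _ _ _) h0.
by exists (a *: 'X^j); rewrite peval_horner map_polyZ map_polyXn /= hornerZ hornerXn mul_mpolyC.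
Qed.

Lemma peval_inj q : peval q radial = 0 -> q = 0.
Proof.
move=> q0; apply/polyP => i; rewrite coef0; have [|le] := ltnP i (size q); last by rewrite nth_default.
move=> lt; have := congr1 (pihomog mdeg (e.+1 * i)) q0.
rewrite pihomog0 linear_sum (bigD1 (Ordinal lt)) //= big1 ?addr0 => [|j ji].
  rewrite linearZ /= pihomog_dE; last exact: dhomogMn radial_homog.
  by move/eqP; rewrite scaler_eq0 expf_eq0 (negPf rad0) andbF orbF => /eqP.
rewrite linearZ /= (pihomog_ne0 (d := (e.+1 * j)%N)) ?scaler0 //; last exact: dhomogMn radial_homog.
by rewrite eqn_mul2l.
Qed.

End Generator.
End Invariants.

(** * Primality of the generator *)

Lemma msize_homog (F : fieldType) n (p : {mpoly F[n]}) d : p \is d.-homog -> (msize p <= d.+1)%N.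
Proof.
move=> ph; rewrite msizeE; apply/bigmax_leqP_seq => m mp _.
by rewrite (dhomog_mf ph mp).
Qed.

(** Euler's operator on an arbitrary polynomial, for prime factors whose homogeneity has not been
    established. *)
Lemma mcoeff_euler (F : fieldType) n (p : {mpoly F[n]}) m :
  (\sum_i 'X_i * mderiv i p)@_m = p@_m *+ mdeg m.
Proof.
have -> : \sum_i 'X_i * mderiv i p = \sum_(m <- msupp p) p@_m *: ('X_[F, m] *+ mdeg m).
  under eq_bigr => i _ do rewrite [X in mderiv i X](mpolyE p) linear_sum mulr_sumr.
  rewrite exchange_big /=; apply: eq_bigr => m' _; rewrite -eulerX scaler_sumr.
  by apply: eq_bigr => i _; rewrite linearZ /= -scalerAr.
rewrite raddf_sum /=; under eq_bigr => m' _ do rewrite mcoeffZ mcoeffMn mcoeffX.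
have [mp|mp] := boolP (m \in msupp p); last first.
  rewrite (memN_msupp_eq0 mp) mul0rn big_seq big1 // => m' m'p.
  by rewrite (_ : m' == m = false) ?mul0rn ?mulr0 //; apply: contraNF mp => /eqP <-.
rewrite (bigD1_seq m) ?msupp_uniq //= eqxx big1 ?addr0 => [|m' /negPf ->]; last by rewrite mul0rn mulr0.
by rewrite mulr_natr.
Qed.

Lemma prime_power_part (F : fieldType) n (p f : {mpoly F[n]}) : prime_elt p -> f != 0 ->
  exists a h, f = p ^+ a * h /\ ~ rdvd p h.
Proof.
move=> pP; have [k] := ubnP (msize f); elim: k f => // k IH f; rewrite ltnS => fk f0.
have [[q fE]|nd] := classic (rdvd p f); last by exists 0%N, f; rewrite expr0 mul1r.
have q0 : q != 0 by apply: contraNneq f0 => q0; rewrite fE q0 mul0r.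
have p0 : p != 0 by case: pP.
have sp : msize p != 1%N by rewrite -mpoly_unitE; case: pP.
have [|a [h [qE nh]]] := IH q _ q0.
  apply: leq_trans fk; rewrite fE msizeM //.
  have : (0 < msize p)%N by rewrite lt0n msize_poly_eq0.
  have : (0 < msize q)%N by rewrite lt0n msize_poly_eq0.
  by move: sp; move: (msize p) (msize q) => x y; lia.
by exists a.+1, h; split=> //; rewrite fE qE exprS mulrC mulrA.
Qed.

Section Prime.
Variables (F : numClosedFieldType) (n : nat) (c : 'I_n -> 'I_n -> 'I_n -> F).
Hypothesis lie : is_lie c.
Local Notation S := {mpoly F[n]}.

Lemma msize_ham i (f : S) : (msize (ham c i f) <= msize f)%N.
Proof.
rewrite {1}(pihomog_partitionE (leqnn (msize f))) ham_sum.
apply: leq_trans (msize_sum _ _ _) _; apply/bigmax_leqP => k _.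
by apply: leq_trans (msize_homog _) (ltn_ord k); apply/ham_homog/pihomogP.
Qed.

Lemma msize_divisor (p q : S) : p * q != 0 -> (msize q <= msize (p * q))%N.
Proof.
rewrite mulf_eq0 negb_or => /andP[p0 q0]; rewrite msizeM //.
have : (0 < msize p)%N by rewrite lt0n msize_poly_eq0.
by move: (msize p) (msize q) => x y; lia.
Qed.

(** Write [f = p ^+ a * h] with [h] not divisible by [p]. That {x_i, f} vanishes forces [p] to
    divide {x_i, p} [h], since the exponent is invertible, hence {x_i, p}. The quotient is constant
    because the bracket does not raise degrees. *)
Lemma ham_prime_factor (p f : S) : prime_elt p -> f != 0 -> (forall i, ham c i f = 0) ->
  rdvd p f -> exists chi : 'I_n -> F, forall i, ham c i p = chi i *: p.
Proof.
move=> pP f0 hf pf; have p0 : p != 0 by case: pP.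
have [a [h [fE nh]]] := prime_power_part pP f0.
have a0 : (0 < a)%N.
  by rewrite lt0n; apply/eqP => a0; apply: nh; move: pf; rewrite fE a0 expr0 mul1r.
suff H i : exists a, ham c i p = a *: p by exact: fin_all_exists H.
have hX k : ham c i (p ^+ k.+1) = k.+1%:R * p ^+ k * ham c i p.
  elim: k => [|k IH]; first by rewrite expr1 expr0 mulr1 mul1r.
  by rewrite exprS hamM IH [p ^+ k.+1]exprS -[k.+2%:R]natr1; ring.
have : rdvd p (ham c i p).
  case: a a0 fE => // a _ fE.
  have := hf i; rewrite fE hamM hX exprSr => E.
  have {}E : p ^+ a * (a.+1%:R * (ham c i p * h) + p * ham c i h) = 0 by rewrite -[RHS]E; ring.
  move/eqP: E; rewrite mulf_eq0 expf_eq0 (negPf p0) andbF /= addr_eq0 => /eqP E.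
  have : rdvd p (ham c i p * h).
    exists (- (a.+1%:R^-1)%:MP * ham c i h).
    apply: (mulfI (_ : (a.+1%:R : S) != 0)).
      by rewrite -mpolyC_nat mpolyC_eq0 pnatr_eq0.
    rewrite E !mulNr mulrN; congr (- _); rewrite -mulrA mulrA -mpolyC_nat -mpolyCM.
    by rewrite mulfV ?pnatr_eq0 // mul1r mulrC.
  by case: pP => _ _ pP /pP [//|/nh].
case=> r rE; have [r0|r0] := eqVneq r 0; first by exists 0; rewrite rE r0 mul0r scale0r.
have : (msize r <= 1)%N.
  have := msize_ham i p; rewrite rE msizeM //.
  have : (0 < msize p)%N by rewrite lt0n msize_poly_eq0.
  by move: (msize r) (msize p) => x y; lia.
by move/msize1_polyC => rC; exists r@_0; rewrite rE {1}rC mul_mpolyC.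
Qed.

Variables (w : 'I_n -> S) (e : nat) (l0 : 'I_n).
Hypothesis wker : forall i, \sum_j poissonMx c i j * w j = 0.
Hypothesis wprim : forall p, prime_elt p -> exists i, ~ rdvd p (w i).
Hypothesis whom : forall i, w i \is e.-homog.
Hypothesis wl0 : w l0 != 0.
Hypothesis wline : forall u : 'I_n -> S, (forall i, \sum_j poissonMx c i j * u j = 0) ->
  forall i j, u i * w j = u j * w i.
Hypothesis nss : no_proper_semi_inv c.
Hypothesis rad0 : radial w != 0.
Hypothesis ham_rad : forall i, ham c i (radial w) = 0.

(** A prime factor [p] of f is an invariant, so its gradient is [q * w] with [q] nonzero. Euler's
    operator then sends [p] to [q * f], of degree at most that of [p], which leaves only a unit as
    cofactor. *)
Lemma radial_prime : prime_elt (radial w).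
Proof.
pose f := radial w; have f0 : f != 0 := rad0; have hf : forall i, ham c i f = 0 := ham_rad.
rewrite -/f.
have sf : msize f = e.+2.
  have := homog_mdegree f0 (radial_homog whom); rewrite /mdegree => <-.
  by rewrite prednK // lt0n msize_poly_eq0.
have [u [[|p s] [uu sP fE]]] := @factorial_mpoly F n _ f0.
  by move: uu; rewrite mpoly_unitE -[u]mulr1 -(big_nil 1 *%R xpredT id) -fE sf.
have pP : prime_elt p by apply: sP; rewrite mem_head.
have [p0 pu _] := pP.
have pf : rdvd p f.
  by exists (u * \prod_(q <- s) q); rewrite fE big_cons mulrCA mulrC.
have [chi hp] := ham_prime_factor pP f0 hf pf.
have hp0 := semi_inv_trivial nss p0 hp.
have [q qE] := invariant_gradient wprim wl0 wline hp0.
have E : \sum_j 'X_j * mderiv j p = q * f.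
  by rewrite mulr_sumr; apply: eq_bigr => j _; rewrite qE mulrCA.
have q0 : q != 0.
  apply: contraNneq pu => q0; rewrite mpoly_unitE eqn_leq lt0n msize_poly_eq0 p0 andbT.
  rewrite msizeE; apply/bigmax_leqP_seq => m mp _; rewrite ltnS leqn0.
  apply: contraTT mp => m0; rewrite mcoeff_msupp negbK.
  have := mcoeff_euler p m; rewrite E q0 mul0r mcoeff0 => /esym/eqP.
  by rewrite mulrn_eq0 (negPf m0).
have sE : (msize (q * f) <= msize p)%N.
  rewrite -E msizeE; apply/bigmax_leqP_seq => m; rewrite mcoeff_msupp mcoeff_euler => mp _.
  by apply: msize_mdeg_lt; rewrite mcoeff_msupp; apply: contraNneq mp => ->; rewrite mul0rn.
case: pf => h fh; have h0 : h != 0 by apply: contraNneq f0 => h0; rewrite fh h0 mul0r.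
have hu : h \is a GRing.unit.
  rewrite mpoly_unitE eqn_leq [(0 < _)%N]lt0n msize_poly_eq0 h0 andbT.
  have := leq_trans (msize_divisor (mulf_neq0 q0 f0)) sE; rewrite fh msizeM //.
  have : (0 < msize p)%N by rewrite lt0n msize_poly_eq0.
  by move: (msize h) (msize p) => x y; lia.
by rewrite fh; apply: prime_elt_unitM.
Qed.

End Prime.

(** * Generic lines *)

Section LinePolynomials.
Variables (F : numFieldType) (n : nat).
Local Notation R1 := {mpoly F[n]}.
Local Notation R2 := {mpoly F[n + n]}.
Implicit Types (x a y : 'I_n -> F).

Lemma poly_eq_eval (p q : {poly F}) : (forall l, p.[l] = q.[l]) -> p = q.
Proof.
move=> pq; apply/eqP; rewrite -subr_eq0; apply: contraT => /poly_nonroot [l].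
by rewrite hornerD hornerN pq subrr eqxx.
Qed.

Definition line x a (l : F) : 'I_n -> F := fun i => x i - l * a i.

Lemma join_ptl x a i : join_pt x a (lshift n i) = x i.
Proof. by rewrite /join_pt (unsplitK (inl i)). Qed.

Lemma join_ptr x a i : join_pt x a (rshift n i) = a i.
Proof. by rewrite /join_pt (unsplitK (inr i)). Qed.

Definition ev x a : {poly R2} -> {poly F} := map_poly (meval (join_pt x a)).

Definition bi_subst (S : comNzRingType) (u v : 'I_n -> S) : 'I_(n + n) -> S :=
  fun k => match split k with inl i => u i | inr j => v j end.

Lemma bi_substl (S : comNzRingType) (u v : 'I_n -> S) i : bi_subst u v (lshift n i) = u i.
Proof. by rewrite /bi_subst (unsplitK (inl i)). Qed.

Lemma bi_substr (S : comNzRingType) (u v : 'I_n -> S) i : bi_subst u v (rshift n i) = v i.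
Proof. by rewrite /bi_subst (unsplitK (inr i)). Qed.

Lemma bi_rmorph_eq (S : comNzRingType) (f g : {rmorphism R2 -> S}) :
  (forall c, f c%:MP = g c%:MP) -> (forall i, f 'X_(lshift n i) = g 'X_(lshift n i)) ->
  (forall i, f 'X_(rshift n i) = g 'X_(rshift n i)) -> f =1 g.
Proof.
move=> fgC fgl fgr; apply: mpoly_rmorph_eq => // k.
by rewrite -[k]splitK; case: (split k) => i /=.
Qed.

Definition poly2C : F -> {poly R2} := polyC \o @mpolyC _ F.
HB.instance Definition _ := GRing.RMorphism.on poly2C.

(* f(x - l a) and h(x - l a, a) as polynomials in l. *)
Definition line_poly : R1 -> {poly R2} :=
  mmap poly2C (fun i => ('X_(lshift n i))%:P - 'X * ('X_(rshift n i))%:P).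
HB.instance Definition _ := GRing.RMorphism.on line_poly.

Definition line_poly2 : R2 -> {poly R2} :=
  mmap poly2C (bi_subst (fun i => ('X_(lshift n i))%:P - 'X * ('X_(rshift n i))%:P)
                        (fun i => ('X_(rshift n i))%:P)).
HB.instance Definition _ := GRing.RMorphism.on line_poly2.

Lemma ev_line_poly x a l f : (ev x a (line_poly f)).[l] = f.@[line x a l].
Proof.
move: f; apply: (@mpoly_rmorph_eq _ _ _
  (horner_eval l \o map_poly (meval (join_pt x a)) \o line_poly) (meval (line x a l))) => [c|i] /=.
  by rewrite /line_poly mmapC /= map_polyC /= mevalC horner_evalE hornerC mevalC.
rewrite /line_poly mmapX mmap1U rmorphB rmorphM /= map_polyX !map_polyC /= !mevalXU.
by rewrite join_ptl join_ptr horner_evalE !hornerE.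
Qed.

Lemma ev_line_poly2 x a l h : (ev x a (line_poly2 h)).[l] = h.@[join_pt (line x a l) a].
Proof.
move: h; apply: (@bi_rmorph_eq _
  (horner_eval l \o map_poly (meval (join_pt x a)) \o line_poly2)
  (meval (join_pt (line x a l) a))) => [c|i|i] /=.
- by rewrite /line_poly2 mmapC /= map_polyC /= mevalC horner_evalE hornerC mevalC.
- rewrite /line_poly2 mmapX mmap1U bi_substl rmorphB rmorphM /= map_polyX !map_polyC /= !mevalXU.
  by rewrite !join_ptl join_ptr horner_evalE !hornerE.
- rewrite /line_poly2 mmapX mmap1U bi_substr map_polyC /= !mevalXU.
  by rewrite !join_ptr horner_evalE !hornerE.
Qed.

Definition spec_x x : R2 -> R1 := mmap (@mpolyC n F) (bi_subst (fun i => (x i)%:MP) (fun i => 'X_i)).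
HB.instance Definition _ x := GRing.RMorphism.on (spec_x x).

Lemma spec_xE x a h : (spec_x x h).@[a] = h.@[join_pt x a].
Proof.
move: h; apply: (@bi_rmorph_eq _ (meval a \o spec_x x) (meval (join_pt x a))) => [c|i|i] /=.
- by rewrite /spec_x mmapC !mevalC.
- by rewrite /spec_x mmapX mmap1U bi_substl mevalC mevalXU join_ptl.
- by rewrite /spec_x mmapX mmap1U bi_substr !mevalXU join_ptr.
Qed.

Definition spec_a a : R2 -> R1 := mmap (@mpolyC n F) (bi_subst (fun i => 'X_i) (fun i => (a i)%:MP)).
HB.instance Definition _ a := GRing.RMorphism.on (spec_a a).

Lemma spec_aE x a h : (spec_a a h).@[x] = h.@[join_pt x a].
Proof.
move: h; apply: (@bi_rmorph_eq _ (meval x \o spec_a a) (meval (join_pt x a))) => [c|i|i] /=.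
- by rewrite /spec_a mmapC !mevalC.
- by rewrite /spec_a mmapX mmap1U bi_substl !mevalXU join_ptl.
- by rewrite /spec_a mmapX mmap1U bi_substr mevalC mevalXU join_ptr.
Qed.

Definition poly1C : F -> {poly R1} := polyC \o @mpolyC _ F.
HB.instance Definition _ := GRing.RMorphism.on poly1C.

Section Shift.
Variable a : 'I_n -> F.

Definition shift_coef : R2 -> {poly R1} :=
  mmap poly1C (bi_subst (fun i => ('X_i)%:P + 'X * ((a i)%:MP)%:P) (fun i => ((a i)%:MP)%:P)).
HB.instance Definition _ := GRing.RMorphism.on shift_coef.

(** Change of variables x = y + l a with [a] fixed: f(x - l a) becomes f(y), constant in l. *)
Definition shift : {poly R2} -> {poly R1} := horner_eval 'X \o map_poly shift_coef.
HB.instance Definition _ := GRing.RMorphism.on shift.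

Lemma shiftE y l P : (map_poly (meval y) (shift P)).[l] = (ev (fun i => y i + l * a i) a P).[l].
Proof.
rewrite /shift /= horner_evalE -horner_map /= map_polyX -horner_evalE -horner_map /= horner_evalE hornerX.
rewrite -!map_poly_comp; congr (_.[l]); apply: eq_map_poly => h /=.
move: h; apply: (@bi_rmorph_eq _ (horner_eval l \o map_poly (meval y) \o shift_coef)
   (meval (join_pt (fun i => y i + l * a i) a))) => [c|i|i] /=.
- by rewrite /shift_coef mmapC /= map_polyC /= mevalC horner_evalE hornerC mevalC.
- rewrite /shift_coef mmapX mmap1U bi_substl rmorphD rmorphM /= map_polyX !map_polyC /= !mevalXU mevalC.
  by rewrite !join_ptl horner_evalE !hornerE.
- rewrite /shift_coef mmapX mmap1U bi_substr map_polyC /= mevalXU mevalC.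
  by rewrite !join_ptr horner_evalE !hornerE.
Qed.

End Shift.

Lemma poly_mpoly_eq (P Q : {poly R1}) :
  (forall y l, (map_poly (meval y) P).[l] = (map_poly (meval y) Q).[l]) -> P = Q.
Proof.
move=> PQ; apply/polyP => i; apply: mpoly_eqP_eval => y.
by have /polyP/(_ i) := poly_eq_eval (PQ y); rewrite !coef_map.
Qed.

(** Undoes [shift] on one line, by substituting y = x - l a in a polynomial in y and l. *)
Definition restrict_line x a : {poly R1} -> {poly F} :=
  horner_eval 'X \o map_poly (mmap (@polyC F) (fun i => (x i)%:P - 'X * (a i)%:P)).

Lemma restrict_lineE x a (r : {poly R1}) l :
  (restrict_line x a r).[l] = (map_poly (meval (line x a l)) r).[l].
Proof.
rewrite /restrict_line /= horner_evalE -horner_evalE -horner_map /= horner_evalE hornerX.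
rewrite -map_poly_comp; congr (_.[l]); apply: eq_map_poly => h /=.
move: h; apply: (@mpoly_rmorph_eq _ _ _
   (horner_eval l \o mmap (@polyC F) (fun i => (x i)%:P - 'X * (a i)%:P)) (meval (line x a l))) => [c|i] /=.
  by rewrite mmapC horner_evalE hornerC mevalC.
by rewrite mmapX mmap1U mevalXU horner_evalE !hornerE.
Qed.

End LinePolynomials.

Section GenericLine.
Variables (F : numFieldType) (n : nat).

(** If f(x - l a) and h(x - l a, a) are coprime in l, a Bezout identity gives [H]. Otherwise U f = V
    h with V of lower degree in l than f(x - l a); after the shift f divides h(., a), excluded by
    [gP], or V, excluded by degrees. *)
Lemma generic_line (f g : {mpoly F[n]}) (h : {mpoly F[n + n]}) :
  prime_elt f -> g != 0 -> (forall a, g.@[a] != 0 -> ~ rdvd f (spec_a a h)) ->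
  exists2 H : {mpoly F[n + n]}, H != 0 &
    forall x a, H.@[join_pt x a] != 0 -> forall l, f.@[line x a l] = 0 ->
    h.@[join_pt (line x a l) a] != 0.
Proof.
move=> fP g0 gP; pose FF := line_poly f; pose GG := line_poly2 h.
have line0 (x a : 'I_n -> F) : line x a 0 =1 x by move=> i; rewrite /line mul0r subr0.
have FF0 : FF != 0.
  have [f0 _ _] := fP; have [x fx] := mpoly_nonroot f0.
  apply: contraNneq fx => FF0; have := ev_line_poly x x 0 f.
  by rewrite -/FF FF0 /ev rmorph0 horner0 (meval_eq _ (line0 x x)) => <-.
have GG0 : GG != 0.
  have [a1 ga1] := mpoly_nonroot g0; apply/eqP => GG0; case: (gP a1 ga1).
  suff -> : spec_a a1 h = 0 by exists 0; rewrite mul0r.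
  apply: mpoly_eqP_eval => y; have := ev_line_poly2 y a1 0 h.
  rewrite -/GG GG0 /ev rmorph0 horner0 rmorph0 spec_aE => E.
  apply: etrans (esym E); apply: meval_eq => k; rewrite /join_pt.
  by case: (split k) => // i; rewrite line0.
have [cop|] := boolP (coprimep FF GG).
  have /Bezout_coprimepP [[U V] /= /eqp_size] := cop; rewrite size_poly1 => /eqP/size_poly1P [H H0 E].
  exists H => // x a Hxa l fl; apply: contraNneq Hxa => hl.
  have := congr1 (fun P => (ev x a P).[l]) E.
  rewrite /ev map_polyC hornerC /= => <-; rewrite rmorphD !rmorphM hornerD !hornerM.
  have -> : (map_poly (meval (join_pt x a)) FF).[l] = 0 by rewrite -[LHS]/((ev x a FF).[l]) ev_line_poly.
  have -> : (map_poly (meval (join_pt x a)) GG).[l] = 0 by rewrite -[LHS]/((ev x a GG).[l]) ev_line_poly2.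
  by rewrite !mulr0 addr0.
move=> /(Bezout_coprimepPn FF0 GG0) [[U V] /= /and3P[_ V0 VF] UV]; exfalso.
rewrite size_poly_gt0 in V0.
have LM0 : lead_coef FF * lead_coef V != 0 by rewrite mulf_neq0 ?lead_coef_eq0.
have [pt LMpt] := mpoly_nonroot LM0.
pose x0 i := pt (lshift n i).
have ptE : pt =1 join_pt x0 (fun i => pt (rshift n i)).
  by move=> k; rewrite -[k]splitK; case: (split k) => i /=; rewrite ?join_ptl ?join_ptr.
(* The specialization must keep both leading coefficients, so that the degrees in l survive, and
   satisfy g(a0) <> 0. *)
have nz : spec_x x0 (lead_coef FF * lead_coef V) * g != 0.
  apply: mulf_neq0 => //; apply: contraNneq LMpt => e.
  by rewrite (meval_eq _ ptE) -spec_xE e rmorph0.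
have [a0] := mpoly_nonroot nz; rewrite rmorphM mulf_eq0 negb_or /= spec_xE rmorphM mulf_eq0 negb_or.
move=> /andP[/andP[L0 M0] h0].
have sV : size (ev x0 a0 V) = size V by rewrite /ev size_map_poly_id0.
have sF : size (ev x0 a0 FF) = size FF by rewrite /ev size_map_poly_id0.
have shF : shift a0 FF = f%:P.
  apply: poly_mpoly_eq => y l; rewrite shiftE ev_line_poly map_polyC hornerC /=.
  by apply: meval_eq => i; rewrite /line addrK.
have shG : shift a0 GG = (spec_a a0 h)%:P.
  apply: poly_mpoly_eq => y l; rewrite shiftE ev_line_poly2 map_polyC hornerC /= spec_aE.
  apply: meval_eq => k; rewrite /join_pt; case: (split k) => // i; by rewrite /line addrK.
have := congr1 (shift a0) UV; rewrite !rmorphM /= shF shG => E.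
have [_ _ fPP] := polyC_prime fP.
have : rdvd f%:P (shift a0 V) \/ rdvd f%:P (spec_a a0 h)%:P.
  by apply: fPP; exists (shift a0 U); exact: esym E.
case=> -[r rE].
  (* On the line, divisibility of the shifted V by f says that f(x0 - l a0) divides V(x0, a0, l),
     which is nonzero of lower degree. *)
  have VE : ev x0 a0 V = restrict_line x0 a0 r * ev x0 a0 FF.
    apply: poly_eq_eval => l; rewrite hornerM restrict_lineE ev_line_poly.
    have := shiftE a0 (line x0 a0 l) l V; rewrite rE rmorphM hornerM /= map_polyC hornerC /= => ->.
    congr (_.[l]); apply: eq_map_poly => q; apply: meval_eq => k; rewrite /join_pt.
    by case: (split k) => // i; rewrite /line subrK.
  have Vx0 : ev x0 a0 V != 0 by rewrite -size_poly_gt0 sV size_poly_gt0.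
  have dv : ev x0 a0 FF %| ev x0 a0 V by rewrite VE dvdp_mull.
  by have := dvdp_leq Vx0 dv; rewrite sV sF leqNgt VF.
by case: (gP a0 h0); exact: (rdvd_polyC2 f (spec_a a0 h)).1 (ex_intro _ r rE).
Qed.

End GenericLine.

(** * The Kronecker block *)

Lemma complement_split (F : fieldType) n k (W : 'M[F]_(k, n)) (N : 'M_(n, k)) :
  W *m N \in unitmx ->
  exists n' (W2 : 'M[F]_(n', n)),
    [/\ (k + n')%N = n, row_free (col_mx W W2), row_free W2 & W2 *m N = 0].
Proof.
move=> Wu; pose W2 := row_base (kermx N).
have W2N : W2 *m N = 0 by apply/eqP; rewrite -sub_kermx eq_row_base.
have nE : (k + \rank (kermx N))%N = n.
  have rk : \rank N = k.
    by apply/eqP; rewrite eqn_leq rank_leq_col -{1}(mxrank_unit Wu) mxrankM_maxr.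
  by rewrite mxrank_ker rk subnKC // -rk rank_leq_row.
have W2free : row_free W2 by apply: row_base_free.
exists _, W2; split=> //.
apply: inj_row_free => v; rewrite -[v]hsubmxK mul_row_col => v0.
have v1 : lsubmx v = 0.
  have := congr1 (mulmx^~ N) v0; rewrite /= mulmxDl -[_ *m W2 *m N]mulmxA W2N mulmx0 addr0 mul0mx.
  by rewrite -mulmxA => /(congr1 (mulmx^~ (invmx (W *m N)))); rewrite /= mulmxK // mul0mx.
move: v0; rewrite v1 mul0mx add0r => v0.
by rewrite (row_free_inj W2free (etrans v0 (esym (mul0mx _ _)))) row_mx0.
Qed.

Lemma form_swap (F : fieldType) n a b (M : 'M[F]_n) (x : 'M_(a, n)) (y : 'M_(b, n)) : M^T = - M ->
  x *m M *m y^T = - (y *m M *m x^T)^T.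
Proof. by move=> skM; rewrite !trmx_mul trmxK skM mulNmx mulmxN opprK mulmxA. Qed.

(** A skew matrix of corank one has as row space the annihilator of its kernel. *)
Lemma skew_range (F : fieldType) n (M : 'M[F]_n) (v e : 'rV_n) : M^T = - M ->
  (n.-1 <= \rank M)%N -> v != 0 -> v *m M = 0 -> v *m e^T = 0 -> exists u, u *m M = e.
Proof.
move=> skM rM v0 vM ve.
have Mv : (M <= kermx v^T)%MS.
  by apply/sub_kermxP/trmx_inj; rewrite trmx_mul trmxK skM mulmxN vM oppr0 trmx0.
have ev : (e <= kermx v^T)%MS.
  by apply/sub_kermxP/trmx_inj; rewrite trmx_mul trmxK ve trmx0.
have rv : \rank (kermx v^T) = n.-1 by rewrite mxrank_ker mxrank_tr rank_rV v0 subn1.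
have := mxrank_leqif_sup Mv; rewrite rv => -[_].
have -> : (\rank M == n.-1) = true by rewrite eqn_leq rM andbT -rv mxrankS.
by move=> /esym kM; have /submxP [u ->] := submx_trans ev kM; exists u.
Qed.

Lemma nonroots (F : numDomainType) (chi : {poly F}) p : chi != 0 ->
  exists s, [/\ size s = p, uniq s & forall x, x \in s -> chi.[x] != 0].
Proof.
move=> chi0; elim: p => [|p [s [ss us sP]]]; first by exists [::].
have : chi * \prod_(x <- s) ('X - x%:P) != 0.
  by rewrite mulf_neq0 // monic_neq0 // monic_prod_XsubC.
move/poly_nonroot => [x]; rewrite hornerM mulf_eq0 negb_or => /andP[xchi xs].
exists (x :: s); rewrite /= ss us andbT; split=> // [|y].
  by apply: contra xs => xs; rewrite -[_ == 0]/(root _ _) root_prod_XsubC.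
by rewrite inE => /orP[/eqP->|/sP].
Qed.

Section Chain.
Variables (F : numClosedFieldType) (n p : nat) (A B : 'M[F]_n) (v : nat -> 'rV[F]_n) (chi : {poly F}).
Hypotheses (skA : A^T = - A) (skB : B^T = - B).
Hypotheses (v0A : v 0%N *m A = 0) (vAB : forall i, v i.+1 *m A = v i *m B).
Hypothesis v_out : forall i, (p < i)%N -> v i = 0.
Hypothesis vp0 : v p != 0.
Hypothesis chi0 : chi != 0.
Hypothesis generic_rank : forall mu, chi.[mu] != 0 -> (n.-1 <= \rank (A - mu *: B)%R)%N.

Definition vpoly k := \poly_(i < p.+1) v i 0 k.
Definition vat mu := \row_k (vpoly k).[mu].
Hypothesis vat0 : forall mu, vat mu != 0.

Lemma vatE mu : vat mu = \sum_(i < p.+1) mu ^+ i *: v i.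
Proof.
apply/rowP => k; rewrite mxE horner_poly summxE; apply: eq_bigr => i _.
by rewrite mxE mulrC.
Qed.

Lemma chain_kernel q (u : nat -> 'rV[F]_n) mu : u 0%N *m A = 0 ->
  (forall i, u i.+1 *m A = u i *m B) -> (forall i, (q <= i)%N -> u i = 0) ->
  (\sum_(i < q) mu ^+ i *: u i) *m (A - mu *: B) = 0.
Proof.
move=> u0 uAB uq; rewrite mulmxBr -scalemxAr !mulmx_suml scaler_sumr.
transitivity (\sum_(i < q.+1) mu ^+ i *: (u i *m A) - \sum_(i < q) mu ^+ i.+1 *: (u i *m B)).
  congr (_ - _).
    rewrite big_ord_recr /= uq // mul0mx scaler0 addr0.
    by apply: eq_bigr => i _; rewrite scalemxAl.
  by apply: eq_bigr => i _; rewrite -scalemxAl scalerA exprS.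
rewrite big_ord_recl u0 scaler0 add0r -sumrB big1 // => i _.
by rewrite lift0 uAB subrr.
Qed.

Lemma vat_kernel mu : vat mu *m (A - mu *: B) = 0.
Proof. by rewrite vatE chain_kernel // => i; apply: v_out. Qed.

(* Generically the kernel is a line, so a shorter chain u is proportional to v;
   then the entries of v have a common root. *)
Lemma minimal_chain (u : nat -> 'rV[F]_n) : u 0%N *m A = 0 ->
  (forall i, u i.+1 *m A = u i *m B) -> (forall i, (p <= i)%N -> u i = 0) -> forall i, u i = 0.
Proof.
move=> u0 uAB up; pose U k := \poly_(i < p) u i 0 k.
have UE mu : \row_k (U k).[mu] = \sum_(i < p) mu ^+ i *: u i.
  apply/rowP => k; rewrite mxE horner_poly summxE; apply: eq_bigr => i _.
  by rewrite mxE mulrC.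
have UV k l : U k * vpoly l = U l * vpoly k.
  apply: (mulfI chi0); apply: poly_eq_eval => mu; rewrite !hornerM.
  have [->|mu0] := eqVneq chi.[mu] 0; first by rewrite !mul0r.
  congr (_ * _); have rk : (\rank (kermx (A - mu *: B)%R) <= 1)%N.
    by rewrite mxrank_ker leq_subLR addn1; apply: leq_trans (leqSpred n) _; rewrite ltnS generic_rank.
  have uk : (\row_k (U k).[mu] <= row_base (kermx (A - mu *: B)))%MS.
    by rewrite eq_row_base; apply/sub_kermxP; rewrite UE chain_kernel.
  have vk : (vat mu <= row_base (kermx (A - mu *: B)))%MS.
    by rewrite eq_row_base; apply/sub_kermxP/vat_kernel.
  move: (row_base _) uk vk => K /submxP [x xE] /submxP [y yE].
  have uE k' : (U k').[mu] = (x *m K) 0 k' by rewrite -xE mxE.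
  have vE k' : (vpoly k').[mu] = (y *m K) 0 k' by rewrite -yE mxE.
  rewrite !uE !vE; case: (\rank _) rk x y K {xE yE uE vE} => [|[|//]] _ x y K.
    by rewrite !mxE !big_ord0 !mul0r.
  by rewrite !mxE !big_ord1; ring.
have [l vl] : exists l, v p 0 l != 0.
  by apply/existsP; apply: contraR vp0 => /existsPn H; apply/eqP/rowP => i; rewrite mxE; exact/eqP/negPn/H.
have sl : size (vpoly l) = p.+1 by rewrite size_poly_eq.
have vl0 : vpoly l != 0 by rewrite -size_poly_gt0 sl.
have Ul0 : U l = 0.
  apply/eqP; apply: contraT => Ul0; pose d := gcdp (vpoly l) (U l).
  have d0 : d != 0 by rewrite gcdp_eq0 (negPf vl0).
  pose g := vpoly l %/ d; pose t := U l %/ d.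
  have gE : vpoly l = g * d by rewrite divpK ?dvdp_gcdl.
  have tE : U l = t * d by rewrite divpK ?dvdp_gcdr.
  have cop : coprimep g t by apply: coprimep_div_gcd; rewrite vl0.
  have sg : size g != 1%N.
    apply/eqP => sg; have sd : (size d <= p)%N.
      by apply: leq_trans (size_poly _ _ : size (U l) <= p)%N; apply: dvdp_leq => //; exact: dvdp_gcdr.
    have := sl; rewrite gE size_mul ?sg; first by move: sd; move: (size d) => x; lia.
      by apply: contraNneq vl0 => g0; rewrite gE g0 mul0r.
    by [].
  have /closed_rootP [mu gmu] := sg.
  have := vat0 mu; case/eqP; apply/rowP => k; rewrite !mxE.
  have : g %| t * vpoly k.
    rewrite -(dvdp_mul2r _ _ d0) mulrAC -tE -gE -UV; exact: dvdp_mulIr.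
  by rewrite Gauss_dvdpr // => /dvdpP [s ->]; rewrite hornerM (rootP gmu) mulr0.
move=> i; have [ip|pi] := ltnP i p; last exact: up.
apply/rowP => k; have : U k = 0.
  by have /eqP := UV k l; rewrite Ul0 mul0r mulf_eq0 (negPf vl0) orbF => /eqP.
by move/polyP/(_ i); rewrite coef_poly ip coef0 mxE.
Qed.

(** A relation among the [v i *m B] yields, by convolution with the [v j], a chain shorter than [v].
    It vanishes by minimality, and as [v 0] is nonzero the coefficients vanish one after another. *)
Lemma chain_free (al : nat -> F) : \sum_(i < p) al i *: (v i *m B) = 0 ->
  forall i, (i < p)%N -> al i = 0.
Proof.
(* The coefficients are reversed so that the given relation is exactly the condition for the new
   chain to stop at step [p]. *)
move=> alB; pose r i := al (p.-1 - i)%N.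
pose u t := if (t < p)%N then \sum_(j < t.+1) r (t - j)%N *: v j else 0.
have u0 : forall t, u t = 0.
  apply: minimal_chain => [|t|t pt]; last by rewrite /u ltnNge pt.
    rewrite /u; case: ifP => _; last by rewrite mul0mx.
    by rewrite big_ord1 -scalemxAl v0A scaler0.
  rewrite /u; case: (ltnP t.+1 p) => tp.
    rewrite (ltnW tp) !mulmx_suml big_ord_recl /= -scalemxAl v0A scaler0 add0r.
    by apply: eq_bigr => j _; rewrite /bump /= add1n subSS -!scalemxAl vAB.
  case: ifP => tp'; last by rewrite !mul0mx.
  rewrite mul0mx; have tE : t.+1 = p by apply/eqP; rewrite eqn_leq tp'.
  rewrite -[LHS]alB mulmx_suml -tE; apply: eq_bigr => j _; rewrite scalemxAl.
  by rewrite /r -tE /= subKn // -ltnS ltn_ord.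
have v00 : v 0%N != 0.
  have := vat0 0; rewrite vatE big_ord_recl expr0 scale1r big1 ?addr0 // => i _.
  by rewrite exprS mul0r scale0r.
suff r0 t : (t < p)%N -> r t = 0.
  move=> i ip; have := r0 (p.-1 - i)%N; rewrite /r subKn; last by lia.
  by apply; lia.
elim/ltn_ind: t => t IH tp; have := u0 t; rewrite /u tp big_ord_recl subn0 big1 ?addr0 => [|j _].
  by move/eqP; rewrite scaler_eq0 (negPf v00) orbF => /eqP.
by rewrite IH ?scale0r //; rewrite lift0; have := ltn_ord j; lia.
Qed.

(** Skewness of both forms moves one step across: v_i B v_(j+1) equals v_(i+1) B v_j, until v_0 is
    reached, which [A] kills. *)
Lemma chain_isotropic j i : v i *m B *m (v j)^T = 0.
Proof.
elim: j i => [|j IH] i.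
  by rewrite -vAB -mulmxA (_ : A *m _ = 0) ?mulmx0 //; apply: trmx_inj; rewrite trmx_mul trmxK skA mulmxN v0A oppr0 trmx0.
rewrite -vAB; apply: trmx_inj; rewrite !trmx_mul trmxK skA mulNmx mulmxN mulmxA vAB.
have := congr1 trmx (IH i.+1); rewrite !trmx_mul trmxK skB mulNmx mulmxN mulmxA => ->.
by rewrite !trmx0.
Qed.

Lemma chain_isotropicA j i : v i *m A *m (v j)^T = 0.
Proof. by case: i => [|i]; [rewrite v0A mul0mx | rewrite vAB chain_isotropic]. Qed.

Lemma v_lastB : v p *m B = 0.
Proof. by rewrite -vAB v_out // mul0mx. Qed.

Lemma chain_row_free : row_free (\matrix_(i < p.+1) v i).
Proof.
apply: inj_row_free => c; rewrite mulmx_sum_row => cV.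
pose al i := c 0 (inord i).
have alE (i : 'I_p.+1) : c 0 i = al i by rewrite /al inord_val.
have al0 : forall i, (i < p)%N -> al i = 0.
  apply: chain_free; have := congr1 (mulmx^~ B) cV; rewrite /= mul0mx mulmx_suml big_ord_recr /=.
  rewrite rowK -scalemxAl v_lastB scaler0 addr0 => E; rewrite -[RHS]E; apply: eq_bigr => i _.
  by rewrite rowK -scalemxAl alE.
have alp : al p = 0.
  move: cV; rewrite big_ord_recr /= big1 ?add0r => [|i _]; last by rewrite alE al0 ?scale0r //=.
  by rewrite rowK alE /= => /eqP; rewrite scaler_eq0 (negPf vp0) orbF => /eqP.
apply/rowP => i; rewrite alE mxE; have [lt|ge] := ltnP i p; first exact: al0.
by rewrite (_ : nat_of_ord i = p) //; apply/eqP; rewrite eqn_leq ge -ltnS ltn_ord.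
Qed.

Lemma skew_pencil mu : (A - mu *: B)^T = - (A - mu *: B).
Proof. by rewrite linearB /= linearZ /= skA skB scalerN opprK opprB addrC. Qed.

(* Take a form e whose values on v_0, ..., v_p are the coefficients of
   P = \prod_j (X - mu_j) and solve u_j (A - mu_j B) = e: the u_j are isotropic
   and, by Lagrange interpolation, dual to the v_i. *)
Theorem kronecker_split : exists n' (W1 : 'M[F]_(p.*2.+1, n)) (W2 : 'M[F]_(n', n)),
  [/\ (p.*2.+1 + n')%N = n, row_free (col_mx W1 W2),
      W1 *m A *m W1^T = jk_blk true (None, p.+1) /\ W1 *m B *m W1^T = jk_blk false (None, p.+1),
      W1 *m A *m W2^T = 0 /\ W1 *m B *m W2^T = 0 &
      (n.-1 <= \rank B)%N -> W2 *m B *m W2^T \in unitmx].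
Proof.
have [s [ss us sP]] := nonroots p chi0.
pose P := \prod_(x <- s) ('X - x%:P); pose mu (j : 'I_p) := s`_j.
have muP j : chi.[mu j] != 0 by apply: sP; rewrite mem_nth // ss.
have sizeP : size P = p.+1 by rewrite size_prod_XsubC ss.
have Pmu j : P.[mu j] = 0.
  by apply/rootP; rewrite root_prod_XsubC mem_nth // ss.
have Plast : P`_p = 1.
  by have /monicP := monic_prod_XsubC s xpredT id; rewrite lead_coefE -/P sizeP.
have [X VX] := row_freeP chain_row_free.
pose e : 'rV[F]_n := (X *m \col_i P`_i)^T.
have ve i : (i <= p)%N -> v i *m e^T = (P`_i)%:M.
  move=> ip; have ip' : (i < p.+1)%N by [].
  have := congr1 (row (Ordinal ip')) (mulmxA (\matrix_(i < p.+1) v i) X (\col_i P`_i)).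
  rewrite VX mul1mx /e trmxK row_mul rowK => ->.
  by apply/matrixP => x y; rewrite !ord1 !mxE mulr1n.
have vate l : vat l *m e^T = (P.[l])%:M.
  rewrite vatE mulmx_suml (horner_coef_wide _ (eq_leq sizeP)) raddf_sum; apply: eq_bigr => i _.
  by rewrite -scalemxAl ve ?scale_scalar_mx 1?mulrC // -ltnS.
have [u uM] : exists u : 'I_p -> 'rV[F]_n, forall j, u j *m (A - mu j *: B) = e.
  apply: (@fin_all_exists _ (fun=> 'rV[F]_n) (fun j u => u *m (A - mu j *: B) = e)) => j.
  apply: (skew_range (skew_pencil _) (generic_rank (muP j)) (vat0 (mu j)) (vat_kernel _)).
  by rewrite vate Pmu raddf0.
have uA j : u j *m A = e + mu j *: (u j *m B).
  by rewrite -(uM j) mulmxBr -scalemxAr subrK.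
have ue j : u j *m e^T = 0.
  have := skew_form0 (u j) (skew_pencil (mu j)); rewrite uM => /(congr1 trmx).
  by rewrite trmx_mul trmxK trmx0.
have eu j : e *m (u j)^T = 0 by apply: trmx_inj; rewrite trmx_mul trmxK ue trmx0.
have mu_inj : injective mu.
  by move=> i j /eqP; rewrite nth_uniq ?ss // => /eqP/val_inj.
(* The value of [A] on u_i, u_j is both mu_i and mu_j times that of [B], because [e] vanishes on the
   [u j]; the nodes are distinct. *)
have uBu i j : u i *m B *m (u j)^T = 0.
  have [->|ij] := eqVneq i j; first exact: skew_form0.
  have E1 : u i *m A *m (u j)^T = mu i *: (u i *m B *m (u j)^T).
    by rewrite uA mulmxDl eu add0r -scalemxAl.
  have E2 : u i *m A *m (u j)^T = mu j *: (u i *m B *m (u j)^T).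
    rewrite (form_swap _ _ skA) uA mulmxDl eu add0r -scalemxAl linearZ /= -scalerN.
    by rewrite -(form_swap _ _ skB).
  have /eqP : (mu i - mu j) *: (u i *m B *m (u j)^T) = 0 by rewrite scalerBl -E1 -E2 subrr.
  by rewrite scaler_eq0 subr_eq0 (inj_eq mu_inj) (negPf ij) => /eqP.
have uBvat j l : (l - mu j) *: (u j *m B *m (vat l)^T) = (P.[l])%:M.
  have vatA : vat l *m A = l *: (vat l *m B).
    by apply/eqP; rewrite -subr_eq0 scalemxAr -mulmxBr vat_kernel.
  have uAvat : u j *m A *m (vat l)^T = l *: (u j *m B *m (vat l)^T).
    rewrite (form_swap _ _ skA) vatA -scalemxAl linearZ /= -scalerN.
    by rewrite -(form_swap _ _ skB).
  rewrite scalerBl -uAvat uA mulmxDl -scalemxAl addrK.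
  by apply: trmx_inj; rewrite trmx_mul trmxK vate tr_scalar_mx.
pose U := \matrix_j u j; pose L := \matrix_(c < p) v (p.-1 - c)%N; pose D := U *m B *m L^T.
have rowU j : row j U = u j by rewrite rowK.
have rowL c : row c L = v (p.-1 - c)%N by rewrite rowK.
have vB0 : B *m (v p)^T = 0.
  by apply: trmx_inj; rewrite trmx_mul trmxK skB mulmxN v_lastB oppr0 trmx0.
(* If a combination of the [u j] is orthogonal to the chain, pair it with the kernel vector at mu_k:
   only the [k]-th term survives, with factor P / (X - mu_k) at mu_k, which is nonzero. *)
have Du : D \in unitmx.
  rewrite -row_free_unit; apply: inj_row_free => be beD.
  pose y := be *m U; have yv i : (i <= p)%N -> y *m B *m (v i)^T = 0.
    rewrite leq_eqVlt => /orP[/eqP->|ip]; first by rewrite -mulmxA vB0 ?mulmx0.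
    have cp : (p.-1 - i < p)%N by lia.
    have yL : y *m B *m L^T = 0 by rewrite /y -!mulmxA (mulmxA U).
    have := congr1 (row (Ordinal cp)) (skew_comm0 skB yL).
    rewrite !row_mul row0 rowL /= subKn; last by lia.
    exact: skew_comm0.
  have yvat l : y *m B *m (vat l)^T = 0.
    rewrite vatE linear_sum mulmx_sumr big1 // => i _.
    by rewrite linearZ /= -scalemxAr yv ?scaler0 // -ltnS.
  apply/rowP => k; rewrite mxE.
  pose G := \poly_(i < p.+1) (u k *m B *m (v i)^T) 0 0.
  have GE l : G.[l] = (u k *m B *m (vat l)^T) 0 0.
    rewrite horner_poly vatE linear_sum mulmx_sumr summxE; apply: eq_bigr => i _.
    by rewrite linearZ /= -scalemxAr [RHS]mxE mulrC.
  have GP : ('X - (mu k)%:P) * G = P.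
    apply: poly_eq_eval => l; rewrite hornerM hornerXsubC GE.
    by have /matrixP/(_ 0 0) := uBvat k l; rewrite mxE [RHS]mxE mulr1n.
  have Gk : G.[mu k] != 0.
    have ms : mu k \in s by rewrite mem_nth // ss.
    have : P = ('X - (mu k)%:P) * \prod_(x <- rem (mu k) s) ('X - x%:P).
      by rewrite /P (big_rem _ ms).
    rewrite -GP => /(mulfI (monic_neq0 (monicXsubC _))) ->.
    by rewrite -[_ == 0]/(root _ _) root_prod_XsubC mem_rem_uniqF.
  have := yvat (mu k); rewrite /y (mulmx_sum_row be) !mulmx_suml (bigD1 k) //= big1 ?addr0 => [|j jk].
    rewrite rowU -!scalemxAl => /matrixP/(_ 0 0); rewrite mxE [RHS]mxE -GE.
    by move=> /eqP; rewrite mulf_eq0 (negPf Gk) orbF => /eqP.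
  rewrite rowU -!scalemxAl; have /eqP := uBvat j (mu k).
  rewrite Pmu raddf0 scaler_eq0 subr_eq0 (inj_eq mu_inj) eq_sym (negPf jk) => /eqP ->.
  by rewrite scaler0.
(* The combinations of the [u j] dual to the reversed chain [L]; isotropy survives the change of
   basis. *)
pose Z := invmx D *m U.
have ZBL : Z *m B *m L^T = 1%:M by rewrite /Z -!mulmxA (mulmxA U) mulVmx.
have UBU : U *m B *m U^T = 0 by apply/matrixP => i j; rewrite gram_entry !rowU uBu !mxE.
have UAU : U *m A *m U^T = 0.
  apply/matrixP => i j; rewrite gram_entry !rowU uA mulmxDl eu add0r -scalemxAl uBu scaler0.
  by rewrite !mxE.
have Z0 M : U *m M *m U^T = 0 -> Z *m M *m Z^T = 0.
  by move=> M0; rewrite /Z trmx_mul !mulmxA -2!(mulmxA (invmx D)) M0 mulmx0 mul0mx.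
have ZAZ := Z0 _ UAU; have ZBZ := Z0 _ UBU.
have LBL : L *m B *m L^T = 0.
  by apply/matrixP => i j; rewrite gram_entry !rowL chain_isotropic !mxE.
have LBU : L *m B *m U^T = - D^T by rewrite (form_swap _ _ skB).
have Ue : U *m e^T = 0.
  by apply/row_matrixP => i; rewrite row_mul rowU ue row0.
have Ze : Z *m e^T = 0 by rewrite /Z -mulmxA Ue mulmx0.
have ZBU : Z *m B *m U^T = 0 by rewrite /Z -!mulmxA (mulmxA U) UBU mulmx0.
(* [W0] spans the block, and the complement is cut out by [e] and by pairing with [U] and [L]. The
   form [e] detects [v p], which [B] kills, and it gives orthogonality for [A], as [u j *m A] is [e]
   plus a multiple of [u j *m B]. *)
pose W0 := col_mx (v p) (col_mx Z L).
pose N := row_mx e^T (row_mx (B *m U^T) (B *m L^T)).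
have Nu : W0 *m N \in unitmx.
  rewrite -row_free_unit; apply: inj_row_free => y.
  rewrite -[y]hsubmxK -[rsubmx y]hsubmxK.
  move: (lsubmx y) (lsubmx (rsubmx y)) (rsubmx (rsubmx y)) => y0 yz yl.
  rewrite mulmxA !mul_row_col !mul_mx_row => /eqP.
  rewrite !row_mx_eq0 !mulmxDl !mulmxA => /andP[/eqP E0 /andP[/eqP E1 /eqP E2]].
  move: E2; rewrite -!(mulmxA y0) v_lastB mul0mx mulmx0 add0r.
  rewrite -!(mulmxA yz) -!(mulmxA yl) ZBL LBL mulmx1 mulmx0 addr0 => yz0.
  move: E1; rewrite yz0 !mul0mx add0r -!(mulmxA y0) v_lastB mul0mx mulmx0 add0r.
  rewrite -!mulmxA (mulmxA L) LBU mulmxN => /eqP; rewrite oppr_eq0 => /eqP yl0.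
  have {}yl0 : yl = 0.
    apply: (row_free_inj _ (etrans yl0 (esym (mul0mx _ _)))).
    by rewrite row_free_unit unitmx_tr.
  move: E0; rewrite yz0 yl0 !mul0mx !addr0 -mulmxA ve // Plast mulmx1 => ->.
  by rewrite !row_mx0.
have [n' [W2 [nE Wfree W2free W2N]]] := complement_split Nu.
move: W2N => /eqP; rewrite !mul_mx_row !row_mx_eq0 !mulmxA => /andP[/eqP W2e /andP[/eqP W2U /eqP W2L]].
have eW2 : e *m W2^T = 0 by apply: trmx_inj; rewrite trmx_mul trmxK W2e trmx0.
have uBW j : u j *m B *m W2^T = 0.
  have /(congr1 (row j)) := skew_comm0 skB W2U; rewrite !row_mul rowU => ->.
  by rewrite row0.
have vBW i : v i *m B *m W2^T = 0.
  have [ip|] := ltnP i p.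
    have cp : (p.-1 - i < p)%N by lia.
    have /(congr1 (row (Ordinal cp))) := skew_comm0 skB W2L; rewrite !row_mul rowL /= subKn; last by lia.
    by move=> ->; rewrite row0.
  rewrite leq_eqVlt => /orP[/eqP<-|ip]; first by rewrite v_lastB mul0mx.
  by rewrite v_out // !mul0mx.
have vAW i : v i *m A *m W2^T = 0 by case: i => [|i]; rewrite ?v0A ?mul0mx // vAB vBW.
have uAW j : u j *m A *m W2^T = 0 by rewrite uA mulmxDl eW2 add0r -scalemxAl uBW scaler0.
have ZBW : Z *m B *m W2^T = 0.
  rewrite /Z -!mulmxA [U *m _](_ : _ = 0) ?mulmx0 //.
  by apply/row_matrixP => j; rewrite mulmxA !row_mul rowU uBW row0.
have ZAW : Z *m A *m W2^T = 0.
  rewrite /Z -!mulmxA [U *m _](_ : _ = 0) ?mulmx0 //.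
  by apply/row_matrixP => j; rewrite mulmxA !row_mul rowU uAW row0.
pose zf a := if insub a is Some j then row j Z else 0.
have zfE (j : 'I_p) : zf j = row j Z by rewrite /zf valK.
(* From row [p] on, the chain runs in reverse order, starting at [v p], to match the entries of the
   Kronecker block. *)
pose rW r := if (r < p)%N then zf r else v (p - (r - p))%N.
pose W1 := \matrix_(r < p.*2.+1) rW r.
have zz M : Z *m M *m Z^T = 0 -> forall a b, zf a *m M *m (zf b)^T = 0.
  move=> M0 a b; rewrite /zf; case: insubP => [i _ _|_]; last by rewrite !mul0mx.
  case: insubP => [j _ _|_]; last by rewrite trmx0 mulmx0.
  by apply/matrixP => x y; rewrite !ord1 -gram_entry M0 !mxE.
have zBv a i : (a < p)%N -> (i < p)%N -> zf a *m B *m (v (p.-1 - i)%N)^T = (a == i)%:R%:M.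
  move=> ap ip; rewrite -[a]/(val (Ordinal ap)) zfE -[ i ]/(val (Ordinal ip)) -rowL.
  by apply/matrixP => x y; rewrite !ord1 -gram_entry ZBL !mxE mulr1n.
have zB a i : (a < p)%N -> (i <= p)%N -> zf a *m B *m (v (p - i)%N)^T = (a.+1 == i)%:R%:M.
  move=> ap; case: i => [|i] ip.
    by rewrite subn0 -mulmxA vB0 mulmx0 raddf0.
  by rewrite eqSS -zBv //; congr (_ *m (v _)^T); lia.
have zA a i : (a < p)%N -> (i <= p)%N -> zf a *m A *m (v (p - i)%N)^T = (a == i)%:R%:M.
  move=> ap ip; rewrite (form_swap _ _ skA); have [ip'|pi] := ltnP i p.
    have -> : (p - i)%N = (p.-1 - i).+1 by lia.
    by rewrite vAB -(form_swap _ _ skB) zBv.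
  have -> : (p - i)%N = 0%N by lia.
  rewrite v0A mul0mx trmx0 oppr0 (_ : (a == i) = false) ?raddf0 //; lia.
have W1E M (K : nat -> nat -> F) : M^T = - M -> Z *m M *m Z^T = 0 ->
    (forall i j, v i *m M *m (v j)^T = 0) ->
    (forall a i, (a < p)%N -> (i <= p)%N -> zf a *m M *m (v (p - i)%N)^T = (K a i)%:M) ->
    forall r s, (W1 *m M *m W1^T) r s = skew_entry K p r s.
  move=> skM ZM vM zM r t; rewrite gram_entry !rowK /rW /skew_entry.
  have [rp|pr] := ltnP r p; have [tp|pt] := ltnP t p => /=.
  - by rewrite zz // mxE.
  - by rewrite zM ?mxE ?mulr1n //; have := ltn_ord t; lia.
  - by rewrite (form_swap _ _ skM) zM ?mxE ?mulr1n //; have := ltn_ord r; lia.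
  - by rewrite vM mxE.
have W1W2 M : (forall i, v i *m M *m W2^T = 0) -> Z *m M *m W2^T = 0 -> W1 *m M *m W2^T = 0.
  move=> vM ZM; apply/row_matrixP => r; rewrite !row_mul rowK row0 /rW; case: ifP => // rp.
  by rewrite -[nat_of_ord r]/(val (Ordinal rp)) zfE -!row_mul ZM row0.
exists n', W1, W2; split.
- by rewrite -nE addnn.
- rewrite /row_free eqn_leq rank_leq_row /=.
  have /eqP rk := Wfree; have dimE : (1 + (p + p) + n' = p.*2.+1 + n')%N by rewrite addnn.
  rewrite [leqLHS](etrans (esym dimE) (esym rk)); apply: mxrankS; rewrite !col_mx_sub.
  have W1s : (W1 <= col_mx W1 W2)%MS by rewrite -addsmxE addsmxSl.
  have -> : (W2 <= col_mx W1 W2)%MS by rewrite -addsmxE addsmxSr.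
  have vs i : (i <= p)%N -> (v i <= col_mx W1 W2)%MS.
    move=> ip; apply: submx_trans W1s; have rp : (p + (p - i) < p.*2.+1)%N by lia.
    have <- : row (Ordinal rp) W1 = v i.
      by rewrite rowK /rW /= ltnNge leq_addr /=; congr v; lia.
    exact: row_sub.
  rewrite vs // andbT /=; apply/andP; split; apply/row_subP => j; last by rewrite rowL vs //; lia.
  apply: submx_trans W1s; have rp : (j < p.*2.+1)%N by have := ltn_ord j; lia.
  have <- : row (Ordinal rp) W1 = row j Z by rewrite rowK /rW /= ltn_ord zfE.
  exact: row_sub.
- split; apply/matrixP => r t; rewrite [RHS]mxE.
    exact: (W1E A (fun a i => (a == i)%:R) skA ZAZ (fun i j => chain_isotropicA j i) zA r t).
  exact: (W1E B (fun a i => (a.+1 == i)%:R) skB ZBZ (fun i j => chain_isotropic j i) zB r t).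
- by split; exact: W1W2.
(* A vector of the complement in the radical of the restricted form lies in the kernel of [B], the
   line of [v p]; but [e] vanishes on the complement and is 1 at [v p]. *)
move=> rB; rewrite -row_free_unit; apply: inj_row_free => b; rewrite !mulmxA => bW.
pose h := b *m W2.
have hB : h *m B = 0.
  have /row_fullP [X' X'E] : row_full (col_mx W0 W2).
    by apply/eqP; rewrite (eqP Wfree).
  rewrite -[h *m B]mulmx1 -trmx1 -X'E trmx_mul mulmxA tr_col_mx tr_col_mx tr_col_mx.
  rewrite !mul_mx_row bW.
  have -> : h *m B *m (v p)^T = 0 by rewrite -mulmxA vB0 mulmx0.
  have -> : h *m B *m L^T = 0 by rewrite /h -!mulmxA (mulmxA W2) W2L mulmx0.
  have -> : h *m B *m Z^T = 0.
    by apply: (skew_comm0 skB); rewrite /h trmx_mul mulmxA ZBW mul0mx.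
  by rewrite !row_mx0 mul0mx.
have hk : (h <= v p)%MS.
  have vk : (v p <= kermx B)%MS by apply/sub_kermxP/v_lastB.
  have := mxrank_leqif_sup vk; rewrite rank_rV vp0 mxrank_ker => -[le1].
  have -> : (1 == n - \rank B)%N by rewrite eqn_leq le1 /= leq_subLR addn1; apply: leq_trans (leqSpred n) _.
  by move/esym; apply: submx_trans; apply/sub_kermxP.
have /sub_rVP [g gE] := hk.
have : h *m e^T = 0 by rewrite /h -mulmxA W2e mulmx0.
rewrite gE -scalemxAl ve // Plast scale_scalar_mx mulr1 => /matrixP/(_ 0 0); rewrite !mxE mulr1n => g0.
move: gE; rewrite g0 scale0r => h0.
by apply: (row_free_inj W2free (etrans h0 (esym (mul0mx _ _)))).
Qed.

End Chain.

(** * Toeplitz ranks *)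

Section Toeplitz.
Variable R : comNzRingType.

Definition down_mx j : 'M[R]_j.+1 := \matrix_(i, k) (i == k.+1 :> nat)%:R.

(* The kernel consists of the polynomials X = X_0 + ... + X_j t^j such that
   X * (A - t B) is divisible by t^(j+1). *)
Definition toep n j (A B : 'M[R]_n) : 'M[R]_(j.+1 * n) :=
  lin_mulmxr A - lin_mulmx (down_mx j) *m lin_mulmxr B.

End Toeplitz.

(** Toeplitz matrices specialize, so their ranks are those of one polynomial matrix at varying
    points. *)
Lemma map_toep (R S : comNzRingType) (f : {rmorphism R -> S}) n j (A B : 'M[R]_n) :
  map_mx f (toep j A B) = toep j (map_mx f A) (map_mx f B).
Proof.
have down : map_mx f (down_mx R j) = down_mx S j.
  by apply/matrixP => i k; rewrite !mxE rmorph_nat.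
have -> : toep j (map_mx f A) (map_mx f B) =
    map_mx f (lin_mulmxr A) - map_mx f (lin_mulmx (down_mx R j)) *m map_mx f (lin_mulmxr B).
  congr (_ - _); last congr mulmx; apply: esym; apply: map_lin_mx => X; by rewrite /= map_mxM ?down.
by rewrite /toep map_mxB map_mxM.
Qed.

Section ToeplitzRank.
Variable F : fieldType.

(** An injective linear map between left kernels compares their dimensions; two such maps in
    opposite directions compute the Toeplitz corank. *)
Lemma ker_dim_le a b c d (M1 : 'M[F]_(a, b)) (M2 : 'M_(c, d)) (f : 'rV[F]_a -> 'rV[F]_c) :
  linear f -> (forall u, u *m M1 = 0 -> f u *m M2 = 0) ->
  (forall u, u *m M1 = 0 -> f u = 0 -> u = 0) -> (a - \rank M1 <= c - \rank M2)%N.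
Proof.
move=> lf f12 finj; pose P := \matrix_i f (delta_mx 0 i).
have fE u : f u = u *m P.
  pose f' : {linear 'rV[F]_a -> 'rV[F]_c} := HB.pack f (GRing.isLinear.Build F _ _ _ f lf).
  rewrite mulmx_sum_row {1}[u]row_sum_delta -[f]/(f' : _ -> _) linear_sum.
  by apply: eq_bigr => i _; rewrite linearZ /= rowK.
rewrite -!mxrank_ker; have /mxrank_injP <- : (kermx M1 :&: kermx P)%MS == 0.
  apply/rowV0P => u; rewrite sub_capmx => /andP[/sub_kermxP u1 /sub_kermxP uP].
  by apply: finj; rewrite // fE.
apply: mxrankS; apply/row_subP => i; apply/sub_kermxP; rewrite row_mul -fE f12 //.
by rewrite -row_mul mulmx_ker row0.
Qed.

Lemma toep_kernel n j (A B : 'M[F]_n) X :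
  mxvec X *m toep j A B = 0 <-> X *m A = down_mx F j *m X *m B.
Proof.
rewrite /toep mulmxBr mulmxA !mul_vec_lin /= -linearB /=.
split=> [/eqP|->]; last by rewrite subrr linear0.
by rewrite mxvec_eq0 subr_eq0 => /eqP.
Qed.

Lemma toep0_rank n (A B : 'M[F]_n) : (1 * n - \rank (toep 0 A B) <= n - \rank A)%N.
Proof.
have row1 : down_mx F 0 = 0 by apply/matrixP => i j; rewrite !mxE !ord1.
apply: (@ker_dim_le _ _ _ _ _ _ (fun u : 'rV_(1 * n) => vec_mx u : 'rV_n)).
- by move=> k u v; rewrite linearP.
- by move=> u; rewrite -{1}[u]vec_mxK => /toep_kernel ->; rewrite row1 !mul0mx.
by move=> u _ u0; rewrite -[u]vec_mxK u0 linear0.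
Qed.

Lemma kron_colA p (r : 'I_(p.*2.+1)) : col r (jk_blk true (None, p.+1) : 'M[F]_(p.*2.+1)) =
  if (r < p)%N then - delta_mx (inord (p + r)) 0
  else if (r - p < p)%N then delta_mx (inord (r - p)) 0 else 0.
Proof.
have rp := ltn_ord r; apply/colP => s; have sp := ltn_ord s.
transitivity (skew_entry (fun a c => (a == c)%:R : F) p s r); first by rewrite 2!mxE.
rewrite /skew_entry.
have deltaE q : (q < p.*2.+1)%N -> delta_mx (inord q : 'I_p.*2.+1) (0 : 'I_1) s 0 = (s == q :> nat)%:R :> F.
  by move=> qp; rewrite mxE -val_eqE /= inordK // andbT.
case: (ltnP r p) => r1.
  rewrite andbF [RHS]mxE deltaE; last by clear sp; lia.
  case: (ltnP s p) => s1 /=; last by congr (- (nat_of_bool _)%:R); apply/eqP/eqP; lia.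
  by rewrite (_ : (_ == _) = false) ?oppr0 //; lia.
rewrite andbT andbF; case: (ltnP (r - p) p) => r2.
  rewrite deltaE; last by lia.
  case: (ltnP s p) => s1 //; rewrite (_ : (_ == _) = false) //; lia.
by rewrite mxE; case: (ltnP s p) => s1 //; rewrite (_ : (_ == _) = false) //; lia.
Qed.

Lemma kron_colB p (r : 'I_(p.*2.+1)) : col r (jk_blk false (None, p.+1) : 'M[F]_(p.*2.+1)) =
  if (r < p)%N then - delta_mx (inord (p + r.+1)) 0
  else if (p < r)%N then delta_mx (inord (r - p).-1) 0 else 0.
Proof.
have rp := ltn_ord r; apply/colP => s; have sp := ltn_ord s.
transitivity (skew_entry (fun a c => (a.+1 == c)%:R : F) p s r); first by rewrite 2!mxE.
rewrite /skew_entry.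
have deltaE q : (q < p.*2.+1)%N -> delta_mx (inord q : 'I_p.*2.+1) (0 : 'I_1) s 0 = (s == q :> nat)%:R :> F.
  by move=> qp; rewrite mxE -val_eqE /= inordK // andbT.
case: (ltnP r p) => r1.
  rewrite andbF [RHS]mxE deltaE; last by clear sp; lia.
  case: (ltnP s p) => s1 /=; last by congr (- (nat_of_bool _)%:R); apply/eqP/eqP; lia.
  by rewrite (_ : (_ == _) = false) ?oppr0 //; lia.
rewrite andbT andbF; case: (ltnP p r) => r2.
  rewrite deltaE; last by lia.
  by case: (ltnP s p) => s1; [congr ((nat_of_bool _)%:R); apply/eqP/eqP | rewrite (_ : (_ == _) = false) //]; lia.
by rewrite mxE; case: (ltnP s p) => s1 //; rewrite (_ : (_ == _) = false) //; lia.
Qed.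

Lemma kron_solution p j (G : 'M[F]_j) (X : 'M_(j, p.*2.+1)) :
  X *m (jk_blk true (None, p.+1) : 'M_(p.*2.+1)) = G *m X *m (jk_blk false (None, p.+1) : 'M_(p.*2.+1)) <->
  (forall a, (a < p)%N -> col (inord a) X = 0) /\
  (forall a, (a < p)%N -> col (inord (p + a)) X = G *m col (inord (p + a.+1)) X).
Proof.
have colM (M : 'M_(j, p.*2.+1)) (N : 'M_(p.*2.+1)) r : col r (M *m N) = M *m col r N.
  by rewrite !colE mulmxA.
have col_inord q : (q < p.*2.+1)%N -> exists2 r : 'I_(p.*2.+1), r = q :> nat & r = inord q.
  by move=> qp; exists (inord q); rewrite ?inordK.
have colEq (r : 'I_p.*2.+1) : col r (X *m jk_blk true (None, p.+1)) = if (r < p)%N then - col (inord (p + r)) X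
  else if (r - p < p)%N then col (inord (r - p)) X else 0.
  rewrite colM kron_colA; case: ifP => _; first by rewrite mulmxN -colE.
  by case: ifP => _; rewrite ?mulmx0 -?colE.
have colEqB (r : 'I_p.*2.+1) : col r (G *m X *m jk_blk false (None, p.+1)) = if (r < p)%N then - (G *m col (inord (p + r.+1)) X)
  else if (p < r)%N then G *m col (inord (r - p).-1) X else 0.
  rewrite colM kron_colB; case: ifP => _; first by rewrite mulmxN -mulmxA -colE.
  by case: ifP => _; rewrite ?mulmx0 -?mulmxA -?colE.
split=> [E|[z0 lG]]; last first.
  suff Ec (r : 'I_p.*2.+1) : col r (X *m jk_blk true (None, p.+1)) =
      col r (G *m X *m jk_blk false (None, p.+1)).
    by apply: trmx_inj; apply/row_matrixP => r; rewrite -!tr_col Ec.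
  have rp := ltn_ord r.
  rewrite colEq colEqB; case: (ltnP r p) => r1; first by rewrite lG // addnS.
  case: (ltnP (r - p) p) => r2.
    by case: (ltnP p r) => r3; rewrite z0 // z0 ?mulmx0 //; lia.
  by case: (ltnP p r) => r3 //; rewrite z0 ?mulmx0 //; lia.
have Er q : (q < p.*2.+1)%N -> col (inord q) (X *m jk_blk true (None, p.+1)) =
    col (inord q) (G *m X *m jk_blk false (None, p.+1)) by move=> _; rewrite E.
split; last first.
  move=> a ap; have qp : (a < p.*2.+1)%N by lia.
  by have := Er a qp; rewrite colEq colEqB inordK // ap => /oppr_inj ->; rewrite addnS.
elim=> [|a IH] ap.
  have qp : (p < p.*2.+1)%N by lia.
  by have := Er p qp; rewrite colEq colEqB inordK // ltnn subnn ap.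
have qp : (p + a.+1 < p.*2.+1)%N by lia.
have := Er _ qp; rewrite colEq colEqB inordK // addKn ap ltnNge leq_addr /=.
have -> : (p < p + a.+1)%N by lia.
by rewrite IH ?mulmx0 // ltnW.
Qed.

Lemma down_row j n (X : 'M[F]_(j.+1, n)) i :
  row i (down_mx F j *m X) = if (i : nat) is i'.+1 then row (inord i') X else 0.
Proof.
rewrite row_mul; case: i => [[|i] ip] /=.
  by rewrite [row _ _](_ : _ = 0) ?mul0mx //; apply/rowP => k; rewrite !mxE.
rewrite [RHS]rowE; congr (_ *m _); apply/rowP => k; rewrite !mxE /= eqSS -val_eqE /= inordK 1?eq_sym //.
exact: ltnW.
Qed.

(** The rows are the successive images under [T] of the last one, and the equation for row 0 says
    that [T ^+ j.+1] kills it. *)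
Lemma nilpotent_solution j n (T : 'M[F]_n) (X : 'M_(j.+1, n)) : X *m T = down_mx F j *m X <->
  row ord_max X *m T ^+ j.+1 = 0 /\ forall i : 'I_j.+1, row i X = row ord_max X *m T ^+ (j - i).
Proof.
split=> [E|[E0 E1]].
  have Er i : row i X *m T = if (i : nat) is i'.+1 then row (inord i') X else 0.
    by rewrite -row_mul E down_row.
  have E1 k : (k <= j)%N -> row (inord (j - k)) X = row ord_max X *m T ^+ k.
    elim: k => [_|k IH kj]; first by rewrite subn0 expr0 mulmx1; congr row; apply/val_inj; rewrite /= inordK.
    have := Er (inord (j - k)); rewrite inordK; last by lia.
    have -> : (j - k)%N = (j - k.+1).+1 by lia.
    move=> <-; have -> : (j - k.+1).+1 = (j - k)%N by lia.
    by rewrite IH ?exprSr ?mulmxA // ltnW.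
  split=> [|i].
    by rewrite exprSr mulmxA -E1 // subnn Er inordK.
  by rewrite -E1 ?leq_subr // subKn ?inord_val // -ltnS.
apply/row_matrixP => i; rewrite row_mul down_row E1; have := ltn_ord i; case: i => [[|i] ip] /= _.
  by rewrite subn0 -mulmxA -[_ *m T]/(T ^+ j * T) -exprSr.
rewrite (E1 (inord i)) inordK; last exact: ltnW.
by rewrite -mulmxA -[_ *m T]/(T ^+ _ * T) -exprSr; congr (_ *m _ ^+ _); lia.
Qed.


Section Split.
Variables (p n' : nat) (A B P : 'M[F]_(p.*2.+1 + n')) (A2 B2 : 'M[F]_n') (l : F) (j : nat).
Let A1 : 'M[F]_(p.*2.+1) := jk_blk true (None, p.+1).
Let B1 : 'M[F]_(p.*2.+1) := jk_blk false (None, p.+1).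
Hypotheses (Pu : P \in unitmx) (AE : P *m A *m P^T = block_mx A1 0 0 A2).
Hypotheses (BE : P *m B *m P^T = block_mx B1 0 0 B2) (B2u : B2 \in unitmx).
Let T := pencil_op A2 B2 l.
Let G := l%:M + down_mx F j.

Lemma split_solution (X1 : 'M_(j.+1, p.*2.+1)) (X2 : 'M_(j.+1, n')) :
  mxvec (row_mx X1 X2 *m P) *m toep j (A - l *: B) B = 0 <->
  X1 *m A1 = G *m X1 *m B1 /\ X2 *m T = down_mx F j *m X2.
Proof.
have PtI : injective (mulmx^~ P^T : 'M_(j.+1, p.*2.+1 + n') -> _).
  by apply: row_free_inj; rewrite row_free_unit unitmx_tr.
have E1 : X1 *m (A1 - l *: B1) = down_mx F j *m X1 *m B1 <-> X1 *m A1 = G *m X1 *m B1.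
  rewrite /G mulmxBr -scalemxAr !mulmxDl mul_scalar_mx -scalemxAl.
  by split=> [<-|->]; rewrite addrC ?subrK ?addKr.
have E2 : X2 *m (A2 - l *: B2) = down_mx F j *m X2 *m B2 <-> X2 *m T = down_mx F j *m X2.
  rewrite /T /pencil_op mulmxA; split=> [->|E]; first by rewrite mulmxK.
  by rewrite -E mulmxKV.
rewrite toep_kernel -E1 -E2.
have PE (M : 'M_(p.*2.+1 + n')) M1 M2 (Y1 : 'M_(j.+1, p.*2.+1)) (Y2 : 'M_(j.+1, n')) :
    P *m M *m P^T = block_mx M1 0 0 M2 ->
    row_mx Y1 Y2 *m P *m M *m P^T = row_mx (Y1 *m M1) (Y2 *m M2).
  by move=> ME; rewrite -!mulmxA (mulmxA P) ME mul_row_block !mulmx0 addr0 add0r.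
have CE : P *m (A - l *: B) *m P^T = block_mx (A1 - l *: B1) 0 0 (A2 - l *: B2).
  rewrite mulmxBr mulmxBl -scalemxAr -scalemxAl AE BE scale_block_mx opp_block_mx add_block_mx.
  by rewrite !(scaler0, oppr0, addr0).
split=> [/(congr1 (mulmx^~ P^T)) /=|[e1 e2]].
  by rewrite mulmxA mul_mx_row (PE _ _ _ _ _ CE) (PE _ _ _ _ _ BE) => /eq_row_mx.
by apply: PtI; rewrite /= mulmxA mul_mx_row (PE _ _ _ _ _ CE) (PE _ _ _ _ _ BE) e1 e2.
Qed.

(** A kernel element is given by the last column of its Kronecker part, free in dimension [j.+1],
    and the last row of its other part, in the kernel of [T ^+ j.+1]. *)
Lemma toep_rank :
  (j.+1 * (p.*2.+1 + n') - \rank (toep j (A - l *: B) B) = j.+1 + n' - \rank (T ^+ j.+1))%N.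
Proof.
pose M := col_mx (0 : 'M_(j.+1, n')) (T ^+ j.+1).
have <- : \rank M = \rank (T ^+ j.+1) by rewrite rank_col_0mx.
have ME c (y : 'rV_n') : row_mx c y *m M = y *m T ^+ j.+1.
  by rewrite mul_row_col mulmx0 add0r.
apply/eqP; rewrite eqn_leq; apply/andP; split.
  pose f (u : 'rV[F]_(j.+1 * (p.*2.+1 + n'))) := let Y := vec_mx u *m invmx P in
    row_mx (col (inord (p + p) : 'I_p.*2.+1) (lsubmx Y))^T (row ord_max (rsubmx Y)).
  have uE u : u = mxvec (row_mx (lsubmx (vec_mx u *m invmx P)) (rsubmx (vec_mx u *m invmx P)) *m P).
    by rewrite hsubmxK mulmxKV // vec_mxK.
  apply: (@ker_dim_le _ _ _ _ _ _ f).
  - move=> k u v; rewrite /f linearP /= mulmxDl -scalemxAl !linearP /=.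
    by rewrite scale_row_mx add_row_mx.
  - move=> u; rewrite {1}[u]uE => /split_solution [_ /nilpotent_solution [E _]].
    by rewrite /f ME.
  move=> u; rewrite {1}[u]uE => /split_solution [/kron_solution [z0 lG] /nilpotent_solution [_ E]].
  rewrite /f -row_mx0 => /eq_row_mx [c0 y0].
  rewrite [u]uE; set Y1 := lsubmx _ in z0 lG c0 *; set Y2 := rsubmx _ in E y0 *.
  have -> : Y2 = 0.
    by apply/row_matrixP => i; rewrite E y0 mul0mx row0.
  have lG0 a : (a <= p)%N -> col (inord (p + (p - a)) : 'I_p.*2.+1) Y1 = 0.
    elim: a => [_|a IH ap]; first by apply: trmx_inj; rewrite subn0 c0 trmx0.
    rewrite lG; last by lia.
    have -> : (p - a.+1).+1 = (p - a)%N by lia.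
    by rewrite IH ?mulmx0 // ltnW.
  have -> : Y1 = 0.
    apply: trmx_inj; apply/row_matrixP => r; rewrite -tr_col trmx0 row0.
    apply: trmx_inj; rewrite trmxK trmx0 -[r]inord_val; have rp := ltn_ord r.
    case: (ltnP r p) => pr; first exact: z0.
    have -> : nat_of_ord r = (p + (p - (p.*2 - r)))%N by lia.
    by apply: lG0; lia.
  by rewrite row_mx0 mul0mx linear0.
(* Inverse parametrization: the column of index [p.*2] is [c^T], and each step to the left
   multiplies by [G]. *)
pose X1 (c : 'rV[F]_j.+1) := \matrix_(i < j.+1, s < p.*2.+1)
  (if (s < p)%N then 0 else (G ^+ (p.*2 - s) *m c^T) i 0).
pose X2 (y : 'rV[F]_n') := \matrix_(i < j.+1) (y *m T ^+ (j - i)).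
have X2last y : row ord_max (X2 y) = y by rewrite rowK subnn expr0 mulmx1.
have X1last c : col (inord (p + p)) (X1 c) = c^T.
  by apply/colP => i; rewrite mxE mxE inordK addnn // ltnNge -addnn leq_addr subnn expr0 mul1mx.
have X1col c s : (p <= s <= p.*2)%N -> col (inord s) (X1 c) = G ^+ (p.*2 - s) *m c^T.
  move=> /andP[s1 s2]; by apply/colP => i; rewrite 2![LHS]mxE inordK // ltnNge s1.
pose f (v : 'rV_(j.+1 + n')) := mxvec (row_mx (X1 (lsubmx v)) (X2 (rsubmx v)) *m P).
apply: (@ker_dim_le _ _ _ _ _ _ f).
- move=> k u v; rewrite /f -linearP /= scalemxAl -mulmxDl scale_row_mx add_row_mx.
  congr (mxvec (row_mx _ _ *m P)).
    apply/matrixP => i s; rewrite [LHS]mxE [RHS]mxE [X in _ = X + _]mxE [X in _ = _ * X + _]mxE [X in _ = _ + X]mxE.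
    case: ifP => _; first by rewrite mulr0 addr0.
    by rewrite linearP /= linearP /= mulmxDr -scalemxAr mxE [X in X + _]mxE.
  apply/row_matrixP => i; rewrite [in RHS]linearP /= !rowK linearP /= mulmxDl -scalemxAl //.
- move=> v; rewrite -{1}[v]hsubmxK ME => vT; apply: (proj2 (split_solution _ _)); split.
    apply: (proj2 (kron_solution _ _)); split=> a ap.
      by apply/colP => i; rewrite mxE mxE inordK ?ap ?mxE //; lia.
    rewrite !X1col; [|lia..]; rewrite mulmxA -[G *m _]/(G * _) -exprS.
    by congr (_ ^+ _ *m _); lia.
  by apply/nilpotent_solution; rewrite X2last; split=> // i; rewrite rowK.
move=> v _; rewrite /f => /eqP; rewrite mxvec_eq0 => /eqP v0.
have : row_mx (X1 (lsubmx v)) (X2 (rsubmx v)) = 0.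
  by rewrite -[LHS](mulmxK Pu) v0 mul0mx.
rewrite -row_mx0 => /eq_row_mx [E1 E2]; rewrite -[v]hsubmxK -(X2last (rsubmx v)) E2 row0.
have := X1last (lsubmx v); rewrite E1 => /(congr1 trmx); rewrite trmxK => <-.
by rewrite -row_mx0; congr row_mx; apply/rowP => i; rewrite !mxE.
Qed.

End Split.

End ToeplitzRank.

(** * Block sizes from truncated sums *)

Section Sizes.
Variable F : fieldType.
Implicit Types (bs : seq (jkblock F)) (l : F).

Definition jordan_sizes l bs := [seq b.2 | b <- bs & b.1 == Some (Some l)].

Lemma sum_height l j bs :
  (\sum_(b <- bs) jk_height l j b)%N = (\sum_(m <- jordan_sizes l bs) minn m j)%N.*2.
Proof.
elim: bs => [|b bs IH]; first by rewrite !big_nil.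
rewrite big_cons IH /jordan_sizes /= /jk_height; case: ifP => _; last by [].
by rewrite /= big_cons doubleD.
Qed.

(** As a function of x, min(m, x) is piecewise linear with its only kink at m, so the second
    difference of the sum counts the entries equal to x. *)
Lemma count_minn x (s : seq nat) : (0 < x)%N ->
  (\sum_(m <- s) minn m x + \sum_(m <- s) minn m x =
   count_mem x s + \sum_(m <- s) minn m x.-1 + \sum_(m <- s) minn m x.+1)%N.
Proof.
move=> x0; elim: s => [|m s]; rewrite ?big_nil // !big_cons /=.
have : (minn m x + minn m x = (m == x) + minn m x.-1 + minn m x.+1)%N.
  by case: ltngtP; lia.
move: (minn m x) (minn m x.-1) (minn m x.+1) (nat_of_bool _) => a b c d.
lia.
Qed.

(** Second differences give all multiplicities, and past the bound [N] the sums are constant. *)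
Lemma perm_sizes N (s t : seq nat) :
  all (fun m => 0 < m <= N)%N s -> all (fun m => 0 < m <= N)%N t ->
  (forall j, (0 < j <= N)%N -> \sum_(m <- s) minn m j = \sum_(m <- t) minn m j)%N -> perm_eq s t.
Proof.
move=> sN tN st; have {}st j : (\sum_(m <- s) minn m j = \sum_(m <- t) minn m j)%N.
  case: j => [|j]; first by rewrite !big1 // => m _; rewrite minn0.
  have [jN|Nj] := leqP j.+1 N; first exact: st.
  have E u : all (fun m => 0 < m <= N)%N u -> (\sum_(m <- u) minn m j.+1 = \sum_(m <- u) minn m N)%N.
    move=> /allP uN; apply: eq_big_seq => m /uN /andP[_ mN].
    by rewrite !(minn_idPl _) // (leq_trans mN) // ltnW.
  rewrite !E //; case: (posnP N) => [->|N0]; first by rewrite !big1 // => m _; rewrite minn0.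
  by apply: st; rewrite N0 /=.
apply/allP => x _; apply/eqP; case: (posnP x) => [->|x0].
  have c0 u : all (fun m => 0 < m <= N)%N u -> count_mem 0%N u = 0%N.
    by move=> /allP uN; apply/count_memPn/negP => /uN.
  by rewrite !c0.
have := count_minn s x0; rewrite !st (count_minn t x0) => /eqP.
by rewrite !eqn_add2r => /eqP.
Qed.

Lemma perm_blocks bs (s : seq F) ns : uniq s ->
  (forall b, b \in bs -> exists2 l, l \in s & b.1 = Some (Some l)) ->
  (forall l, l \in s -> perm_eq (jordan_sizes l bs) ns) ->
  perm_eq bs (flatten [seq [seq (Some mu, m) : jkblock F | m <- ns] | mu <- map Some s]).
Proof.
elim: s bs => [|l s IH] bs /=.
  by case: bs => // b bs _ /(_ b (mem_head _ _)) [].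
move=> /andP[ls us] bsl sz.
rewrite -(perm_filterC (fun b => b.1 == Some (Some l)) bs) perm_cat //.
  have -> : [seq b <- bs | b.1 == Some (Some l)] = [seq (Some (Some l), m) : jkblock F | m <- jordan_sizes l bs].
    rewrite /jordan_sizes -map_comp -[LHS]map_id; apply/eq_in_map => -[t m].
    by rewrite mem_filter /= => /andP[/eqP ->].
  by apply: perm_map; apply: sz; rewrite mem_head.
apply: IH => // [b|l' l's].
  rewrite mem_filter /= => /andP[bl /bsl [l']]; rewrite inE => /orP[/eqP-> E|l's E].
    by rewrite E eqxx in bl.
  by exists l'.
rewrite (perm_trans _ (sz l' _)) //; last by rewrite inE l's orbT.
rewrite /jordan_sizes -filter_predI (eq_filter (a2 := fun b => b.1 == Some (Some l'))) // => b /=.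
case: eqP => //= ->; apply/eqP => -[E]; by rewrite -E l's in ls.
Qed.

End Sizes.

(** Joins the Kronecker splitting to the Jordan form of the complement. The Toeplitz coranks involve
    the pencil alone, so they determine the Jordan sizes whatever complement was chosen. *)
Lemma pencil_type (F : numClosedFieldType) n p (A B : 'M[F]_n) (v : nat -> 'rV[F]_n) (chi : {poly F}) :
  A^T = - A -> B^T = - B ->
  v 0%N *m A = 0 -> (forall i, v i.+1 *m A = v i *m B) -> (forall i, (p < i)%N -> v i = 0) ->
  v p != 0 -> chi != 0 -> (forall mu, chi.[mu] != 0 -> (n.-1 <= \rank (A - mu *: B)%R)%N) ->
  (forall mu, vat p v mu != 0) -> (n.-1 <= \rank B)%N ->
  exists bs : seq (jkblock F), [/\ jk_decomp A B ((None, p.+1) :: bs),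
    forall b, b \in bs -> exists l, b.1 = Some (Some l) &
    forall l j, (j.+1 * n - \rank (toep j (A - l *: B) B) =
      j.+1 + \sum_(b <- bs) jk_height l j.+1 b)%N].
Proof.
move=> skA skB v0A vAB vout vp chi0 rk v0 rB.
have [n' [W1 [W2 [nE Wfree [A1 B1] [A12 B12] B2u]]]] :=
  kronecker_split skA skB v0A vAB vout vp chi0 rk v0.
have {}B2u := B2u rB.
have [bs [bsl dec]] := skew_jordan B2u (skew_congr W2 skA) (skew_congr W2 skB).
exists bs; split=> [||l j].
- exact: (@jk_decomp_cons _ (None, p.+1) bs n n' A B W1 W2).
- exact: bsl.
have := rank_jk_decomp l j.+1 B2u dec bsl.
move=> rkE.
case: n / nE A B W1 W2 skA skB {v0A vAB vout vp rk v0 rB v} Wfree A1 B1 A12 B12 B2u {dec} rkE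
  => A' B' W1 W2 skA skB Wfree A1 B1 A12 B12 B2u rkE.
have blk (M : 'M_(p.*2.+1 + n')) K : M^T = - M -> W1 *m M *m W1^T = K -> W1 *m M *m W2^T = 0 ->
    col_mx W1 W2 *m M *m (col_mx W1 W2)^T = block_mx K 0 0 (W2 *m M *m W2^T).
  move=> skM M11 M12; rewrite tr_col_mx mul_col_mx mul_col_row M11 M12.
  by rewrite (skew_comm0 skM M12).
have Pu : col_mx W1 W2 \in unitmx by rewrite -row_free_unit.
rewrite (toep_rank l j Pu (blk A' _ skA A1 A12) (blk B' _ skB B1 B12) B2u).
by move: rkE; rewrite [\rank (_ ^+ _)]lock; move: (locked _) (\sum_(b <- bs) _)%N => r t <-; rewrite addnCA addKn.
Qed.

(** * Constancy of ranks at the roots of f on generic lines *)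

Lemma max_attained (T : Type) (P : T -> Prop) (r : T -> nat) N : (exists t, P t) ->
  (forall t, P t -> (r t <= N)%N) -> exists2 t, P t & forall u, P u -> (r u <= r t)%N.
Proof.
move=> [t0 Pt0] rN; have [k kE] := ubnP (N - r t0)%N.
elim: k t0 Pt0 kE => // k IH t Pt kE.
case: (classic (exists2 u, P u & (r t < r u)%N)) => [[u Pu tu]|H].
  by apply: (IH u Pu); have := rN _ Pu; lia.
exists t => // u Pu; rewrite leqNgt; apply/negP => tu; apply: H; by exists u.
Qed.

Section Minors.
Variable F : fieldType.

Lemma mxsub_rank m n r (A : 'M[F]_(m, n)) (f : 'I_r -> 'I_m) (g : 'I_r -> 'I_n) :
  \det (mxsub f g A) != 0 -> (r <= \rank A)%N.
Proof.
move=> d0; have : mxsub f g A \in unitmx by rewrite unitmxE unitfE.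
move/mxrank_unit => <-.
rewrite -[A in mxsub _ _ A]mulmx1 mxsub_mul rowsubE.
exact: leq_trans (mxrankM_maxl _ _) (mxrankM_maxr _ _).
Qed.

Lemma rank_mxsub m n (A : 'M[F]_(m, n)) : exists (f : 'I_(\rank A) -> 'I_m) (g : 'I_(\rank A) -> 'I_n),
  \det (mxsub f g A) != 0.
Proof.
have full : row_full (rowsub (maxrankfun A) A)^T.
  by rewrite /row_full mxrank_tr; exact: maxrowsub_free.
exists (maxrankfun A), (fullrankfun full).
have := fullrowsub_unit full; rewrite unitmxE unitfE -det_tr.
by congr (\det _ != 0); apply/matrixP => i j; rewrite !mxE.
Qed.

End Minors.


Section RankConstancy.
Variables (F : numClosedFieldType) (n : nat) (f : {mpoly F[n]}).
Hypothesis fP : prime_elt f.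

(** Divisibility by f would make h(., b) vanish at the zero [y] of f. One nonvanishing on f = 0 thus
    supplies the hypotheses of [generic_line]. *)
Lemma prime_not_rdvd (h : {mpoly F[n + n]}) y a : f.@[y] = 0 -> h.@[join_pt y a] != 0 ->
  spec_x y h != 0 /\ forall b, (spec_x y h).@[b] != 0 -> ~ rdvd f (spec_a b h).
Proof.
move=> fy hy; split=> [|b].
  by apply: contraNneq hy => E; rewrite -spec_xE E rmorph0.
by rewrite spec_xE => hb [q qE]; case/eqP: hb; rewrite -spec_aE qE rmorphM /= fy mulr0.
Qed.

(** A minor realizing the maximal rank over f = 0 is nonzero at all the roots on a generic line, and
    maximality bounds the rank there from above. *)
Lemma rank_constancy m1 m2 (M : 'M[{mpoly F[n + n]}]_(m1, m2)) y0 : f.@[y0] = 0 ->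
  exists rho, exists2 H : {mpoly F[n + n]}, H != 0 &
    forall x a, H.@[join_pt x a] != 0 -> forall l, f.@[line x a l] = 0 ->
      \rank (map_mx (meval (join_pt (line x a l) a)) M) = rho.
Proof.
move=> fy0; pose rk (z : ('I_n -> F) * ('I_n -> F)) := \rank (map_mx (meval (join_pt z.1 z.2)) M).
have [[y b] /= fy rmax] : exists2 z, f.@[z.1] = 0 & forall u, f.@[u.1] = 0 -> (rk u <= rk z)%N.
  by apply: (max_attained (N := m1)) => [|z _]; [exists (y0, y0) | apply: rank_leq_row].
have [u [v duv]] := rank_mxsub (map_mx (meval (join_pt y b)) M).
have hE z : \det (mxsub u v (map_mx (meval z) M)) = (\det (mxsub u v M)).@[z].
  by rewrite -map_mxsub det_map_mx.
rewrite hE in duv; have [g0 gP] := prime_not_rdvd fy duv.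
have [H H0 HP] := generic_line fP g0 gP.
exists (rk (y, b)), H => // x a Hxa l fl; apply/eqP; rewrite eqn_leq.
rewrite -[X in (X <= _)%N]/(rk (line x a l, a)) rmax //=.
by apply: (mxsub_rank (f := u) (g := v)); rewrite hE HP.
Qed.

End RankConstancy.

(** * Restriction to a line: degrees and derivatives *)

Definition rename (F : comNzRingType) n k (u : 'I_n -> 'I_k) : {mpoly F[n]} -> {mpoly F[k]} :=
  mmap (@mpolyC k F) (fun i => 'X_(u i)).
HB.instance Definition _ (F : comNzRingType) n k (u : 'I_n -> 'I_k) := GRing.RMorphism.on (@rename F n k u).

Lemma meval_rename (F : comNzRingType) n k (u : 'I_n -> 'I_k) (q : {mpoly F[n]}) z :
  (rename u q).@[z] = q.@[fun i => z (u i)].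
Proof.
move: q; apply: (@mpoly_rmorph_eq _ _ _ (meval z \o rename u)
  (meval (fun i => z (u i)))) => [c|i] /=.
- by rewrite /rename mmapC !mevalC.
- by rewrite /rename mmapX mmap1U !mevalXU.
Qed.

Section TopCoefficient.
Variable R : comNzRingType.

(** Here [a] may be zero: [d] only bounds the degree, which makes the notion stable under sums and
    products. *)
Definition top_coef d (P : {poly R}) a := (size P <= d.+1)%N /\ P`_d = a.

Lemma top_coefM d1 d2 P Q a b : top_coef d1 P a -> top_coef d2 Q b -> top_coef (d1 + d2) (P * Q) (a * b).
Proof.
move=> [sP <-] [sQ <-]; split.
  apply: leq_trans (size_polyMleq _ _) _.
  by move: sP sQ; move: (size P) (size Q) => x y; lia.
have ltd : (d1 < (d1 + d2).+1)%N by rewrite ltnS leq_addr.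
rewrite coefM (bigD1 (Ordinal ltd)) //= addKn big1 ?addr0 // => i; rewrite -val_eqE /= neq_ltn.
case/orP=> id; last by rewrite nth_default ?mul0r // (leq_trans sP).
by rewrite [Q`__]nth_default ?mulr0 // (leq_trans sQ) //; lia.
Qed.

Lemma top_coef1 : top_coef 0 1 1.
Proof. by split; [rewrite size_poly1 | rewrite coef1]. Qed.

Lemma top_coefX d P a k : top_coef d P a -> top_coef (d * k) (P ^+ k) (a ^+ k).
Proof.
move=> Pa; elim: k => [|k IH]; first by rewrite muln0 !expr0; exact: top_coef1.
by rewrite mulnS !exprS; apply: top_coefM.
Qed.

Lemma top_coef_sum (I : eqType) (r : seq I) d (P : I -> {poly R}) a :
  (forall i, i \in r -> top_coef d (P i) (a i)) -> top_coef d (\sum_(i <- r) P i) (\sum_(i <- r) a i).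
Proof.
elim: r => [|i r IH] H; first by rewrite !big_nil /top_coef size_poly0 coef0.
have [s1 e1] := H i (mem_head _ _); have [|s2 e2] := IH.
  by move=> j jr; apply: H; rewrite inE jr orbT.
rewrite !big_cons; split; last by rewrite coefD e1 e2.
by rewrite (leq_trans (size_polyD _ _)) // geq_max s1 s2.
Qed.

End TopCoefficient.

Section LineCalculus.
Variables (F : numClosedFieldType) (n : nat).
Implicit Types (q : {mpoly F[n]}) (x a : 'I_n -> F).

(** The top coefficient sees only the direction [a] of the line, so f(a) <> 0 fixes the number of
    roots on it. *)
Lemma line_top_coef q d x a : q \is d.-homog ->
  top_coef d (ev x a (line_poly q)) ((-1) ^+ d * q.@[a]).
Proof.
move=> qd; pose L i := (x i)%:P - 'X * (a i)%:P.
have Lt i : top_coef 1 (L i) (- a i).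
  split; last by rewrite coefB coefC coefXM coefC /= sub0r.
  rewrite (leq_trans (size_polyD _ _)) // geq_max size_polyN mulrC mul_polyC.
  by rewrite (leq_trans (size_scale_leq _ _)) ?size_polyX // (leq_trans (size_polyC_leq1 _)).
have -> : ev x a (line_poly q) = \sum_(m <- msupp q) (q@_m)%:P * \prod_i L i ^+ m i.
  apply: poly_eq_eval => l; rewrite ev_line_poly mevalE horner_sum; apply: eq_bigr => m _.
  rewrite hornerM hornerC horner_prod; congr (_ * _); apply: eq_bigr => i _.
  by rewrite horner_exp !hornerE.
rewrite mevalE mulr_sumr; apply: top_coef_sum => m mq.
rewrite mulrCA -[d]add0n; apply: top_coefM.
  by split; rewrite ?size_polyC_leq1 // coefC.
have <- : mdeg m = d by exact: (dhomog_mf qd mq).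
have -> : (-1) ^+ mdeg m * \prod_i a i ^+ m i = \prod_i (- a i) ^+ m i.
  rewrite mdegE -prodrXr -big_split /=; apply: eq_bigr => i _.
  by rewrite -exprMn mulN1r.
rewrite mdegE; elim/big_rec3: _ => [|i k1 k2 k3 _ IH]; first exact: top_coef1.
by apply: top_coefM => //; have := top_coefX (m i) (Lt i); rewrite mul1n.
Qed.

Lemma deriv_affine (E : {rmorphism {mpoly F[n]} -> {poly F}}) x a :
  (forall c, E c%:MP = c%:P) -> (forall i, E 'X_i = (x i)%:P - 'X * (a i)%:P) ->
  forall q, (E q)^`() = - \sum_i a i *: E (mderiv i q).
Proof.
move=> EC EX.
have PD q1 q2 : (E q1)^`() = - \sum_i a i *: E (mderiv i q1) ->
    (E q2)^`() = - \sum_i a i *: E (mderiv i q2) ->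
    (E (q1 + q2))^`() = - \sum_i a i *: E (mderiv i (q1 + q2)).
  rewrite rmorphD derivD => -> ->; rewrite -opprD -big_split; congr (- _).
  by apply: eq_bigr => i _; rewrite mderivD rmorphD scalerDr.
have PM q1 q2 : (E q1)^`() = - \sum_i a i *: E (mderiv i q1) ->
    (E q2)^`() = - \sum_i a i *: E (mderiv i q2) ->
    (E (q1 * q2))^`() = - \sum_i a i *: E (mderiv i (q1 * q2)).
  rewrite rmorphM derivM => -> ->; rewrite mulNr mulrN -opprD; congr (- _).
  rewrite mulr_suml mulr_sumr -big_split; apply: eq_bigr => i _.
  by rewrite mderivM rmorphD !rmorphM scalerDr scalerAl scalerAr.
have PC c : (E c%:MP)^`() = - \sum_i a i *: E (mderiv i c%:MP).
  rewrite EC derivC big1 ?oppr0 // => i _.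
  by rewrite mderivC rmorph0 scaler0.
have PX i : (E 'X_i)^`() = - \sum_k a k *: E (mderiv k 'X_i).
  rewrite EX derivB derivM derivX !derivC mulr0 addr0 mul1r sub0r; congr (- _).
  rewrite (bigD1 i) //= big1 ?addr0 => [|k ki]; last by rewrite mderiv_X (negPf ki) rmorph0 scaler0.
  by rewrite mderiv_X eqxx rmorph1 -mul_polyC mulr1.
have P1 : (E 1)^`() = - \sum_k a k *: E (mderiv k 1) by rewrite -mpolyC1.
have PXn i k : (E ('X_i ^+ k))^`() = - \sum_j a j *: E (mderiv j ('X_i ^+ k)).
  by elim: k => [|k IH]; [rewrite expr0 | rewrite exprS; apply: PM].
move=> q; rewrite (mpolyE q); elim/big_rec: _ => [|m q' _ IH]; first by rewrite -mpolyC0.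
apply: (PD _ _ _ IH); rewrite -mul_mpolyC; apply: (PM _ _ (PC _)).
rewrite mpolyXE_id; elim/big_rec: _ => // i q'' _.
by move=> IHq; apply: (PM _ _ (PXn _ _) IHq).
Qed.

Lemma deriv_line x a q :
  (ev x a (line_poly q))^`() = - \sum_i a i *: ev x a (line_poly (mderiv i q)).
Proof.
apply: (@deriv_affine (map_poly (meval (join_pt x a)) \o @line_poly F n) x a) => [c|i] /=.
  by apply: poly_eq_eval => l; rewrite -/(ev x a _) ev_line_poly mevalC hornerC.
by apply: poly_eq_eval => l; rewrite -/(ev x a _) ev_line_poly mevalXU !hornerE.
Qed.

Lemma simple_roots_uniq (s : seq F) : (forall y, y \in s -> (\prod_(z <- s) ('X - z%:P))^`().[y] != 0) -> uniq s.
Proof.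
elim: s => //= z s IH H; set Q := \prod_(y <- s) ('X - y%:P) in IH.
have HE y : y \in z :: s -> Q.[y] + (y - z) * Q^`().[y] != 0.
  by move/H; rewrite big_cons derivM derivXsubC mul1r hornerD hornerM hornerXsubC.
apply/andP; split.
  apply/negP => zs; have := HE z (mem_head _ _); rewrite subrr mul0r addr0.
  by rewrite -[_ == 0]/(root _ _) root_prod_XsubC zs.
apply: IH => y ys; have := HE y; rewrite inE ys orbT => /(_ isT).
have /rootP -> : root Q y by rewrite root_prod_XsubC.
by rewrite add0r mulf_eq0 negb_or => /andP[].
Qed.

End LineCalculus.

(** * Jordan-Kronecker invariants *)

Section GoodPoints.
Variables (F : numClosedFieldType) (n : nat) (c : 'I_n -> 'I_n -> 'I_n -> F).
Hypothesis skc : forall i j k, c i j k = - c j i k.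
Variables (w : 'I_n -> {mpoly F[n]}) (e : nat).
Hypothesis whom : forall i, w i \is e.-homog.
Hypothesis wker : forall i, \sum_j poissonMx c i j * w j = 0.
Local Notation f := (radial w).
Hypothesis fP : prime_elt f.
Hypothesis grad : forall j, mderiv j f = e.+1%:R *: w j.
Hypothesis frank : forall y, f.@[y] != 0 -> (n.-1 <= \rank (evalMx c y))%N.

Lemma evalMxE y : evalMx c y = map_mx (meval y) (poissonMx c).
Proof.
apply/matrixP => i j; rewrite !mxE raddf_sum; apply: eq_bigr => k _.
by rewrite /= mevalZ mevalXU.
Qed.

Lemma evalMx_skew y : (evalMx c y)^T = - evalMx c y.
Proof.
apply/matrixP => i j; rewrite !mxE -sumrN; apply: eq_bigr => k _.
by rewrite skc mulNr.
Qed.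

Lemma evalMx_line x a l : evalMx c (line x a l) = evalMx c x - l *: evalMx c a.
Proof.
apply/matrixP => i j; rewrite !mxE mulr_sumr -sumrB; apply: eq_bigr => k _.
by rewrite /line mulrBr mulrCA.
Qed.

Lemma radial_eval y : f.@[y] = \sum_j y j * (w j).@[y].
Proof. by rewrite raddf_sum; apply: eq_bigr => j _; rewrite /= mevalM mevalXU. Qed.

Lemma kernel_eval y i : \sum_j (w j).@[y] * evalMx c y j i = 0.
Proof.
have /(congr1 (meval y)) := wker i; rewrite rmorph0 raddf_sum => E.
rewrite -[RHS]oppr0 -[in RHS]E -sumrN; apply: eq_bigr => j _.
rewrite /= mevalM evalMxE mxE [poissonMx c j i](_ : _ = - poissonMx c i j) ?rmorphN ?mulrN 1?mulrC //.
by rewrite !mxE -sumrN; apply: eq_bigr => k _; rewrite skc scaleNr.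
Qed.

(** Up to sign and the factor [e.+1], the sum is the derivative of f along the line. *)
Definition simple_at x a := forall l, f.@[line x a l] = 0 -> \sum_i a i * (w i).@[line x a l] != 0.

(** For fixed [a] the sum of the [a i * w i] has degree [e] when it is nonzero, below that of f, so
    f cannot divide it. *)
Lemma generic_simple : exists2 H : {mpoly F[n + n]}, H != 0 &
  forall x a, H.@[join_pt x a] != 0 -> simple_at x a.
Proof.
pose h : {mpoly F[n + n]} := \sum_i 'X_(rshift n i) * rename (@lshift n n) (w i).
have hE y a : h.@[join_pt y a] = \sum_i a i * (w i).@[y].
  rewrite raddf_sum; apply: eq_bigr => i _; rewrite /= mevalM mevalXU join_ptr meval_rename.
  by congr (_ * _); apply: meval_eq => k; rewrite join_ptl.
have [f0 _ _] := fP.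
have [i0 wi0] : exists i, w i != 0.
  apply: NNPP => H; case/eqP: f0; rewrite /radial big1 // => i _.
  have [->|wi] := eqVneq (w i) 0; first by rewrite mulr0.
  by case: H; exists i.
have [y0 wy0] := mpoly_nonroot wi0.
pose g : {mpoly F[n]} := \sum_i ((w i).@[y0])%:MP * 'X_i.
have gE a : g.@[a] = \sum_i a i * (w i).@[y0].
  by rewrite raddf_sum; apply: eq_bigr => i _; rewrite /= mevalM mevalXU mevalC mulrC.
have g0 : g != 0.
  apply: contraNneq wy0 => g0; have := gE (fun i => (i == i0)%:R).
  rewrite g0 rmorph0 (bigD1 i0) //= eqxx mul1r big1 ?addr0 => [<-|i ii0] //.
  by rewrite (negPf ii0) mul0r.
have gP a : g.@[a] != 0 -> ~ rdvd f (spec_a a h).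
  move=> ga [q qE].
  have S0 : spec_a a h != 0.
    by apply: contraNneq ga => S0; rewrite gE -hE -spec_aE S0 rmorph0.
  have SE : spec_a a h = \sum_i (a i)%:MP * w i.
    apply: mpoly_eqP_eval => y; rewrite spec_aE hE raddf_sum; apply: eq_bigr => i _.
    by rewrite /= mevalM mevalC.
  have Sh : spec_a a h \is e.-homog.
    by rewrite SE; apply: rpred_sum => i _; rewrite mul_mpolyC; apply: rpredZ.
  have le1 : (msize f <= msize (spec_a a h))%N by rewrite qE msize_divisor // -qE.
  have fE : (msize f).-1 = e.+1 := homog_mdegree f0 (radial_homog whom).
  move: (leq_trans le1 (msize_homog Sh)) fE; case: (msize f) => //= u.
  by rewrite ltnS => ue uE; rewrite uE ltnn in ue.
have [H H0 HP] := generic_line fP g0 gP.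
by exists H => // x a Hxa l fl; rewrite -hE; apply: HP.
Qed.

(** Jordan sizes are at most [n], so finitely many [j] suffice and their open conditions can be
    multiplied together. *)
Lemma generic_toep_rank : exists rho : 'I_n -> nat, exists2 H : {mpoly F[n + n]}, H != 0 &
  forall x a, H.@[join_pt x a] != 0 -> forall l, f.@[line x a l] = 0 ->
  forall j : 'I_n, \rank (toep j (evalMx c (line x a l)) (evalMx c a)) = rho j.
Proof.
pose M (j : nat) := toep j (map_mx (rename (@lshift n n)) (poissonMx c)) (map_mx (rename (@rshift n n)) (poissonMx c)).
have ME j y a : map_mx (meval (join_pt y a)) (M j) = toep j (evalMx c y) (evalMx c a).
  rewrite map_toep -!map_mx_comp !evalMxE; congr toep; apply/matrixP => i k; rewrite !mxE /=.
    by rewrite meval_rename; apply: meval_eq => t; rewrite join_ptl.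
  by rewrite meval_rename; apply: meval_eq => t; rewrite join_ptr.
(* The zero set of f has to be nonempty for the maximal rank on it to make sense. *)
have f00 : f.@[fun=> 0] = 0 by rewrite radial_eval big1 // => j _; rewrite mul0r.
have /fin_all_exists [rho /fin_all_exists2 [H H0 HP]] :
    forall j : 'I_n, exists rho, exists2 H : {mpoly F[n + n]}, H != 0 &
    forall x a, H.@[join_pt x a] != 0 -> forall l, f.@[line x a l] = 0 ->
      \rank (map_mx (meval (join_pt (line x a l) a)) (M j)) = rho.
  by move=> j; apply: (rank_constancy fP (M j) f00).
exists rho, (\prod_j H j); first by apply/prodf_neq0.
move=> x a; rewrite rmorph_prod => /prodf_neq0 Hxa l fl j.
by rewrite -ME; apply: HP => //; apply: Hxa.
Qed.

(** The coefficients in l of w(x - l a) form a chain for the pencil. The vector has no zero on the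
    line: it would be a zero of f, where [simple_at] forbids w to vanish. *)
Lemma good_point x a : f.@[a] != 0 -> simple_at x a ->
  exists (s : seq F) (bs : seq (jkblock F)), [/\ uniq s, size s = e.+1,
    forall l, l \in s -> f.@[line x a l] = 0,
    jk_decomp (evalMx c x) (evalMx c a) ((None, e.+1) :: bs) &
    (forall b, b \in bs -> exists2 l, l \in s & b.1 = Some (Some l)) /\
    forall l j, (j.+1 * n - \rank (toep j (evalMx c (line x a l)) (evalMx c a)) =
      j.+1 + \sum_(b <- bs) jk_height l j.+1 b)%N].
Proof.
move=> fa smp; pose W i := ev x a (line_poly (w i)); pose P := ev x a (line_poly f).
have Wt i : top_coef e (W i) ((-1) ^+ e * (w i).@[a]) by apply: line_top_coef.
have [sP Ptop] : top_coef e.+1 P ((-1) ^+ e.+1 * f.@[a]).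
  by apply: line_top_coef; apply: radial_homog.
have Ptop0 : P`_e.+1 != 0 by rewrite Ptop mulf_neq0 ?signr_eq0.
have szP : size P = e.+2.
  by apply/eqP; rewrite eqn_leq sP /= ltnNge; apply: contra Ptop0 => s; rewrite nth_default.
have P0 : P != 0 by rewrite -size_poly_gt0 szP.
have [s sE] := closed_field_poly_normal P.
have lP0 : lead_coef P != 0 by rewrite lead_coef_eq0.
have ss : size s = e.+1.
  by move: szP; rewrite {1}sE size_scale // size_prod_XsubC => -[].
have sP0 l : (l \in s) = (f.@[line x a l] == 0).
  by rewrite -root_prod_XsubC -(rootZ _ _ lP0) -sE /root ev_line_poly.
have dP l : P^`().[l] = - (e.+1%:R * \sum_i a i * (w i).@[line x a l]).
  rewrite deriv_line hornerN horner_sum mulr_sumr; congr (- _); apply: eq_bigr => i _.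
  by rewrite hornerZ ev_line_poly grad mevalZ mulrCA.
have us : uniq s.
  apply: simple_roots_uniq => y ys.
  have : P^`().[y] != 0.
    rewrite dP oppr_eq0 mulf_neq0 ?pnatr_eq0 //; apply: smp.
    by apply/eqP; rewrite -sP0.
  by rewrite sE derivZ hornerZ mulf_eq0 negb_or => /andP[].
pose v k := \row_i (W i)`_k.
have vatW mu : vat e v mu = \row_i (w i).@[line x a mu].
  apply/rowP => i; rewrite !mxE -ev_line_poly -/(W i); have [sW _] := Wt i.
  rewrite (horner_coef_wide _ sW) horner_poly; apply: eq_bigr => k _.
  by rewrite mxE.
have vAB : forall k, v k *m evalMx c x = if k is k'.+1 then v k' *m evalMx c a else 0.
  move=> k; apply/rowP => i.
  have E : \sum_j W j * ((evalMx c x j i)%:P - 'X * (evalMx c a j i)%:P) = 0.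
    apply: poly_eq_eval => l; rewrite horner0 horner_sum -[RHS](kernel_eval (line x a l) i).
    apply: eq_bigr => j _; rewrite hornerM ev_line_poly; congr (_ * _).
    by rewrite evalMx_line !hornerE !mxE.
  have := congr1 (fun q : {poly F} => q`_k) E; rewrite coef0 coef_sum /=.
  under eq_bigr => j _ do rewrite mulrBr coefB coefMC mulrCA coefXM coefMC.
  rewrite sumrB => /eqP; rewrite subr_eq0 => /eqP Ek.
  rewrite [LHS]mxE; under eq_bigr => j _ do rewrite mxE.
  rewrite Ek; case: k {Ek} => [|k]; first by rewrite mxE big1.
  by rewrite /= [RHS]mxE; apply: eq_bigr => j _; rewrite [in RHS]mxE.
have w0 y : f.@[y] != 0 -> exists i, (w i).@[y] != 0.
  move=> fy; apply: NNPP => H; case/eqP: fy; rewrite radial_eval big1 // => i _.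
  have [->|wi] := eqVneq (w i).@[y] 0; first by rewrite mulr0.
  by case: H; exists i.
have [||||||||bs [dec bsl bsr]] := @pencil_type F n e (evalMx c x) (evalMx c a) v P
   (evalMx_skew x) (evalMx_skew a).
- exact: vAB.
- by move=> i; apply: vAB.
- move=> i ei; apply/rowP => k; rewrite !mxE nth_default //; have [sW _] := Wt k.
  exact: leq_trans sW ei.
- have [i wi] := w0 _ fa; apply: contraNneq wi => /rowP/(_ i); rewrite !mxE; have [_ ->] := Wt i.
  by move/eqP; rewrite mulf_eq0 signr_eq0.
- exact: P0.
- by move=> mu; rewrite ev_line_poly => /frank; rewrite evalMx_line.
- move=> mu; rewrite vatW; apply/eqP => v0.
  have w0' i : (w i).@[line x a mu] = 0 by have /rowP/(_ i) := v0; rewrite !mxE.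
  have fl : f.@[line x a mu] = 0 by rewrite radial_eval big1 // => i _; rewrite w0' mulr0.
  by have /eqP := smp mu fl; apply; rewrite big1 // => i _; rewrite w0' mulr0.
- exact: frank.
exists s, bs; split=> //.
  by move=> l; rewrite sP0 => /eqP.
split=> [b bb|l j]; last by rewrite evalMx_line bsr.
(* If f did not vanish at l, the pencil would have corank at most one there, whereas a Jordan block
   at l brings it to at least 3. *)
have [l bl] := bsl b bb; exists l => //; rewrite sP0; apply: contraT => /frank.
move=> rk; have := bsr l 0%N; rewrite -evalMx_line => E.
have := leq_trans (toep0_rank (evalMx c (line x a l)) (evalMx c a)) (leq_sub2l n rk).
rewrite [leqLHS]E (big_rem b bb) /= /jk_height bl eqxx.
have /andP[_ /allP /(_ b bb) bv] : all (@jk_valid F) ((None, e.+1) :: bs) by case: dec.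
rewrite (minn_idPr bv) => le; have : (3 <= n - n.-1)%N by apply: leq_trans le; exact: (leq_addr _ 3).
by clear le; lia.
Qed.

(** The tuple [ns] is read at one root for one generic pair; equal Toeplitz ranks carry it to every
    root and every generic pair. The dimension identity later yields the sum of [ns]. *)
Lemma jk_invariants : exists ns : seq nat, [/\ all (fun m => 0 < m)%N ns,
  n.+1 = (e.+1 * (sumn ns).+1).*2 &
  exists h : {mpoly F[n + n]}, h != 0 /\ forall x a, h.@[join_pt x a] != 0 ->
    exists lams : seq (option F), [/\ uniq lams, size lams = e.+1 &
      exists bs : seq (jkblock F),
        perm_eq bs ((None, e.+1) :: flatten [seq [seq (Some l, m) | m <- ns] | l <- lams]) /\
        jk_decomp (evalMx c x) (evalMx c a) bs]].
Proof.
have [H1 H10 H1P] := generic_simple; have [rho [H2 H20 H2P]] := generic_toep_rank.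
have [f0 _ _] := fP; pose h3 := rename (@rshift n n) f.
have h3E x a : h3.@[join_pt x a] = f.@[a].
  by rewrite meval_rename; apply: meval_eq => k; rewrite join_ptr.
have h30 : h3 != 0.
  have [a fa] := mpoly_nonroot f0; apply: contraNneq fa => h30.
  by rewrite -(h3E a a) h30 rmorph0.
have gen0 : H1 * H2 * h3 != 0 by rewrite !mulf_neq0.
have good x a : (H1 * H2 * h3).@[join_pt x a] != 0 ->
  exists (s : seq F) (bs : seq (jkblock F)), [/\ uniq s, size s = e.+1,
    jk_decomp (evalMx c x) (evalMx c a) ((None, e.+1) :: bs),
    forall b, b \in bs -> exists2 l, l \in s & b.1 = Some (Some l) &
    forall l, l \in s -> all (fun m => 0 < m <= n)%N (jordan_sizes l bs) /\
      forall j : 'I_n, (j.+1 * n - rho j = j.+1 + (\sum_(m <- jordan_sizes l bs) minn m j.+1).*2)%N].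
  rewrite !mevalM !mulf_eq0 !negb_or h3E => /andP[/andP[xa1 xa2] fa].
  have [s [bs [us ss sf dec [bsl bsr]]]] := good_point fa (H1P _ _ xa1).
  exists s, bs; split=> // l ls; split=> [|j]; last by rewrite -sum_height -bsr H2P ?sf.
  have [/andP[_ /allP bv] [szE _]] := dec.
  apply/allP => m /mapP [b]; rewrite mem_filter => /andP[/eqP bl bb] ->.
  have sb : jk_size b = b.2.*2 by rewrite /jk_size bl.
  rewrite (bv b bb : (0 < b.2)%N) -szE big_cons (big_rem b bb) sb.
  apply: leq_trans (leq_addl _ _); apply: leq_trans (leq_addr _ _).
  by rewrite -addnn leq_addr.
have [z0 zP] := mpoly_nonroot gen0.
pose x0 i := z0 (lshift n i); pose a0 i := z0 (rshift n i).
have {zP} xa0 : (H1 * H2 * h3).@[join_pt x0 a0] != 0.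
  rewrite (meval_eq (v2 := z0)) // => k; rewrite -[k]splitK; case: (split k) => i /=.
    by rewrite join_ptl.
  by rewrite join_ptr.
have [s0 [bs0 [us0 ss0 dec0 bsl0 sz0]]] := good _ _ xa0.
pose l0 := head 0 s0; have l0s : l0 \in s0 by rewrite /l0; case: (s0) ss0 => //= l s _; rewrite mem_head.
pose ns := jordan_sizes l0 bs0; have [ns_n nsE] := sz0 l0 l0s.
have perm x a (xa : (H1 * H2 * h3).@[join_pt x a] != 0) :
    exists (s : seq F) (bs : seq (jkblock F)), [/\ uniq s, size s = e.+1,
    jk_decomp (evalMx c x) (evalMx c a) ((None, e.+1) :: bs) &
    perm_eq bs (flatten [seq [seq (Some mu, m) : jkblock F | m <- ns] | mu <- map Some s])].
  have [s [bs [us ss dec bsl sz]]] := good _ _ xa.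
  exists s, bs; split=> //; apply: perm_blocks => // l ls; have [l_n lE] := sz l ls.
  apply: (perm_sizes l_n ns_n) => -[//|j] jn; apply: double_inj.
  by have := lE (Ordinal jn); rewrite (nsE (Ordinal jn)) => /addnI.
exists ns; split.
- by apply/allP => m /(allP ns_n) /andP[].
- have [s [bs [us ss [_ [szE _]] bsE]]] := perm _ _ xa0.
  rewrite -[in LHS]szE big_cons /= (perm_big _ bsE) /= big_flatten !big_map /=.
  rewrite (eq_bigr (fun=> (sumn ns).*2)) => [|l _]; last first.
    by rewrite big_map sumnE -mul2n big_distrr /=; apply: eq_bigr => m _; rewrite /jk_size mul2n.
  rewrite big_const_seq count_predT ss iter_addn_0.
  by rewrite /jk_size /=; move: (sumn ns) => t; clear; nia.
exists (H1 * H2 * h3); split=> // x a xa; have [s [bs [us ss dec bsE]]] := perm x a xa.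
exists (map Some s); split; rewrite ?size_map //.
  by rewrite map_inj_uniq // => ? ? [].
by exists ((None, e.+1) :: bs); split; rewrite ?perm_cons.
Qed.

End GoodPoints.

(** * Assembly in odd dimension *)

Lemma index_unique (F : fieldType) n (c : 'I_n -> 'I_n -> 'I_n -> F) r1 r2 :
  is_index c r1 -> is_index c r2 -> r1 = r2.
Proof.
move=> [r1n [[x1 rk1] max1]] [r2n [[x2 rk2] max2]].
by have := max1 x2; have := max2 x1; rewrite rk1 rk2; lia.
Qed.

Section OddDimension.
Variables (F : numClosedFieldType) (m : nat).
Local Notation n := m.*2.+1.
Local Notation S := {mpoly F[n]}.
Variables (c : 'I_n -> 'I_n -> 'I_n -> F) (p : S).
Hypotheses (lie : is_lie c) (nss : no_proper_semi_inv c).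
Local Notation A := (poissonMx c).

Lemma sub_pf_homog l : sub_pf A l \is m.-homog.
Proof.
rewrite /sub_pf /pf_sum; apply: rpred_sum => s _; rewrite mulr_sign.
have H : \prod_(j < m) mxsub (lift l) (lift l) A (s (even_ord j)) (s (odd_ord j)) \is m.-homog.
  suff : \prod_(j < m) mxsub (lift l) (lift l) A (s (even_ord j)) (s (odd_ord j)) \is (\sum_(j < m) 1)%N.-homog.
    by rewrite sum1_card card_ord.
  elim/big_rec2: _ => [|j d q _ qd]; first exact: dhomog1.
  by apply: dhomogM => //; rewrite mxE; apply: poisson_homog.
by case: (s : bool) => //; rewrite rpredN.
Qed.

Theorem invariants_odd_dimension : is_gcd_of (fun q => exists f : 'I_(n - 1) -> 'I_n,
    injective f /\ q = pfaff (mxsub f f A)) p -> (0 < mdegree p)%N ->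
  let k := ((n + 1)./2 - mdegree p)%N in
  exists f : S,
    [/\ is_invariant c f, mdegree f = k,
        (forall q : {poly F}, peval q f = 0 -> q = 0),
        (forall h : S, is_invariant c h <-> exists q, h = peval q f) &
        exists (a : F) (d : nat),
          [/\ p = a *: f ^+ d, mdegree p = (d * mdegree f)%N &
              exists ns : seq nat,
                [/\ all (fun m => 0 < m)%N ns, sumn ns = d &
                    exists h : {mpoly F[n + n]}, h != 0 /\
                      forall x y : 'I_n -> F, h.@[join_pt x y] != 0 ->
                        exists lams : seq (option F),
                          [/\ uniq lams, size lams = k &
                            exists bs : seq (jkblock F),
                              perm_eq bs ((None, k) ::
                                  flatten [seq [seq (Some l, m) | m <- ns] | l <- lams]) /\
                              jk_decomp (evalMx c x) (evalMx c y) bs]]]].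
Proof.
move=> pgcd pdeg k; have skA := poisson_skew lie.
have [pd pmax] := gcd_sub_pf pgcd.
have p0 : p != 0 by apply: contraTneq pdeg => ->; rewrite /mdegree msize0.
have [l0 pf0] : exists l0, sub_pf A l0 != 0.
  (* If all Pfaffians vanished, 0 would divide them all and hence [p]. *)
  apply: NNPP => H; case/eqP: p0; have [|q ->] := pmax 0; last by rewrite mulr0.
  move=> l; have [->|pl] := eqVneq (sub_pf A l) 0; last by case: H; exists l.
  by exists 0; rewrite mul0r.
have [g [Q [g0 Ql0 QE adjE Qker]]] := pfaffian_vector skA pf0.
have [w wE] : exists w, forall i, Q i = p * w i.
  apply: (@fin_all_exists _ (fun=> S) (fun i v => Q i = p * v)) => i.
  have [v vE] := pd i; case: (QE i) => ->; first by exists v; rewrite vE mulrC.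
  by exists (- v); rewrite vE mulrN mulrC.
have wker i : \sum_j A i j * w j = 0.
  apply: (mulfI p0); rewrite mulr0 -[RHS](Qker i) mulr_sumr; apply: eq_bigr => j _.
  by rewrite wE mulrCA.
have wl0 : w l0 != 0 by apply: contraNneq Ql0 => E; rewrite wE E mulr0.
(* A common prime factor [q] of the [w i] would make [q * p] divide all Pfaffians, hence [p]. *)
have wprim q : prime_elt q -> exists i, ~ rdvd q (w i).
  move=> [q0 qu _]; apply: NNPP => H; case/negP: qu.
  have [|t tE] := pmax (q * p).
    move=> l; have [t tE] : rdvd q (w l) by apply: NNPP => nd; apply: H; exists l.
    have Ql : Q l = t * (q * p) by rewrite wE tE mulrC mulrA.
    case: (QE l) => E; first by exists t; rewrite -E.
    by exists (- t); rewrite mulNr -Ql E opprK.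
  have tq : t * q = 1 by apply: (mulIf p0); rewrite mul1r -mulrA.
  by apply/unitrPr; exists t; rewrite mulrC.
have Qhom i : Q i \is m.-homog.
  by case: (QE i) => ->; rewrite ?rpredN; apply: sub_pf_homog.
have [dp phom dpm] : exists2 d, p \is d.-homog & (d <= m)%N.
  by apply: (homog_factor (q := w l0) wl0); rewrite -wE.
have pdE : mdegree p = dp by apply: homog_mdegree.
pose e := (m - dp)%N.
have whom i : w i \is e.-homog.
  have [->|wi0] := eqVneq (w i) 0; first exact: rpred0.
  have wp : w i * p \is m.-homog by rewrite mulrC -wE.
  exact: (homog_div p0 wi0 phom wp).1.
have wline (u : 'I_n -> S) : (forall i, \sum_j A i j * u j = 0) -> forall i j, u i * w j = u j * w i.
  move=> uker i j; have := skew_kernel_line skA g0 Ql0 adjE Qker uker i j.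
  by rewrite !wE !(mulrCA _ p) => /(mulfI p0).
have [chi chiE] := ham_kernel lie wker wprim whom wl0 wline.
have evA v : (map_mx (meval v) A)^T = - map_mx (meval v) A.
  by rewrite map_trmx skA map_mxN.
have det0 : \det A = 0.
  by apply: mpoly_eq0P => v; rewrite -det_map_mx; exact: skew_odd_det (evA v).
have adjS : (\adj A)^T = \adj A.
  apply/matrixP => i j; apply: (@mpoly_eqP_eval F n) => v.
  have := skew_odd_adj (evA v); rewrite -map_mx_adj => /matrixP /(_ i j).
  by rewrite !mxE.
have adjE' i : (\adj A) i l0 = g *: (p * w i * (p * w l0)) by rewrite adjE !wE.
have ham_p : forall i, ham c i p = 0.
  exact: (semi_inv_trivial nss p0 (ham_gcd lie wl0 g0 adjE' adjS det0 p0 chiE)).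
have [q0 q0E q0r] := invariant_euler wprim wl0 wline ham_p phom.
have rad0 : radial w != 0.
  apply: contraTneq pdeg => r0; move/eqP: q0r.
  by rewrite r0 mulr0 -scaler_nat scaler_eq0 (negPf p0) orbF pnatr_eq0 pdE lt0n negbK.
have ham_rad : forall i, ham c i (radial w) = 0.
  exact: (semi_inv_trivial nss rad0 (ham_radial wker chiE)).
have fP := radial_prime wprim whom wl0 wline nss rad0 ham_rad.
have grad := radial_gradient wprim whom wl0 wline rad0 ham_rad.
have fdeg : mdegree (radial w) = e.+1 by apply: homog_mdegree rad0 (radial_homog whom).
have [a [d [pE dE]]] := homog_invariant wprim whom wl0 wline rad0 ham_rad ham_p phom p0.
have kE : k = e.+1.
  by rewrite /k addn1 pdE -doubleS doubleK subSn.
(* The whole adjugate is g p^2 w w^T. Where f does not vanish, neither do p, a scalar multiple of a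
   power of f, and some w_i; so the corank is one there. *)
have adjw i j : (\adj A) i j = g *: (p * w i * (p * w j)).
  have ker r : \sum_s A r s * (\adj A) s j = 0.
    by have /matrixP/(_ r j) := mul_mx_adj A; rewrite det0 !mxE mul0rn.
  apply: (mulIf wl0); rewrite (wline _ ker).
  have -> : (\adj A) l0 j = (\adj A) j l0 by rewrite -[in LHS]adjS mxE.
  by rewrite adjE' -!scalerAl; congr (_ *: _); ring.
have frank y : (radial w).@[y] != 0 -> (n.-1 <= \rank (evalMx c y))%N.
  move=> fy; have [i wi] : exists i, (w i).@[y] != 0.
    apply: NNPP => H; case/eqP: fy; rewrite raddf_sum big1 // => i _; rewrite /= mevalM.
    have [->|wi] := eqVneq (w i).@[y] 0; first by rewrite mulr0.
    by case: H; exists i.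
  apply: adj_neq0_rank; apply/eqP => /matrixP /(_ i i).
  rewrite evalMxE -map_mx_adj mxE adjw /= mevalZ !mevalM [RHS]mxE => /eqP.
  rewrite !mulf_eq0 (negPf g0) (negPf wi) orbF orbb /= pE mevalZ rmorphXn /=.
  rewrite mulf_eq0 expf_eq0 (negPf fy) andbF orbF => /eqP a0.
  by move/eqP: p0; rewrite pE a0 scale0r.
have [ns [ns0 nE [h hP]]] := jk_invariants (fun i j k => (lie.1 i j k)) whom wker fP grad frank.
exists (radial w); split.
- exact/invariant_ham.
- by rewrite fdeg kE.
- exact: peval_inj whom rad0.
- exact: invariant_peval wprim whom wl0 wline rad0 ham_rad.
exists a, d; rewrite fdeg pdE; split=> //; exists ns; split=> //; last by exists h; rewrite kE.
(* Two counts of [m.+1]: from the blocks it is [e.+1 * (sumn ns).+1], and from [m = dp + e] with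
   [dp = d * e.+1] it is [e.+1 * d.+1]. *)
have {}nE : (m.+1 = e.+1 * (sumn ns).+1)%N by apply: double_inj; rewrite -nE doubleS.
have : (e.+1 * (sumn ns).+1 = e.+1 * d.+1)%N.
  by rewrite -nE mulnS [(e.+1 * d)%N]mulnC -dE /e addSn subnK.
by move/eqP; rewrite eqn_pmul2l // eqSS => /eqP.
Qed.

End OddDimension.

(** In even dimension the order n - 1 is odd, where [pfaff] is 0 by convention; then 0 divides all
    of them and so [p], against its positive degree. *)
Lemma fund_semiinv_odd (F : fieldType) n (c : 'I_n -> 'I_n -> 'I_n -> F) (p : {mpoly F[n]}) :
  is_index c 1 -> fund_semiinv c p -> (0 < mdegree p)%N ->
  exists m, n = m.*2.+1 /\ is_gcd_of (fun q => exists f : 'I_(n - 1) -> 'I_n,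
    injective f /\ q = pfaff (mxsub f f (poissonMx c))) p.
Proof.
move=> idx [r [/(index_unique idx) <- pgcd]] pdeg; exists (n.-1)./2; split=> //.
have n0 : (0 < n)%N by case: idx.
case: (boolP (odd (n - 1))) => [odd1|]; last by rewrite subn1 => ev; rewrite even_halfK // prednK.
have [|q pE] := pgcd.2 0.
  by move=> q [f [_ ->]]; exists 0; rewrite /pfaff odd1 mulr0.
by move: pdeg; rewrite pE mulr0 /mdegree msize0.
Qed.

Unset Implicit Arguments.
Set Strict Implicit.
Set Printing Implicit Defensive.

Theorem theorem27 (R : realType) (n : nat) (c : 'I_n -> 'I_n -> 'I_n -> R[i])
    (p : {mpoly R[i][n]}) :
  is_lie c ->
  no_proper_semi_inv c ->
  is_index c 1 ->
  fund_semiinv c p ->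
  (0 < mdegree p)%N ->
  let k := ((n + 1)./2 - mdegree p)%N in
  exists f : {mpoly R[i][n]},
    [/\ is_invariant c f,
        mdegree f = k,
        (forall q : {poly R[i]}, peval q f = 0 -> q = 0),
        (forall h : {mpoly R[i][n]}, is_invariant c h <-> exists q, h = peval q f) &
        exists (a : R[i]) (d : nat),
          [/\ p = a *: f ^+ d,
              mdegree p = (d * mdegree f)%N &
              exists ns : seq nat,
                [/\ all (fun m => 0 < m)%N ns, sumn ns = d &
                    exists h : {mpoly R[i][n + n]}, h != 0 /\
                      forall x y : 'I_n -> R[i], h.@[join_pt x y] != 0 ->
                        exists lams : seq (option R[i]),
                          [/\ uniq lams, size lams = k &
                            exists bs : seq (jkblock R[i]),
                              perm_eq bs ((None, k) ::
                                  flatten [seq [seq (Some l, m) | m <- ns] | l <- lams]) /\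
                              jk_decomp (evalMx c x) (evalMx c y) bs]]]].
Proof.
move=> lie nss idx fund pdeg.
have [m [nE pgcd]] := fund_semiinv_odd idx fund pdeg.
by subst n; exact: invariants_odd_dimension lie nss pgcd pdeg.
Qed.
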